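(* Let $G$ be a connected simple undirected graph (not necessarily finite) satisfying the interval condition and the local positioning condition, and having at least one vertex with finitely many neighbors. Then the fundamental group $\pi_1(X(G))$ of the triangle-square complex $X(G)$ of $G$ is finite.
   Context: For a graph $G$, $d(u,v)$ is the shortest-path distance, and the interval between $u$ and $v$ is $I(u,v)=\{x: d(u,x)+d(x,v)=d(u,v)\}$. A triangle is a 3-cycle and a square is an induced 4-cycle of $G$. A pyramid is the wheel $W_4$ (a 4-cycle plus a vertex adjacent to all four of its vertices). An octahedron is $K_6$ minus a perfect matching. The triangle-square complex $X(G)$ is the 2-dimensional cell complex whose 1-skeleton is $G$ and whose 2-cells are a triangular cell attached along each triangle of $G$ and a square cell attached along each square of $G$. Interval condition: for any $u,v$ with $d(u,v)=2$, the subgraph induced by $I(u,v)$ is a square, a pyramid, or an octahedron. Local positioning condition: for every square $u_1u_2u_3u_4$ of $G$ (vertices in cyclic order) and every vertex $v$ with $d(v,u_1)=d(v,u_3)=2$, one has $d(v,u_2)+d(v,u_4)=4$. *)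

(* Defs.v *)
From HB Require Import structures.
From mathcomp Require Import all_boot all_order all_algebra.
From mathcomp Require Import all_classical all_reals all_analysis.
From mathcomp Require Import homotopy.
Set Implicit Arguments.
Unset Strict Implicit.
Unset Printing Implicit Defensive.
Import Order.TTheory GRing.Theory Num.Theory.
Import numFieldNormedType.Exports.
Local Open Scope classical_set_scope.
Local Open Scope ring_scope.

(** * Graphs, possibly infinite *)

(* Classically, every type carries a choiceType structure and every relation is
   boolean, so these choices do not restrict the class of graphs. *)
Record graph := Graph {
  vertex :> choiceType;
  adj : rel vertex;
  adj_sym : symmetric adj;
  adj_irrefl : irreflexive adj }.

Arguments adj {g}.

Section GraphNotions.
Variable G : graph.
Implicit Types u v w x : G.

Definition has_walk u v (n : nat) : bool :=
  `[< exists p : seq G, [/\ path adj u p, last u p = v & size p = n] >].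

Definition connected_graph : Prop := forall u v, exists n, has_walk u v n.

(* The value 0 between distinct components is a dummy; only connected graphs
   are considered. *)
Definition gdist u v : nat :=
  if pselect (exists n, has_walk u v n) is left h then ex_minn h else 0%N.

Definition ginterval u v : set G :=
  [set x | (gdist u x + gdist x v)%N = gdist u v].

Definition triangle (a b c : G) : Prop := [/\ adj a b, adj b c & adj c a].

(* An induced 4-cycle, with its vertices listed in cyclic order. *)
Definition square (a b c d : G) : Prop :=
  [/\ adj a b, adj b c, adj c d & adj d a] /\
  [/\ a != c, b != d, ~~ adj a c & ~~ adj b d].

(* The subgraph of G induced by A is isomorphic to the finite graph H. *)
Definition induces (A : set G) (T : finType) (H : rel T) : Prop :=
  exists f : T -> G,
    [/\ injective f, range f = A & forall i j, adj (f i) (f j) = H i j].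

End GraphNotions.

Definition cycle4 : rel 'I_4 := fun i j => (j == ordS i) || (i == ordS j).

(* The wheel W_4: None is the hub. *)
Definition wheel4 : rel (option 'I_4) := fun a b =>
  match a, b with
  | Some i, Some j => cycle4 i j
  | None, None => false
  | _, _ => true
  end.

(* K_6 minus the perfect matching {01, 23, 45}. *)
Definition octahedron : rel 'I_6 := fun i j => (i != j) && (i./2 != j./2).

Definition interval_condition (G : graph) : Prop :=
  forall u v : G, gdist u v = 2%N ->
    [\/ induces (ginterval u v) cycle4,
        induces (ginterval u v) wheel4
      | induces (ginterval u v) octahedron].

Definition local_positioning_condition (G : graph) : Prop :=
  forall u1 u2 u3 u4 v : G, square u1 u2 u3 u4 ->
    gdist v u1 = 2%N -> gdist v u3 = 2%N ->
    (gdist v u2 + gdist v u4)%N = 4%N.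

(** * The triangle-square complex *)

(* Points are represented by their barycentric coordinates, that is, by
   functions G -> R. A vertex v is its indicator function, edges and triangles
   are the simplices on their vertices, and the cell of a square a b c d is the
   image of the unit square under the bilinear map sending the corners (0,0),
   (1,0), (1,1), (0,1) to a, b, c, d. This map is injective, restricts to the
   edges of the 4-cycle on the boundary, and takes only values with full support
   {a, b, c, d} on the interior. Hence distinct cells, whose vertex sets are
   distinct, have disjoint interiors, and different listings of the vertices of
   one triangle or one square yield the same cell. *)
Section Complex.
Variables (R : realType) (G : graph).

Definition vertex_pt (v : G) : G -> R := fun x => (x == v)%:R.

Definition vertex_cell (v : G) : set (G -> R) := [set vertex_pt v].

Definition edge_cell (a b : G) : set (G -> R) :=
  [set w | exists p q : R, [/\ 0 <= p, 0 <= q, p + q = 1 &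
    w = fun x => p * vertex_pt a x + q * vertex_pt b x]].

Definition triangle_cell (a b c : G) : set (G -> R) :=
  [set w | exists p q r : R, [/\ 0 <= p, 0 <= q, 0 <= r, p + q + r = 1 &
    w = fun x => p * vertex_pt a x + q * vertex_pt b x + r * vertex_pt c x]].

Definition square_cell (a b c d : G) : set (G -> R) :=
  [set w | exists s t : R, [/\ 0 <= s <= 1, 0 <= t <= 1 &
    w = fun x => (1 - s) * (1 - t) * vertex_pt a x + s * (1 - t) * vertex_pt b x
               + s * t * vertex_pt c x + (1 - s) * t * vertex_pt d x]].

Inductive closed_cell : set (G -> R) -> Prop :=
| VertexCell v : closed_cell (vertex_cell v)
| EdgeCell a b of adj a b : closed_cell (edge_cell a b)
| TriangleCell a b c of triangle a b c : closed_cell (triangle_cell a b c)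
| SquareCell a b c d of square a b c d : closed_cell (square_cell a b c d).

Record tsq_complex := TsqComplex {
  coords :> G -> R;
  coords_cell : exists2 C, closed_cell C & C coords }.

HB.instance Definition _ := gen_eqMixin tsq_complex.
HB.instance Definition _ := gen_choiceMixin tsq_complex.

(* The weak (CW) topology: U is open iff it meets every closed cell in a
   relatively open set. Each closed cell carries the topology of pointwise
   convergence, which is its Euclidean topology, as the cell lies in the span of
   at most four vertices. *)
Definition tsq_open (U : set tsq_complex) : Prop :=
  forall C, closed_cell C ->
    exists2 O : set {ptws G -> R}, open O &
      forall x : tsq_complex, C x -> (U x <-> O (coords x)).

Lemma tsq_openT : tsq_open setT.
Proof. by move=> C _; exists setT => //; exact: openT. Qed.

Lemma tsq_openI : setI_closed tsq_open.
Proof.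
move=> U W oU oW C cC; have [A oA AU] := oU C cC; have [P oP PW] := oW C cC.
exists (A `&` P) => [|x Cx]; first exact: openI.
by have [? ?] := AU x Cx; have [? ?] := PW x Cx; split=> -[]; split; auto.
Qed.

Lemma tsq_open_bigU (I : Type) (F : I -> set tsq_complex) :
  (forall i, tsq_open (F i)) -> tsq_open (\bigcup_i F i).
Proof.
move=> oF C cC.
have /(@choice I) [A AP] (i : I) : exists A : set {ptws G -> R}, open A /\
    forall x : tsq_complex, C x -> (F i x <-> A (coords x)).
  by have [A ? ?] := oF i C cC; exists A.
exists (\bigcup_i A i) => [|x Cx].
  by apply: bigcup_open => i _; case: (AP i).
by split=> -[i _ ?]; exists i => //; apply/((AP i).2 x Cx).
Qed.

HB.instance Definition _ :=
  isOpenTopological.Build tsq_complex tsq_openT tsq_openI tsq_open_bigU.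

End Complex.

(** * Fundamental group *)

Section UnitInterval.
Variable R : realType.

Definition unit_itv : Type := set_type [set` `[(0 : R), 1]].

Lemma unit_itv0_subproof : (0 : R) \in [set` `[(0 : R), 1]].
Proof. by rewrite inE /= in_itv /= lexx ler01. Qed.

Lemma unit_itv1_subproof : (1 : R) \in [set` `[(0 : R), 1]].
Proof. by rewrite inE /= in_itv /= lexx ler01. Qed.

Definition unit_itv0 : unit_itv := exist _ 0 unit_itv0_subproof.
Definition unit_itv1 : unit_itv := exist _ 1 unit_itv1_subproof.

Lemma unit_itv01 : unit_itv0 != unit_itv1.
Proof. by apply/eqP => /(congr1 val) /= /eqP; rewrite eq_sym oner_eq0. Qed.

HB.instance Definition _ := Topological.on unit_itv.
HB.instance Definition _ :=
  isBiPointed.Build unit_itv unit_itv01.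

End UnitInterval.

Section FundamentalGroup.
Variables (R : realType) (T : topologicalType) (x0 : T).

Definition loop : Type := {path (unit_itv R) from x0 to x0 in T}.

(* Homotopy relative to the endpoints. *)
Definition loop_homotopic (p q : loop) : Prop :=
  exists H : unit_itv R * unit_itv R -> T,
    [/\ continuous H,
        (forall t, H (zero, t) = p t) /\ (forall t, H (one, t) = q t)
      & (forall s, H (s, zero) = x0) /\ (forall s, H (s, one) = x0)].

(* The underlying set of the fundamental group of T at x0, which is all that
   its finiteness depends on: the set of homotopy classes of loops. *)
Definition pi1 : set (set loop) :=
  [set [set q | loop_homotopic p q] | p in [set: loop]].

End FundamentalGroup.

Arguments loop R {T} x0.
Arguments pi1 R {T} x0.

(* Main.v *)
Require Import Defs.
From mathcomp Require Import all_boot all_order all_algebra.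
From mathcomp Require Import finmap.
From mathcomp Require Import all_classical all_reals all_analysis.
From mathcomp Require Import homotopy.
From mathcomp Require Import zify ring lra.
Set Implicit Arguments.
Unset Strict Implicit.
Unset Printing Implicit Defensive.
Local Open Scope classical_set_scope.

(** Why the fundamental group is finite.

The idea is to follow, along a closed walk at a vertex v of finite degree, the
distance function of the universal cover: although it is not defined on the graph,
its restriction to closed neighbourhoods can be carried from vertex to vertex. The
way in which it returns to v only leaves finitely many possibilities, and it tells
whether the walk is contractible.

Precisely, a germ at u is a function on the closed neighbourhood of u that behaves
like the distance to some base vertex, and germs at adjacent vertices are compatible
if they look like restrictions of one distance function, where the steps along
opposite sides of a square are equal. By the interval and local positioning
conditions, the germs that arise have exactly one compatible germ at every adjacent
vertex ([compat_uniq], [good_step]), and composing these transports around a triangle or a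
square gives the identity ([compat_tri], [compat_square]). Both facts come down to
the possible positions of few vertices around two or three faces. There the interval
condition says that everything between two vertices at distance two lies in an
octahedron, and local positioning closes up cubes; the many cases in which the
relations between the vertices are contradictory are left to a refutation procedure
whose output is checked in the logic.

Start at v with the germ of the distance to v, of value 0 at v and 1 at its
neighbours. The germ that returns along a closed walk is determined, up to a constant,
by the set of neighbours of v at which it is smaller than at v ([germ_determined]).
If two closed walks p and q give the same set, then the transport along p followed by
the inverse of q returns a germ for which all neighbours of v are larger than v. In
such a case the walk is contractible by a mountain pass argument: a visit of highest
level can be pushed down across a triangle or a square that exists by the properties
of the germ there ([bypass], [lower_walk]), until the whole walk is at level 0 and
thus constant ([contract_walk]). So closed walks at v fall into at most 2^d homotopy
classes, where d is the degree of v ([walk_code]).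

It remains to compare loops in the complex with walks. Homotopic walks give homotopic
paths, as the moves across triangles and squares take place in a closed cell
([walk_homot_sound]). Conversely, the open star of each vertex, the set of points with
positive coordinate there, contracts to that vertex along tracks that stay in each
closed cell ([ctr_continuous]). A path is locally contained in such stars, hence
homotopic to a walk up to the tracks of its two ends ([path_walk]). Therefore a loop at
x0 is determined up to homotopy by the code of a closed walk at v ([pi1_finite]). *)

(** * Refuting finite configurations by reflection *)

(** Two vertices are equal, adjacent or apart. A mask is the set of those of the
three relations that are still possible for a pair; a finite configuration is a
list of facts, each restricting one pair of indices to a mask. *)
Inductive mask := Mask of bool & bool & bool.

Definition mask_eq m := let: Mask e _ _ := m in e.
Definition mask_adj m := let: Mask _ a _ := m in a.
Definition mask_far m := let: Mask _ _ n := m in n.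
Definition mask_meet m1 m2 :=
  let: Mask e a n := m1 in let: Mask e' a' n' := m2 in
  Mask (e && e') (a && a') (n && n').
Definition mask_compl m := let: Mask e a n := m in Mask (~~ e) (~~ a) (~~ n).

Definition onlyE := Mask true false false.
Definition onlyA := Mask false true false.
Definition onlyN := Mask false false true.
Definition anyrel := Mask true true true.

Definition is_E m := let: Mask _ a n := m in ~~ a && ~~ n.
Definition is_A m := let: Mask e _ n := m in ~~ e && ~~ n.
Definition is_N m := let: Mask e a _ := m in ~~ e && ~~ a.
Definition is_void m := let: Mask e a n := m in [&& ~~ e, ~~ a & ~~ n].

Definition fact : Type := (nat * nat * mask)%type.

(** A refutation tree: its leaves are violations of the axioms of equality and
adjacency or of one of the rules of the graph, and [Cut] branches on whether the
relation of a pair lies in a mask or in its complement. *)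
Inductive cert :=
| Void of nat & nat
| Subst of nat & nat & nat
| Clique of nat & nat & nat & nat & nat
| Mates of nat & nat & nat & nat & nat
| Position of nat & nat & nat & nat & nat & nat
| Cut of nat & nat & mask & cert & cert.

Definition lookup (s : seq fact) i j : mask :=
  foldr (fun f m => let: (i', j', m') := f in
    if (i == i') && (j == j') || (i == j') && (j == i') then mask_meet m' m else m)
    anyrel s.

Fixpoint check (s : seq fact) (c : cert) : bool :=
  let A i j := is_A (lookup s i j) in
  let N i j := is_N (lookup s i j) in
  match c with
  | Void i j => is_void (lookup s i j)
  | Subst i j k => is_E (lookup s i j) && is_void (mask_meet (lookup s i k) (lookup s j k))
  | Clique u z x y t =>
      [&& N u z, A u x, A u y, A u t, A z x, A z y, A z t, A x y, A x t & A y t]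
  | Mates u z x y t =>
      [&& N u z, A u x, A u y, A u t, A z x, A z y, A z t, N x y, N x t &
          ~~ mask_eq (lookup s y t)]
  | Position v a b c d e =>
      [&& A a b, A b c, A c d, A d a, N a c & N b d] &&
      [&& N v a, N v b, N v c, A v d, A v e & A e b]
  | Cut i j m c1 c2 =>
      check ((i, j, m) :: s) c1 && check ((i, j, mask_compl m) :: s) c2
  end.

(** The search below is a lookahead procedure with backtracking. Nothing is
proved about it: it only proposes trees, which [check] validates. *)
Section Search.
Variable n : nat.
Definition table := seq (seq mask).
Definition mget (M : table) i j := nth anyrel (nth [::] M i) j.
Definition mset1 (M : table) i j m : table :=
  set_nth [::] M i (set_nth anyrel (nth [::] M i) j m).
Definition mset M i j m := mset1 (mset1 M i j m) j i m.

Fixpoint find_some (T S : Type) (f : T -> option S) (s : seq T) : option S :=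
  if s is x :: s' then if f x is Some y then Some y else find_some f s' else None.

Definition conflict (M : table) : option cert :=
  let I := iota 0 n in
  let A i j := is_A (mget M i j) in
  let N i j := is_N (mget M i j) in
  let nb i := [seq j <- I | A i j] in
  let nn i := [seq j <- I | N i j] in
  let k0 := find_some (fun i => find_some (fun j =>
     if (i < j) && is_E (mget M i j) then
       find_some (fun k => if is_void (mask_meet (mget M i k) (mget M j k))
                       then Some (Subst i j k) else None) I
     else None) I) I in
  if k0 is Some c then Some c else
  let k12 := find_some (fun u => find_some (fun z =>
     if z < u then None else
     let C := [seq x <- nb u | A z x] in
     find_some (fun x => find_some (fun y => find_some (fun t =>
        if A x y then if A x t && A y t then Some (Clique u z x y t) else None
        else if [&& N x y, N x t & ~~ mask_eq (mget M y t)]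
             then Some (Mates u z x y t) else None) C) C) C) (nn u)) I in
  if k12 is Some c then Some c else
  find_some (fun v => let av := nb v in find_some (fun d =>
     let X := [seq a <- nb d | N v a] in
     find_some (fun a => find_some (fun c => if N a c then
        find_some (fun b => if [&& A c b, N d b & N v b] then
           find_some (fun e => if A e b then Some (Position v a b c d e) else None) av
        else None) (nb a) else None) X) X) av) I.

Definition values := [:: onlyE; onlyA; onlyN].
Definition all_triples : seq fact :=
  let I := iota 0 n in
  [seq (ij, m) | ij <- [seq ij <- [seq (i, j) | i <- I, j <- I] | ij.1 < ij.2],
                 m <- values].

Fixpoint search (fuel : nat) (todo : seq fact) (chg : bool) (M : table)
  : option cert :=
  if fuel is fuel'.+1 then
    match todo with
    | (i, j, b) :: todo' =>
      let m := mget M i j in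
      if is_void (mask_meet m b) then search fuel' todo' chg M else
      if conflict (mset M i j b) is Some c then
        let m' := mask_meet m (mask_compl b) in
        if is_void m' then Some (Cut i j b c (Void i j)) else
        if search fuel' todo' true (mset M i j m') is Some c'
        then Some (Cut i j b c c') else None
      else search fuel' todo' chg M
    | [::] =>
      if chg then search fuel' all_triples false M else
      let unres := [seq f <- all_triples | let: (i, j, b) := f in
          ~~ is_void (mask_meet (mget M i j) b) && ~~ is_void (mask_meet (mget M i j) (mask_compl b))] in
      if unres is (i, j, b) :: _ then
        if search fuel' all_triples false (mset M i j b) is Some c then
        if search fuel' all_triples false (mset M i j (mask_meet (mget M i j) (mask_compl b)))
           is Some c' then Some (Cut i j b c c') else None else None
      else None
    end
  else None.

Definition table_of (s : seq fact) : table :=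
  let M0 := [seq [seq (if i == j then onlyE else anyrel) | j <- iota 0 n] | i <- iota 0 n] in
  foldl (fun M f => let: (i, j, m) := f in mset M i j (mask_meet (mget M i j) m)) M0 s.

Definition find_cert (s : seq fact) : option cert :=
  let M := table_of s in
  if find_some (fun f : fact => let: (i, j, _) := f in
       if is_void (mget M i j) then Some (Void i j) else None) all_triples is Some c
  then Some c else
  (* a bound never reached for the configurations below *)
  if conflict M is Some c then Some c else search 20000 all_triples false M.

End Search.

(** * Local rules and germs *)
Section Graph.
Variables (V : eqType) (adj : rel V).
Hypothesis adj_sym : symmetric adj.
Hypothesis adj_irr : irreflexive adj.

(** When x and y have a common neighbour, being apart means being at distance two. *)
Definition nadj x y := (x != y) && ~~ adj x y.
Definition sq a b c d :=
  [&& adj a b, adj b c, adj c d, adj d a, nadj a c & nadj b d].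

(** The interval and local positioning conditions in first-order form. The
common neighbours of two vertices at distance two lie in an octahedron, so that
no three of them are pairwise adjacent, and each of them is apart from at most
one other. The third rule is local positioning when the corner d of the square is
adjacent to v: the opposite corner b has to be at distance three from v. *)
Hypothesis clique_free : forall u z x y t, nadj u z -> adj u x -> adj u y -> adj u t ->
  adj z x -> adj z y -> adj z t -> adj x y -> adj x t -> adj y t -> False.
Hypothesis mate_unique : forall u z x y t, nadj u z -> adj u x -> adj u y -> adj u t ->
  adj z x -> adj z y -> adj z t -> nadj x y -> nadj x t -> y = t.
Hypothesis near_position : forall v a b c d e, sq a b c d -> nadj v a -> nadj v b -> nadj v c ->
  adj v d -> adj v e -> adj e b -> False.

Definition holds m x y :=
  [|| mask_eq m && (x == y), mask_adj m && adj x y | mask_far m && nadj x y].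

Lemma holds_mask_meet m1 m2 x y : holds (mask_meet m1 m2) x y = holds m1 x y && holds m2 x y.
Proof.
rewrite /holds /nadj; case: m1 m2 => [e a n] [e' a' n'] /=.
case: eqVneq => [->|_] /=; last by case: adj; rewrite ?andbF ?andbT ?orbF.
by rewrite adj_irr ?andbF ?andbT ?orbF.
Qed.

Lemma holds_mask_compl m x y : holds (mask_compl m) x y = ~~ holds m x y.
Proof.
rewrite /holds /nadj; case: m => [e a n] /=.
case: eqVneq => [->|_] /=; last by case: adj; rewrite ?andbF ?andbT ?orbF.
by rewrite adj_irr ?andbF ?andbT ?orbF.
Qed.

Lemma nadj_sym x y : nadj x y = nadj y x.
Proof. by rewrite /nadj eq_sym adj_sym. Qed.

Lemma holds_sym m x y : holds m x y = holds m y x.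
Proof. by rewrite /holds eq_sym adj_sym nadj_sym. Qed.

Definition models (rho : nat -> V) (s : seq fact) : bool :=
  all (fun f : fact => let: (i, j, m) := f in holds m (rho i) (rho j)) s.

Lemma models_lookup rho s i j :
  models rho s -> holds (lookup s i j) (rho i) (rho j).
Proof.
elim: s => [|[[i' j'] m] s IHs] /=.
  by rewrite /holds /nadj /=; case: eqP => //= _; case: adj.
case/andP=> hm /IHs {}IHs; case: ifP => // /orP[] /andP[/eqP Ei /eqP Ej].
  by rewrite holds_mask_meet IHs andbT Ei Ej.
by rewrite holds_mask_meet IHs andbT Ei Ej holds_sym.
Qed.

(** Each leaf is an instance of irreflexivity, of substitution or of one of the
three rules; a [Cut] is an instance of excluded middle, the two masks being
complementary. *)
Lemma check_sound rho s c : models rho s -> check s c = true -> False.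
Proof.
have hA s' i j : models rho s' -> is_A (lookup s' i j) -> adj (rho i) (rho j).
  move=> /(@models_lookup rho s' i j); case: lookup => [[] a []] //=.
  by rewrite /holds /= orbF => /andP[].
have hN s' i j : models rho s' -> is_N (lookup s' i j) -> nadj (rho i) (rho j).
  move=> /(@models_lookup rho s' i j); case: lookup => [[] [] n] //=.
  by rewrite /holds /= => /andP[].
elim: c s => [i j|i j k|u z x y t|u z x y t|v a b c d e|i j m c1 IH1 c2 IH2] s hs /=.
- by move: (@models_lookup rho s i j hs); case: lookup => [[] [] []].
- move: (@models_lookup rho s i j hs) (@models_lookup rho s i k hs) (@models_lookup rho s j k hs).
  case: (lookup s i j) => [e [] []] //=; rewrite /holds /= orbF => /andP[_ /eqP ->].
  rewrite -!/(holds _ _ _) => h1 h2.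
  have: holds (mask_meet (lookup s i k) (lookup s j k)) (rho j) (rho k) by rewrite holds_mask_meet h1.
  by case: mask_meet => [[] [] []].
- by move=> /and5P[? ? ? ? /and5P[? ? ? ? /andP[]]] *;
     apply: (@clique_free (rho u) (rho z) (rho x) (rho y) (rho t)); apply: hA hs _ || apply: hN hs _.
- move=> /and5P[? ? ? ? /and5P[? ? ? ? /andP[? ne]]].
  have Eyt : rho y = rho t.
    by apply: (@mate_unique (rho u) (rho z) (rho x) (rho y) (rho t)); apply: hA hs _ || apply: hN hs _.
  move: (@models_lookup rho s y t hs) ne; rewrite Eyt /holds /nadj eqxx adj_irr /=.
  by case: lookup => [[] a' n] /=; rewrite ?andbF.
- case/andP=> /and5P[? ? ? ? /andP[? ?]] /and5P[? ? ? ? /andP[? ?]].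
  apply: (@near_position (rho v) (rho a) (rho b) (rho c) (rho d) (rho e));
    try (by apply: hA hs _); try (by apply: hN hs _).
  by rewrite /sq !(hA s, hN s).
- case/andP=> h1 h2; case: (boolP (holds m (rho i) (rho j))) => h.
    by apply: IH1 h1; rewrite /= h.
  by apply: IH2 h2; rewrite /= holds_mask_compl h.
Qed.

Lemma fact_eq x y : x = y -> holds onlyE x y.
Proof. by rewrite /holds => ->; rewrite eqxx. Qed.

Lemma fact_eqb x y : x == y -> holds onlyE x y.
Proof. by move/eqP; apply: fact_eq. Qed.

Lemma fact_adj x y : adj x y -> holds onlyA x y.
Proof. by rewrite /holds /= => ->. Qed.

Lemma fact_nadj x y : nadj x y -> holds onlyN x y.
Proof. by rewrite /holds /= => ->. Qed.

Lemma fact_neq x y : x != y -> holds (mask_compl onlyE) x y.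
Proof. by rewrite holds_mask_compl /holds /= orbF. Qed.

Lemma fact_notadj x y : ~~ adj x y -> holds (mask_compl onlyA) x y.
Proof. by rewrite holds_mask_compl /holds /= orbF. Qed.

Lemma fact_notnadj x y : ~~ nadj x y -> holds (mask_compl onlyN) x y.
Proof. by rewrite holds_mask_compl /holds /=. Qed.

Lemma models_nil rho : models rho [::]. Proof. by []. Qed.
Lemma models_cons rho i j m s :
  holds m (rho i) (rho j) -> models rho s -> models rho ((i, j, m) :: s).
Proof. by rewrite /= => -> ->. Qed.

Ltac index x l := lazymatch l with
  | x :: _ => constr:(0)
  | _ :: ?l' => let k := index x l' in constr:(S k)
  end.

Ltac unpack_sq := repeat match goal with
  | H : is_true (sq _ _ _ _) |- _ =>
    let h1 := fresh "hs" in let h2 := fresh "hs" in let h3 := fresh "hs" in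
    let h4 := fresh "hs" in let h5 := fresh "hs" in let h6 := fresh "hs" in
    case/and5P: (H) => h1 h2 h3 h4 /andP[h5 h6]; clear H
  end.

Ltac add_fact rho l M x y pf H :=
  let i := index x l in let j := index y l in
  let M' := fresh "M" in
  pose proof (models_cons (rho := rho) (i := i) (j := j) (pf x y H) M) as M';
  clear M H; rename M' into M.

Ltac config_false l :=
  exfalso; unpack_sq;
  let d := lazymatch l with ?x :: _ => constr:(x) end in
  let rho := constr:(nth d l) in
  let M := fresh "M" in
  pose proof (models_nil rho) as M;
  repeat match goal with
  | H : is_true (adj ?x ?y) |- _ => first [add_fact rho l M x y fact_adj H | clear H]
  | H : is_true (nadj ?x ?y) |- _ => first [add_fact rho l M x y fact_nadj H | clear H]
  | H : ?x = ?y |- _ => first [add_fact rho l M x y fact_eq H | clear H]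
  | H : is_true (?x == ?y) |- _ => first [add_fact rho l M x y fact_eqb H | clear H]
  | H : is_true (?x != ?y) |- _ => first [add_fact rho l M x y fact_neq H | clear H]
  | H : is_true (~~ adj ?x ?y) |- _ => first [add_fact rho l M x y fact_notadj H | clear H]
  | H : is_true (~~ nadj ?x ?y) |- _ => first [add_fact rho l M x y fact_notnadj H | clear H]
  end;
  lazymatch type of M with is_true (models _ ?s) =>
    let n := constr:(size l) in
    let c := eval vm_compute in (find_cert n s) in
    lazymatch c with
    | Some ?c' => exact (check_sound M (c := c') (erefl true))
    | None => fail "no refutation" s
    end
  end.

(** [config [:: x1; ..; xn]] proves a goal on the relations between the listed
vertices from the hypotheses on these relations, by refuting its negation. *)
Ltac config l :=
  lazymatch goal with
  | |- False => config_false l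
  | |- is_true (sq _ _ _ _) => rewrite /sq; apply/and5P; split; last (apply/andP; split); config l
  | |- is_true (~~ _) => apply/negP => ?; config_false l
  | |- is_true _ => apply/contraT => ?; config_false l
  | |- _ = _ => apply/eqP/contraT => ?; config_false l
  | |- _ /\ _ => split; config l
  | |- and4 _ _ _ _ => split; config l
  | |- and3 _ _ _ => split; config l
  end.

(** The two rules that produce vertices: intervals of length two contain squares,
and a vertex at distance two from two opposite corners of a square has distances
1 and 3 or 2 and 2 to the others. *)
Hypothesis in_square : forall u z x, nadj u z -> adj u x -> adj x z -> exists p q, sq u p z q.
Hypothesis far_position : forall a b c d v e f, sq a b c d -> nadj v a -> nadj v c ->
  adj v e -> adj e a -> adj v f -> adj f c ->
  [\/ adj v b, adj v d | exists g h, [/\ adj v g, adj g b, adj v h & adj h d]].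

Lemma adj_swap x y : adj x y -> adj y x. Proof. by rewrite adj_sym. Qed.

(** Inside the octahedron that contains the interval of u and z, the middle
vertex w either lies on a square through u and z or sees all four vertices of
such a square. Most case distinctions below are instances of this one. *)
Lemma rim_or_hub u z w : nadj u z -> adj u w -> adj w z ->
  (exists t, sq u w z t) \/ (exists p q, [/\ sq u p z q, adj w p & adj w q]).
Proof.
move=> nuz auw awz; have [p [q spq]] := in_square nuz auw awz.
case: (eqVneq w p) => [->|wp]; first by left; exists q.
case: (eqVneq w q) => [->|wq].
  by left; exists p; config [:: u; p; z; q].
by right; exists p, q; split=> //; config [:: u; p; z; q; w].
Qed.

(** Linear arithmetic on the values of germs, away from the facts on the graph. *)
Ltac nlia :=
  repeat match goal with
  | H : is_true (adj _ _) |- _ => clear H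
  | H : is_true (nadj _ _) |- _ => clear H
  | H : is_true (sq _ _ _ _) |- _ => clear H
  | H : is_true (~~ adj _ _) |- _ => clear H
  | H : is_true (~~ @eq_op V _ _) |- _ => clear H
  end; clear clique_free mate_unique near_position in_square far_position adj_sym adj_irr; lia.

Definition nbh u x := (x == u) || adj u x.

(** The local properties, on the closed neighbourhood of u, of the function
giving the distance to a base vertex. Its values elsewhere are meaningless. The
third property is the triangle condition of weakly modular graphs, and the last
one a form of convexity of the set of descending neighbours. *)
Record germ u (F : V -> nat) : Prop := Germ {
  germ_step : forall x, adj u x -> F x <= (F u).+1 /\ F u <= (F x).+1;
  germ_lip : forall x y, adj u x -> adj u y -> adj x y -> F x <= (F y).+1;
  germ_desc : forall x, adj u x -> F x = F u ->
    exists y, [/\ adj u y, adj x y & (F y).+1 = F u];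
  germ_conv : forall p q r, adj u p -> adj u q -> adj u r -> adj p q -> adj p r ->
    nadj q r -> (F q).+1 = F u -> (F r).+1 = F u -> (F p).+1 = F u }.

(** The edge pq of the link of u dips if a descending neighbour of u is one of
its ends or spans a triangle with it. *)
Definition dips u (F : V -> nat) p q : bool :=
  `[< exists m, [/\ adj u m, (F m).+1 = F u &
                    [\/ m = p, m = q | adj m p /\ adj m q]] >].

Lemma dipsC u F p q : dips u F p q = dips u F q p.
Proof.
suff H a b : dips u F a b -> dips u F b a by apply/idP/idP; apply: H.
move=> /asboolP[m [um Fm h]]; apply/asboolP; exists m; split=> //.
by case: h => [->|->|[? ?]]; [constructor 2|constructor 1|constructor 3].
Qed.

(** If p descends, both edges at p dip; if p ascends, neither does, as the values
at adjacent vertices differ by at most one. If p is level, the triangle condition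
provides a descending neighbour adjacent to p, hence by the interval condition one
dipping edge, and by convexity the other edge does not dip. Along an induced cycle
in the link of u, the values of the germ are thus F u + 1 minus the sums of the
weights of the two edges at a vertex, and for an even cycle their alternating sum
vanishes. *)
Lemma germ_dips u F p q r : germ u F -> adj u p -> adj u q -> adj u r ->
  adj p q -> adj p r -> nadj q r ->
  F p + dips u F p q + dips u F p r = (F u).+1.
Proof.
move=> gF up uq ur pq pr nqr.
have [Fpu Fup] := germ_step gF up.
have [Ep|np] := eqVneq (F p).+1 (F u).
  have -> : dips u F p q by apply/asboolP; exists p; split=> //; constructor 1.
  have -> : dips u F p r by apply/asboolP; exists p; split=> //; constructor 1.
  by rewrite -Ep; nlia.
have toq s : dips u F p s -> adj p s -> exists m, [/\ adj u m, adj p m, (F m).+1 = F u & m = s \/ adj m s].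
  move=> /asboolP[m [um Fm h]] ps; exists m; case: h => [E|E|[mp ms]]; first by rewrite E in Fm; nlia.
    by rewrite E in um Fm *; split=> //; left.
  by split=> //; [exact: adj_swap|right].
case: (boolP (dips u F p q)) => hq; case: (boolP (dips u F p r)) => hr /=.
- have [m [um pm Fm hm]] := toq _ hq pq; have [k [uk pk Fk hk]] := toq _ hr pr.
  have nmk : nadj m k.
    case: hm hk => [->|mq] [->|kr] //; first by config [:: u; p; q; r; k].
      by config [:: u; p; q; r; m].
    by config [:: u; p; q; r; m; k].
  have := germ_conv gF up um uk pm pk nmk Fm Fk; nlia.
- have [m [um pm Fm hm]] := toq _ hq pq.
  have := germ_lip gF up um pm; nlia.
- have [m [um pm Fm hm]] := toq _ hr pr.
  have := germ_lip gF up um pm; nlia.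
- have [Ep|] := eqVneq (F p) (F u); last nlia.
  have [m [um pm Fm]] := germ_desc gF up Ep.
  have dm s : m = s \/ adj m s -> dips u F p s.
    move=> h; apply/asboolP; exists m; split=> //.
    by case: h => [->|ms]; [constructor 2 | constructor 3; split=> //; apply: adj_swap].
  case: (eqVneq m q) => [E|mq]; first by rewrite dm ?E // in hq; left.
  case: (eqVneq m r) => [E|mr]; first by rewrite dm ?E // in hr; left.
  case: (boolP (adj m q)) => [E|nmq]; first by rewrite dm ?E // in hq; right.
  case: (boolP (adj m r)) => [E|nmr]; first by rewrite dm ?E // in hr; right.
  exfalso; have nmq' : nadj m q by rewrite /nadj mq.
  have nmr' : nadj m r by rewrite /nadj mr.
  have [[t st]|[a [b [sab ua ub]]]] := rim_or_hub nqr (adj_swap uq) ur.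
    by config [:: u; p; q; r; m; t].
  by config [:: u; p; q; r; m; a; b].
Qed.

Lemma germ_square u F p q r s : germ u F -> sq p q r s ->
  adj u p -> adj u q -> adj u r -> adj u s -> F p + F r = F q + F s.
Proof.
move=> gF sq1 up uq ur us.
case/and5P: (sq1) => pq qr rs sp /andP[npr nqs].
have := germ_dips gF up uq us pq (adj_swap sp) nqs.
have := germ_dips gF uq up ur (adj_swap pq) qr npr.
have := germ_dips gF ur uq us (adj_swap qr) rs nqs.
have := germ_dips gF us up ur sp (adj_swap rs) npr.
rewrite (dipsC u F q p) (dipsC u F r q) (dipsC u F s r) (dipsC u F s p).
nlia.
Qed.

Lemma germ_hexagon u F a b c d e f : germ u F ->
  adj u a -> adj u b -> adj u c -> adj u d -> adj u e -> adj u f ->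
  adj a b -> adj b c -> adj c d -> adj d e -> adj e f -> adj f a ->
  nadj a c -> nadj b d -> nadj c e -> nadj d f -> nadj e a -> nadj f b ->
  F a + F c + F e = F b + F d + F f.
Proof.
move=> gF ua ub uc ud ue uf ab bc cd de ef fa ac bd ce df ea fb.
have := germ_dips gF ua uf ub (adj_swap fa) ab fb.
have := germ_dips gF ub ua uc (adj_swap ab) bc ac.
have := germ_dips gF uc ub ud (adj_swap bc) cd bd.
have := germ_dips gF ud uc ue (adj_swap cd) de ce.
have := germ_dips gF ue ud uf (adj_swap de) ef df.
have := germ_dips gF uf ue ua (adj_swap ef) fa ea.
rewrite (dipsC u F b a) (dipsC u F c b) (dipsC u F d c) (dipsC u F e d).
rewrite (dipsC u F f e) (dipsC u F a f).
nlia.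
Qed.

(** * Transport of germs around triangles and squares *)

(** Germs at adjacent vertices are compatible when they look like restrictions of
one distance function: they agree where both are defined, and the step from u to
w equals the step along the opposite side of every square on the edge uw. *)
Record compat u (F : V -> nat) w (F' : V -> nat) : Prop := Compat {
  compat_eq : forall x, nbh u x -> nbh w x -> F x = F' x;
  compat_sq : forall z p, sq u w z p -> F u + F' z = F' w + F p }.

Lemma sqC a b c d : sq a b c d -> sq b a d c.
Proof. by move=> s; config [:: a; b; c; d]. Qed.

Lemma nbhx u : nbh u u. Proof. by rewrite /nbh eqxx. Qed.
Lemma adj_nbh u x : adj u x -> nbh u x. Proof. by rewrite /nbh => ->; rewrite orbT. Qed.
Hint Resolve nbhx adj_nbh : core.

Lemma compat_ends u F w F' : adj u w -> compat u F w F' -> F u = F' u /\ F w = F' w.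
Proof.
by move=> uw c; split; apply: compat_eq c _ _ _; auto; apply: adj_nbh; apply: adj_swap.
Qed.

Lemma compatC u F w F' : adj u w -> compat u F w F' -> compat w F' u F.
Proof.
move=> uw c; have [Eu Ew] := compat_ends uw c.
case: c => ceq csq; split=> [x wx ux|z p s]; first by rewrite ceq.
by rewrite addnC [RHS]addnC Eu -Ew; have := csq _ _ (sqC s); lia.
Qed.

Lemma nbh_far u x : ~~ nbh u x -> nadj u x.
Proof. by rewrite /nbh /nadj negb_or eq_sym. Qed.

(** A germ determines the compatible germ at an adjacent vertex w: a neighbour x
of w apart from u is opposite to u in a square that either contains w, and then
compatibility yields the value at x, or is seen entirely by w, and then
[germ_square] does. The shifts a and b allow for a difference of F and G by a
constant of either sign. *)
Lemma compat_uniq u F G w F' G' a b : adj u w -> germ w F' -> germ w G' ->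
  compat u F w F' -> compat u G w G' ->
  (forall x, nbh u x -> F x + a = G x + b) ->
  forall x, nbh w x -> F' x + a = G' x + b.
Proof.
move=> uw gF gG cF cG FG x wx.
have [Eu Ew] := compat_ends uw cF; have [Eu' Ew'] := compat_ends uw cG.
have [ux|/nbh_far nux] := boolP (nbh u x).
  by rewrite -(compat_eq cF) // -(compat_eq cG) //; apply: FG.
have wx' : adj w x.
  by case/orP: wx => // /eqP E; rewrite E in nux; config [:: u; w].
have FGu := FG _ (nbhx u); have FGw := FG _ (adj_nbh uw).
have [[t st]|[p [q [spq wp wq]]]] := rim_or_hub nux uw wx'.
  have ut : adj u t by config [:: u; w; x; t].
  have := compat_sq cF st; have := compat_sq cG st; have := FG _ (adj_nbh ut); nlia.
case/and5P: (spq) => up px xq qu _.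
have uq := adj_swap qu; have wu := adj_swap uw.
have := germ_square gF spq wu wp wx' wq; have := germ_square gG spq wu wp wx' wq.
rewrite -(compat_eq cF (adj_nbh up) (adj_nbh wp)) -(compat_eq cF (adj_nbh uq) (adj_nbh wq)).
rewrite -(compat_eq cG (adj_nbh up) (adj_nbh wp)) -(compat_eq cG (adj_nbh uq) (adj_nbh wq)).
have := FG _ (adj_nbh up); have := FG _ (adj_nbh uq); rewrite -Eu -Eu'; nlia.
Qed.

(** In the interval of v and c, which contains b, and in that of v and d, which
contains a, the other vertices fit together: either they share the vertex t that
is opposite to b and a in squares, which closes a triangular prism, or some
neighbour x of v sees the whole square abcd. *)
Lemma prism a b c d v : sq a b c d -> adj v a -> adj v b -> nadj v c -> nadj v d ->
  (exists t, sq v b c t /\ sq v a d t) \/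
  (exists x y z, [/\ adj v x /\ [/\ adj x a, adj x b, adj x c & adj x d],
     sq v x c y /\ adj b y, sq v x d z /\ adj a z, sq a b y z & sq z y c d]).
Proof.
move=> s va vb nvc nvd.
have bc : adj b c by config [:: a; b; c; d].
have ad : adj a d by config [:: a; b; c; d].
have [[t st]|[x [y [sxy bx by_]]]] := rim_or_hub nvc vb bc.
  by left; exists t; split=> //; config [:: a; b; c; d; v; t].
have [[t st]|[p [q [spq ap aq]]]] := rim_or_hub nvd va ad.
  by left; exists t; split=> //; config [:: a; b; c; d; v; t].
have [E|E] : (x = p \/ x = q) \/ (y = p \/ y = q).
  case: (eqVneq x p) => [->|xp]; first by left; left.
  case: (eqVneq x q) => [->|xq]; first by left; right.
  case: (eqVneq y p) => [->|yp]; first by right; left.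
  case: (eqVneq y q) => [->|yq]; first by right; right.
  by exfalso; config [:: a; b; c; d; v; x; y; p; q].
- right; case: E => E; rewrite -E in ap aq spq *.
    by exists x, y, q; split; config [:: a; b; c; d; v; x; y; q].
  by exists x, y, p; split; config [:: a; b; c; d; v; x; y; p].
- right; case: E => E; rewrite -E in ap aq spq *.
    by exists y, x, q; split; config [:: a; b; c; d; v; x; y; q].
  by exists y, x, p; split; config [:: a; b; c; d; v; x; y; p].
Qed.

(** Transport around a triangle is trivial. A vertex seen by u and x but not by w
is related to w by squares or hubs on the edges of the triangle. A square on the
edge ux is compared with squares on the other two edges by [prism]. *)
Lemma compat_tri u w x Fu Fw Fx : adj u w -> adj w x -> adj u x ->
  germ u Fu -> germ w Fw -> germ x Fx ->
  compat u Fu w Fw -> compat w Fw x Fx -> compat u Fu x Fx.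
Proof.
move=> uw wx ux gu gw gx cuw cwx.
have wu := adj_swap uw; have xw := adj_swap wx; have xu := adj_swap ux.
have [Euu Euw] := compat_ends uw cuw; have [Eww Ewx] := compat_ends wx cwx.
have Eux : Fu x = Fw x by apply: (compat_eq cuw); auto.
have Exu : Fw u = Fx u by apply: (compat_eq cwx); auto.
split=> [y uy xy|z p s].
  have [wy|/nbh_far nwy] := boolP (nbh w y).
    by rewrite (compat_eq cuw) // (compat_eq cwx).
  have uy' : adj u y by case/orP: uy => // /eqP E; config [:: u; w; y].
  have xy' : adj x y by case/orP: xy => // /eqP E; config [:: x; w; y].
  have [[t st]|[p [q [spq up uq]]]] := rim_or_hub nwy wu uy'.
    have [xt wt] : adj x t /\ adj w t by config [:: u; w; x; y; t].
    have := compat_sq (compatC uw cuw) st.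
    have := germ_square gx st xw xu xy' xt.
    rewrite -(compat_eq cwx (nbhx w) (adj_nbh xw)) -(compat_eq cwx (adj_nbh wt) (adj_nbh xt)).
    nlia.
  have [t [st ut]] : exists t, sq w x y t /\ adj u t.
    have [E|E] : x = p \/ x = q.
      case: (eqVneq x p) => [->|xp]; first by left.
      by right; config [:: u; w; x; y; p; q].
    by exists q; split; config [:: u; w; x; y; p; q].
    by exists p; split; config [:: u; w; x; y; p; q].
  have wt : adj w t by config [:: w; x; y; t].
  have := compat_sq cwx st.
  have := germ_square gu st uw ux uy' ut.
  rewrite (compat_eq cuw (adj_nbh ut) (adj_nbh wt)); nlia.
have up : adj u p by config [:: u; x; z; p].
have xz : adj x z by config [:: u; x; z; p].
case: (boolP (nbh w p)) => [wp|/nbh_far nwp]; last first.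
  have nwz : nadj w z by config [:: u; w; x; z; p].
  have [[t [sz sp]]|] := prism s wu wx nwz nwp.
    have := compat_sq cwx sz; have := compat_sq (compatC uw cuw) sp.
    nlia.
  case=> a [y0 [z0 [[wa [au ax az ap]] [sy xy] [sz uz] suxyz _]]].
  have [wy wz xy' ua xa] : [/\ adj w y0, adj w z0, adj x y0, adj u a & adj x a].
    by split; config [:: u; w; x; z; p; a; y0; z0].
  have := germ_square gu sz uw ua up uz.
  have := germ_square gx sy xw xa xz xy.
  have := germ_square gw suxyz wu wx wy wz.
  rewrite (compat_eq cuw (adj_nbh ua) (adj_nbh wa)) (compat_eq cuw (adj_nbh uz) (adj_nbh wz)).
  rewrite -(compat_eq cwx (adj_nbh wa) (adj_nbh xa)) -(compat_eq cwx (adj_nbh wy) (adj_nbh xy)).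
  nlia.
have wp' : adj w p by case/orP: wp => // /eqP E; config [:: u; w; x; z; p].
have wz : adj w z by config [:: u; w; x; z; p].
have := germ_square gw s wu wx wz wp'.
rewrite -(compat_eq cwx (adj_nbh wz) (adj_nbh xz)) (compat_eq cuw (adj_nbh up) wp).
nlia.
Qed.

(** Two squares with the common edge wy, thought of as consecutive faces of a
cube with the parallel edges ut, pt', wr and ys. The goal is the equality of the
steps of the germs at w and y along wr and ys; when all four parallel edges exist
and t and t' are adjacent, it is obtained by going around the cube. The intervals of
u and r, and of p and s, decide which faces exist: each offers a rim vertex or a
square seen by w or by y, whence four cases. *)
Section CubeFace.
Variables (p u w y r s : V) (Fp Fu Fw Fy : V -> nat).
Hypotheses (s1 : sq p u w y) (s2 : sq w y s r) (nur : nadj u r) (nps : nadj p s).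
Hypotheses (gp : germ p Fp) (gu : germ u Fu) (gw : germ w Fw) (gy : germ y Fy).
Hypotheses (cpu : compat p Fp u Fu) (cuw : compat u Fu w Fw) (cpy : compat p Fp y Fy).

Let pu : adj p u. Proof. by config [:: p; u; w; y]. Qed.
Let uw : adj u w. Proof. by config [:: p; u; w; y]. Qed.
Let wy : adj w y. Proof. by config [:: p; u; w; y]. Qed.
Let py : adj p y. Proof. by config [:: p; u; w; y]. Qed.
Let wr : adj w r. Proof. by config [:: w; y; s; r]. Qed.
Let ys : adj y s. Proof. by config [:: w; y; s; r]. Qed.
Let rs : adj r s. Proof. by config [:: w; y; s; r]. Qed.

Lemma cube_rims t t' : sq u w r t -> sq p y s t' -> adj t t' ->
  Fw r + Fy y = Fy s + Fw w.
Proof.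
move=> st st' tt'.
have [Ep Eu] := compat_ends pu cpu; have [Eu' Ew] := compat_ends uw cuw.
have [Ep' Ey] := compat_ends py cpy.
have := compat_sq cuw st; have := compat_sq cpy st'.
have s3 : sq p u t t' by config [:: p; u; w; y; r; s; t; t'].
have := compat_sq cpu s3; have := compat_sq cpu s1.
nlia.
Qed.

(** Local positioning of t with respect to the square p y s t' forces t and t' to
be adjacent, so that the cube closes up. *)
Lemma cube_rim_rim t t' : sq u w r t -> sq p y s t' -> Fw r + Fy y = Fy s + Fw w.
Proof.
move=> st st'; apply: (cube_rims st st').
have ntp : nadj t p by config [:: p; u; w; y; r; s; t; t'].
have nts : nadj t s by config [:: p; u; w; y; r; s; t; t'].
have tu : adj t u by config [:: u; w; r; t].
have tr : adj t r by config [:: u; w; r; t].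
have := far_position st' ntp nts tu (adj_swap pu) tr rs.
case=> [ty|//|[e [f [te ey _ _]]]].
  by config [:: p; u; w; y; r; s; t; t'].
apply/contraT => ntt'.
by config [:: p; u; w; y; r; s; t; t'; e].
Qed.

(** The interval of t and p offers a rim vertex, which closes up the cube, or a
square t x p i seen by u. In the latter case local positioning, with z and j
exchanged if necessary, makes y, z, x, u, i, j a hexagon in the link of p, and
[germ_hexagon] relates the values. *)
Lemma cube_rim_hub t z j : sq u w r t -> sq p z s j -> adj y z -> adj y j ->
  Fw r + Fy y = Fy s + Fw w.
Proof.
move=> st szj yz yj.
have ntp : nadj t p by config [:: p; u; w; y; r; s; t; z; j].
have nst : nadj s t by config [:: p; u; w; y; r; s; t; z; j].
have tu : adj t u by config [:: u; w; r; t].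
have tr : adj t r by config [:: u; w; r; t].
have nsp : nadj s p by config [:: p; s].
have [[k sk]|[x [i [sxi ux ui]]]] := rim_or_hub ntp tu (adj_swap pu).
  have sk' : adj s k.
    have := far_position sk nst nsp (adj_swap rs) (adj_swap tr) (adj_swap ys) (adj_swap py).
    case=> [su|//|[e [f [se eu _ _]]]].
      by config [:: p; u; w; y; r; s; t; z; j].
    by config [:: p; u; w; y; r; s; t; z; j; e].
  apply: (cube_rims st (t' := k)); first by config [:: p; u; w; y; r; s; t; z; j; k].
  by config [:: t; u; p; k].
have [e [f [se ex sf fi]]] : exists e f, [/\ adj s e, adj e x, adj s f & adj f i].
  case: (far_position sxi nst nsp (adj_swap rs) (adj_swap tr) (adj_swap ys) (adj_swap py)) => //.
    by move=> sx; exfalso; config [:: p; u; w; y; r; s; t; z; j; x; i].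
  by move=> si; exfalso; config [:: p; u; w; y; r; s; t; z; j; x; i].
have hex z' j' : sq p z' s j' -> adj y z' -> adj y j' -> adj x z' ->
    Fw r + Fy y = Fy s + Fw w.
  move=> {szj yz yj} szj yz yj xz.
  have ij : adj i j' by config [:: p; u; w; y; r; s; t; z'; j'; x; i; e; f].
  have [pz pj px pi] : [/\ adj p z', adj p j', adj p x & adj p i].
    by config [:: t; x; p; i; z'; s; j'].
  have [nyx nzu nxi] : [/\ nadj y x, nadj z' u & nadj x i].
    by config [:: p; u; w; y; r; s; t; z'; j'; x; i].
  have [nuj nij njz] : [/\ nadj u j', nadj i y & nadj j' z'].
    by config [:: p; u; w; y; r; s; t; z'; j'; x; i].
  have := germ_hexagon gp py pz px pu pi pj yz (adj_swap xz) (adj_swap ux) ui ij (adj_swap yj)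
     nyx nzu nxi nuj nij njz.
  have ut : adj u t by apply: adj_swap.
  have yu := adj_swap pu; have yp := adj_swap py.
  have := germ_square gu sxi ut ux yu ui.
  have := germ_square gy szj yp yz ys yj.
  have [Ep Eu] := compat_ends pu cpu; have [Eu' Ew] := compat_ends uw cuw.
  have [Ep' Ey] := compat_ends py cpy.
  have := compat_sq cuw st; have := compat_sq cpu s1.
  rewrite -(compat_eq cpu (adj_nbh px) (adj_nbh ux)) -(compat_eq cpu (adj_nbh pi) (adj_nbh ui)).
  rewrite -(compat_eq cpy (adj_nbh pz) (adj_nbh yz)) -(compat_eq cpy (adj_nbh pj) (adj_nbh yj)).
  nlia.
have [xz|xz] := boolP (adj x z); first exact: hex szj yz yj xz.
apply: (hex j z) => //; first by config [:: p; z; s; j].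
by config [:: p; u; w; y; r; s; t; z; j; x; i; e; f].
Qed.

(** Both faces degenerate into squares seen by w and by y. If the two squares are
joined by one edge xz they are joined by a second one ij, by local positioning,
and the squares on these two edges and pu relate all the values. *)
Lemma cube_hub_adj x i z j : sq u x r i -> adj w x -> adj w i ->
  sq p z s j -> adj y z -> adj y j -> adj x z -> Fw r + Fy y = Fy s + Fw w.
Proof.
move=> sxi wx wi szj yz yj xz.
have [xu xr iu] : [/\ adj x u, adj x r & adj i u] by config [:: u; x; r; i].
have [nju njr] : nadj j u /\ nadj j r by config [:: p; u; w; y; r; s; x; i; z; j].
have [jp js pj pz] : [/\ adj j p, adj j s, adj p j & adj p z] by config [:: p; z; s; j].
have ij : adj i j.
  case: (far_position sxi nju njr jp pu js (adj_swap rs)) => [jx|ji|[e [f [je ex _ _]]]].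
  - by config [:: p; u; w; y; r; s; x; i; z; j].
  - exact: adj_swap.
  - by config [:: p; u; w; y; r; s; x; i; z; j; e].
have [sx si] : sq p u x z /\ sq p u i j by config [:: p; u; w; y; r; s; x; i; z; j].
have [Ep Eu] := compat_ends pu cpu; have [Eu' Ew] := compat_ends uw cuw.
have [Ep' Ey] := compat_ends py cpy.
have := compat_sq cpu sx; have := compat_sq cpu si; have := compat_sq cpu s1.
have := germ_square gw sxi (adj_swap uw) wx wr wi.
have := germ_square gy szj (adj_swap py) yz ys yj.
rewrite -(compat_eq cuw (adj_nbh (adj_swap xu)) (adj_nbh wx)).
rewrite -(compat_eq cuw (adj_nbh (adj_swap iu)) (adj_nbh wi)).
rewrite -(compat_eq cpy (adj_nbh pz) (adj_nbh yz)) -(compat_eq cpy (adj_nbh pj) (adj_nbh yj)).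
nlia.
Qed.

(** The case left open by [cube_hub_adj] does not occur: with no edge between the
two seen squares, local positioning gives each of x and i a common neighbour with z
that is adjacent to u and p, and no position of these two is possible. *)
Lemma cube_hub_hub x i z j : sq u x r i -> adj w x -> adj w i ->
  sq p z s j -> adj y z -> adj y j -> Fw r + Fy y = Fy s + Fw w.
Proof.
move=> sxi wx wi szj yz yj.
have [six sjz] : sq u i r x /\ sq p j s z.
  by split; config [:: u; x; r; i; p; z; s; j].
have [xz|nxz] := boolP (adj x z); first exact: cube_hub_adj sxi wx wi szj yz yj xz.
have [xj|nxj] := boolP (adj x j); first exact: cube_hub_adj sxi wx wi sjz yj yz xj.
have [iz|niz] := boolP (adj i z); first exact: cube_hub_adj six wi wx szj yz yj iz.
have [ij|nij] := boolP (adj i j); first exact: cube_hub_adj six wi wx sjz yj yz ij.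
have up := adj_swap pu.
have mid x' i' : sq u x' r i' -> adj w x' -> adj w i' -> ~~ adj x' z -> ~~ adj x' j ->
    exists e f, [/\ sq x' e z f, adj u e & adj p e].
  move=> {sxi wx wi} sxi wx wi nxz' nxj'.
  have [nxp nxs] : nadj x' p /\ nadj x' s by config [:: p; u; w; y; r; s; x'; i'; z; j].
  have [xu xr] : adj x' u /\ adj x' r by config [:: u; x'; r; i'].
  have [e [xe ez]] : exists e, adj x' e /\ adj e z.
    case: (far_position szj nxp nxs xu up xr rs) => [xz|xj|[e [f [xe ez _ _]]]]; last by exists e.
    - by rewrite xz in nxz'.
    - by rewrite xj in nxj'.
  have nxz'' : nadj x' z by config [:: p; u; w; y; r; s; x'; i'; z; j].
  have [a [b sab]] := in_square nxz'' xe ez.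
  have [ua|nua] := boolP (adj u a).
    by exists a, b; split=> //; config [:: p; u; w; y; r; s; x'; i'; z; j; a; b].
  exists b, a; split; [by config [:: x'; a; z; b]| |];
    by config [:: p; u; w; y; r; s; x'; i'; z; j; a; b].
have [e [f [sef ue pe]]] := mid x i sxi wx wi nxz nxj.
have [g [h [sgh ug pg]]] := mid i x six wi wx niz nij.
have [ye|nye] := boolP (adj y e); last first.
  by config [:: p; u; w; y; r; s; x; i; z; j; e; f; g; h].
have [yg|nyg] := boolP (adj y g).
  by config [:: p; u; w; y; r; s; x; i; z; j; e; f; g; h].
by config [:: p; u; w; y; r; s; x; i; z; j; e; f; g; h].
Qed.
End CubeFace.

(** Transport around a square is trivial. The values at common neighbours of w and
y are compared by [prism], the steps along the squares on wy by the cases of the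
cube above. *)
Lemma compat_square p u w y Fp Fu Fw Fy : sq p u w y ->
  germ p Fp -> germ u Fu -> germ w Fw -> germ y Fy ->
  compat p Fp u Fu -> compat u Fu w Fw -> compat p Fp y Fy -> compat y Fy w Fw.
Proof.
move=> s1 gp gu gw gy cpu cuw cpy.
have [pu uw [wy py]] : [/\ adj p u, adj u w & adj w y /\ adj p y].
  by config [:: p; u; w; y].
have [up wu [yw yp]] : [/\ adj u p, adj w u & adj y w /\ adj y p].
  by config [:: p; u; w; y].
have [Ep Eu] := compat_ends pu cpu; have [Eu' Ew] := compat_ends uw cuw.
have [Ep' Ey] := compat_ends py cpy; have Hu := compat_sq cpu s1.
have Hw : Fu u + Fw y = Fw w + Fu p by apply: (compat_sq cuw); config [:: p; u; w; y].
have Hy : Fp p + Fy w = Fy y + Fp u by apply: (compat_sq cpy); config [:: p; u; w; y].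
split=> [x /orP[/eqP ->|yx] /orP[/eqP ->|wx]|r s s2]; try by nlia.
- have [ux|nux] := boolP (adj u x).
    have px : adj p x by config [:: p; u; w; y; x].
    by rewrite -(compat_eq cpy (adj_nbh px) (adj_nbh yx)) (compat_eq cpu (adj_nbh px) (adj_nbh ux))
       (compat_eq cuw (adj_nbh ux) (adj_nbh wx)).
  have [nxu nxp] : nadj x u /\ nadj x p by config [:: p; u; w; y; x].
  have s1' : sq w y p u by config [:: p; u; w; y].
  have [[t [sp su]]|] := prism s1' (adj_swap wx) (adj_swap yx) nxp nxu.
    have [su' sp'] : sq u w x t /\ sq p y x t by config [:: p; u; w; y; x; t].
    have [ut pt] : adj u t /\ adj p t by config [:: p; u; w; y; x; t].
    have := compat_sq cuw su'; have := compat_sq cpy sp'.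
    rewrite (compat_eq cpu (adj_nbh pt) (adj_nbh ut)); nlia.
  case=> a [b [c [[xa [aw ay ap au]] [sb yb] [sc wc] _ s3]]].
  have [pb uc] : adj p b /\ adj u c by config [:: x; a; p; b; u; c].
  have s3' : sq p u c b by config [:: c; b; p; u].
  have := germ_square gw sc wx (adj_swap aw) wu wc.
  have := germ_square gy sb yx (adj_swap ay) yp yb.
  have := compat_sq cpu s3'.
  rewrite -(compat_eq cpy (adj_nbh (adj_swap ap)) (adj_nbh (adj_swap ay))).
  rewrite -(compat_eq cpy (adj_nbh pb) (adj_nbh yb)) -(compat_eq cuw (adj_nbh uc) (adj_nbh wc)).
  rewrite -(compat_eq cuw (adj_nbh (adj_swap au)) (adj_nbh (adj_swap aw))).
  rewrite -(compat_eq cpu (adj_nbh (adj_swap ap)) (adj_nbh (adj_swap au))).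
  nlia.
have s2' : sq w y s r by config [:: y; w; r; s].
have [wr ys] : adj w r /\ adj y s by config [:: y; w; r; s].
have [ur|nur] := boolP (adj u r).
  have ps : adj p s by config [:: p; u; w; y; r; s].
  have s3 : sq p u r s by config [:: p; u; w; y; r; s].
  have := compat_sq cpu s3.
  rewrite -(compat_eq cpy (adj_nbh ps) (adj_nbh ys)) -(compat_eq cuw (adj_nbh ur) (adj_nbh wr)).
  nlia.
have [Er|neur] := eqVneq u r.
  have Es : p = s by config [:: p; u; w; y; r; s].
  by rewrite -Er -Es; nlia.
have [nur' nps] : nadj u r /\ nadj p s by config [:: p; u; w; y; r; s].
suff: Fw r + Fy y = Fy s + Fw w by nlia.
have [[t st]|[x [i [sxi wx wi]]]] := rim_or_hub nur' uw wr;
  have [[t' st']|[z [j [szj yz yj]]]] := rim_or_hub nps py ys.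
- exact: cube_rim_rim s1 s2' nur' nps cpu cuw cpy _ _ st st'.
- exact: cube_rim_hub s1 s2' nur' nps gp gu gy cpu cuw cpy _ _ _ st szj yz yj.
- suff: Fy s + Fw w = Fw r + Fy y by nlia.
  exact: cube_rim_hub (sqC s1) (sqC s2') nps nur' gu gp gw (compatC pu cpu) cpy cuw
           _ _ _ st' sxi wx wi.
- exact: cube_hub_hub s1 s2' nur' nps gw gy cpu cuw cpy _ _ _ _ sxi wx wi szj yz yj.
Qed.

(** * Extending a germ upwards *)

(** When the germ F at u increases along uw, the germ at w is obtained by linear
extrapolation: at a vertex opposite to u in a square, it takes the value that makes
both diagonals of the square have the same sum. The choice of the square is
immaterial by [opposite_sum]. *)
Definition ascend u (F : V -> nat) z : nat :=
  if nbh u z then F z else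
  if pselect (exists pq : V * V, sq u pq.1 z pq.2) is left h
  then F (sval (cid h)).1 + F (sval (cid h)).2 - F u else 0.

Lemma ascend_near u F z : nbh u z -> ascend u F z = F z.
Proof. by rewrite /ascend => ->. Qed.

Lemma dips_top u F p q : germ u F -> adj u p -> adj u q -> adj p q -> F p = (F u).+1 ->
  dips u F p q = false.
Proof.
move=> gF up uq pq Fp; apply/negP => /asboolP[m [um Fm]].
case=> [E|E|[mp mq]].
- by rewrite E in Fm; nlia.
- by have := germ_lip gF up uq pq; rewrite E in Fm; nlia.
- by have := germ_lip gF up um (adj_swap mp); nlia.
Qed.

Lemma dips_low u F p q : adj u q -> (F q).+1 = F u -> dips u F p q.
Proof. by move=> uq Fq; apply/asboolP; exists q; split=> //; constructor 2. Qed.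

(** The middle vertices of two different squares with the diagonal uz form a square in
the link of u. *)
Lemma opposite_sum u z p q p' q' F : germ u F -> sq u p z q -> sq u p' z q' ->
  F p + F q = F p' + F q'.
Proof.
move=> gF s s'.
case: (eqVneq p p') => [E|n1].
  have -> : q = q' by config [:: u; p; z; q; p'; q'].
  by rewrite E.
case: (eqVneq p q') => [E|n2].
  have -> : q = p' by config [:: u; p; z; q; p'; q'].
  by rewrite E addnC.
have s2 : sq p p' q q' by config [:: u; p; z; q; p'; q'].
have [[up uq] [up' uq']] : (adj u p /\ adj u q) /\ (adj u p' /\ adj u q').
  by config [:: u; p; z; q; p'; q'].
exact: germ_square gF s2 up up' uq uq'.
Qed.

Section Ascent.
Variables (u w : V) (F : V -> nat).
Hypotheses (gF : germ u F) (uw : adj u w) (Fw : F w = (F u).+1).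
Notation E := (ascend u F).

Lemma ascendE z p q : adj w z -> sq u p z q -> F u + E z = F p + F q.
Proof.
move=> wz s; have nuz : nadj u z by config [:: u; p; z; q].
rewrite /ascend; case: ifP => [uz|_].
  by case/andP: nuz; rewrite eq_sym; case/orP: uz => ->.
case: pselect => [h|[]]; last by exists (p, q).
case: (cid h) => [[p' q'] /= s'].
have H := opposite_sum gF s s'; suff: F u <= F p + F q by nlia.
have [up uq] : adj u p /\ adj u q by config [:: u; p; z; q].
have [Lp1 Lp2] := germ_step gF up; have [Lq1 Lq2] := germ_step gF uq.
case: (eqVneq w p) => [<-|wp]; first by nlia.
case: (eqVneq w q) => [<-|wq]; first by nlia.
have wp' : adj w p by config [:: u; w; p; z; q].
have := germ_lip gF uw up wp'; nlia.
Qed.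

Lemma ascend_compat : compat u F w E.
Proof.
split=> [x ux _|z p s]; first by rewrite ascend_near.
by rewrite (ascend_near F (adj_nbh uw)); apply: (ascendE _ s); config [:: u; w; z; p].
Qed.

(** The value at z comes from the square on the edge uw, or from a square seen by
w, whose middle vertices then cannot descend. *)
Lemma ascend_cases z : adj w z -> nadj u z ->
  (exists t, [/\ sq u w z t, adj u t & E z = (F t).+1]) \/
  (exists p q, [/\ sq u p z q /\ F u + E z = F p + F q,
      [/\ adj u p, adj u q, adj w p & adj w q],
      F u <= F p <= (F u).+1 & F u <= F q <= (F u).+1]).
Proof.
move=> wz nuz; have [[t s]|[p [q [s wp wq]]]] := rim_or_hub nuz uw wz; [left|right].
  exists t; split=> //; first by config [:: u; w; z; t].
  by have := ascendE wz s; nlia.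
have [up uq] : adj u p /\ adj u q by config [:: u; p; z; q].
have [? ?] := germ_step gF up; have [? ?] := germ_step gF uq.
have H1 := germ_lip gF uw up wp; have H2 := germ_lip gF uw uq wq.
exists p, q; split=> //; last 2 first; try by nlia.
by split=> //; apply: (ascendE _ s).
Qed.

Lemma far_or_near z : adj w z -> [\/ z = u, adj u z | nadj u z].
Proof.
move=> wz; case: (boolP (nbh u z)) => [/orP[/eqP|]|/nbh_far];
  by [constructor 1|constructor 2|constructor 3].
Qed.

Lemma ascend_range z : adj w z -> F u <= E z <= (F u).+2.
Proof.
move=> wz; case: (far_or_near wz) => [->|uz|nuz].
- by rewrite ascend_near // /nbh; nlia.
- have [? ?] := germ_step gF uz; rewrite ascend_near; auto.
  have := germ_lip gF uw uz wz; nlia.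
case: (ascend_cases wz nuz) => [[t [s ut ->]]|[p [q [[s H] _ ? ?]]]]; last by nlia.
have := germ_step gF ut; nlia.
Qed.

Lemma ascend_low z y : adj w z -> nadj u z -> E z = F u ->
  adj u y -> adj w y -> adj y z -> F y = F u.
Proof.
move=> wz nuz Ez uy wy yz.
have := germ_lip gF uw uy wy.
case: (ascend_cases wz nuz) => [[t [s ut Et]]|[p [q [[s H] [up uq wp wq] ? ?]]]].
  have yt : adj y t by config [:: u; w; z; t; y].
  have := germ_lip gF uy ut yt; nlia.
have [->|->] : y = p \/ y = q; try by nlia.
have [->|yp] := eqVneq y p; first by left.
by right; config [:: u; w; z; p; q; y].
Qed.

(** A value F u + 2 forces all neighbours between u and x to ascend: a neighbour on a
square through u and x does as the sum over the diagonal is 2 F u + 2, and a hub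
does because the edges from it to the ascending p and q do not dip. *)
Lemma ascend_top x : adj w x -> E x = (F u).+2 ->
  nadj u x /\ forall y, adj u y -> adj y x -> F y = (F u).+1.
Proof.
move=> wx Ex.
have nux : nadj u x.
  case: (far_or_near wx) => [E0|ux|//].
    by rewrite E0 ascend_near /nbh ?eqxx // in Ex; nlia.
  by have := germ_step gF ux; rewrite ascend_near in Ex; auto; nlia.
split=> // y uy yx.
have top p : adj u p -> F p <= (F u).+1 by move=> /(germ_step gF)[].
have [[t s]|[p [q [s yp yq]]]] := rim_or_hub nux uy yx.
  have ut : adj u t by config [:: u; y; x; t].
  have := ascendE wx s; have := top _ uy; have := top _ ut; nlia.
have [up uq npq] : [/\ adj u p, adj u q & nadj p q] by config [:: u; p; x; q].
have H := ascendE wx s; have Tp := top _ up; have Tq := top _ uq.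
have := germ_dips gF uy up uq yp yq npq.
rewrite (dipsC u F y p) (dipsC u F y q).
rewrite (dips_top gF up uy (adj_swap yp)); last by nlia.
rewrite (dips_top gF uq uy (adj_swap yq)); last by nlia.
nlia.
Qed.

(** If the values at x and y were F u + 2 and F u, a common neighbour of u, w, x and y
would have to ascend by [ascend_top] and be level by [ascend_low]. Without such a
vertex, x and y are opposite to u in squares on the edge uw, whose fourth corners
are adjacent and have values that differ by two. *)
Lemma ascend_lip x y : adj w x -> adj w y -> adj x y -> E x <= (E y).+1.
Proof.
move=> wx wy xy; have Rx := ascend_range wx; have Ry := ascend_range wy.
apply/contraT => H; exfalso.
have Ex : E x = (F u).+2 by nlia.
have Ey : E y = F u by nlia.
have [nux topx] := ascend_top wx Ex.
case: (far_or_near wy) => [E0|uy|nuy].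
- by rewrite E0 in xy; config [:: u; x].
- by have := topx _ uy (adj_swap xy); rewrite ascend_near in Ey; auto; nlia.
have one p : adj u p -> adj w p -> adj p y -> adj p x -> False.
  by move=> up wp py px; have := topx _ up px; have := ascend_low wy nuy Ey up wp py; nlia.
case: (ascend_cases wx nux) => [[t [s ut Et]]|[p [q [[s _] [up uq wp wq] _ _]]]]; last first.
  have [py|npy] := boolP (adj p y).
    by apply: (one p) => //; config [:: u; p; x; q].
  by apply: (one q) => //; config [:: u; p; x; q; w; y].
case: (ascend_cases wy nuy) => [[t' [s' ut' Et']]|[p [q [[s' _] [up uq wp wq] _ _]]]].
  have tt' : adj t t' by config [:: u; w; x; y; t; t'].
  by have := germ_lip gF ut ut' tt'; nlia.
have [px|npx] := boolP (adj p x).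
  by apply: (one p) => //; config [:: u; p; y; q].
by apply: (one q) => //; config [:: u; p; y; q; w; x].
Qed.

(** At a neighbour of u, the vertex u itself descends. Across a square on uw, the
triangle condition at w follows from the one at u by [prism], and for a square
seen by w, one of its middle vertices is level for F, thus below w. *)
Lemma ascend_desc z : adj w z -> E z = E w -> exists y, [/\ adj w y, adj z y & (E y).+1 = E w].
Proof.
move=> wz; rewrite (ascend_near F (adj_nbh uw)) Fw => Ez.
case: (far_or_near wz) => [E0|uz|nuz].
- by rewrite E0 ascend_near /nbh ?eqxx // in Ez; nlia.
- by exists u; split; rewrite ?ascend_near /nbh ?eqxx //; apply: adj_swap.
case: (ascend_cases wz nuz) => [[t [s ut Et]]|[p [q [[s H] [up uq wp wq] ? ?]]]]; last first.
  have [pz qz] : adj z p /\ adj z q by config [:: u; p; z; q].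
  have [Ep|Eq] : F p = F u \/ F q = F u by nlia.
    by exists p; split; rewrite ?ascend_near ?Ep //; auto.
  by exists q; split; rewrite ?ascend_near ?Eq //; auto.
have Ft : F t = F u by nlia.
have [r [ur tr Fr]] := germ_desc gF ut Ft.
have nrw : ~~ adj r w by apply/negP => rw; have := germ_lip gF uw ur (adj_swap rw); nlia.
have rw' : r != w by apply/eqP => E0; rewrite E0 in Fr; nlia.
have [nrz nrw'] : nadj r z /\ nadj r w by config [:: u; w; z; t; r].
have s1 : sq u t z w by config [:: u; w; z; t].
have [[k [sk1 sk2]]|[k [_ [_ [[rk [ku kt kz kw]] _ _ _ _]]]]] :=
   prism s1 (adj_swap ur) (adj_swap tr) nrz nrw'.
  have [wk zk sk] : [/\ adj w k, adj z k & sq u r k w] by config [:: u; w; z; t; r; k].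
  exists k; split=> //; have := ascendE wk sk; nlia.
exists k; split; try exact: adj_swap.
have uk := adj_swap ku; have := germ_lip gF uw uk (adj_swap kw).
have := germ_lip gF uk ur (adj_swap rk).
rewrite ascend_near; auto; nlia.
Qed.

(** The square u w p t carries the edge pz of the link of w to a dipping edge tk of
the link of u. *)
Lemma ascend_side p t z : sq u w p t -> F t = F u -> adj w z -> adj z p -> E z = F u -> z != u ->
  exists k, [/\ adj u k, adj t k, dips u F t k &
     [\/ k = z, sq u w z k | [/\ nadj u z, adj k w, adj k z & adj k p]]].
Proof.
move=> s Ft wz zp Ez zu.
have ut : adj u t by config [:: u; w; p; t].
have mid k : adj u k -> F k = F u -> adj k w -> adj k p -> adj t k /\ dips u F t k.
  move=> uk Fk kw kp; have kt : adj k t by config [:: u; w; p; t; k].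
  split; first exact: adj_swap.
  have nwt : nadj w t by config [:: u; w; p; t].
  have := germ_dips gF uk uw ut kw kt nwt.
  by rewrite (dipsC u F k w) (dips_top gF uw uk (adj_swap kw) Fw) (dipsC u F k t); case: dips => //; nlia.
case: (far_or_near wz) => [E0|uz|nuz]; first by rewrite E0 eqxx in zu.
  have [tz dz] : adj t z /\ dips u F t z.
    by apply: mid => //; [rewrite -Ez ascend_near //; auto|apply: adj_swap].
  by exists z; split=> //; constructor 1.
case: (ascend_cases wz nuz) => [[k [sk uk Ek]]|[x [y [[sk H] [ux uy wx wy] ? ?]]]].
  have tk : adj t k by config [:: u; w; p; t; z; k].
  by exists k; split=> //; [apply: dips_low => //; nlia|constructor 2].
have [k [uk Fk [wk kz kp]]] : exists k, [/\ adj u k, F k = F u & [/\ adj w k, adj k z & adj k p]].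
  have [px|px] := boolP (adj x p).
    by exists x; split; [|nlia|split=> //; config [:: u; x; z; y]].
  by exists y; split; [|nlia|split=> //; config [:: u; x; z; y; w; p; t]].
have [tk dk] := mid k uk Fk (adj_swap wk) kp.
by exists k; split=> //; constructor 3; split=> //; apply: adj_swap.
Qed.

(** Two descending neighbours q and r of p would, by [ascend_side], give two dipping
edges at the level vertex t, against [germ_dips]. When p has no such t, the
square seen by w takes its place. *)
Lemma ascend_conv p q r : adj w p -> adj w q -> adj w r -> adj p q -> adj p r -> nadj q r ->
  E q = F u -> E r = F u -> E p = F u.
Proof.
move=> wp wq wr pq pr nqr Eq Er.
have Rp := ascend_range wp; have Lp := ascend_lip wp wq pq.
apply/eqP/contraT => ne; have {ne} Ep : E p = (F u).+1 by nlia.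
exfalso.
have high y z : adj w z -> nadj u z -> E z = F u -> adj u y -> adj w y -> adj y z ->
    F y = (F u).+1 -> False.
  by move=> wz nuz Ez uy wy yz Fy; have := ascend_low wz nuz Ez uy wy yz; nlia.
case: (far_or_near wp) => [E0|up|nup].
- by rewrite E0 ascend_near /nbh ?eqxx // in Ep; nlia.
- have Fp : F p = (F u).+1 by rewrite -Ep ascend_near //; auto.
  have nfar z : adj w z -> adj p z -> E z = F u -> nbh u z.
    move=> wz pz Ez; apply/contraT => /nbh_far nuz.
    by case: (high p z).
  have [uq ur] := (nfar q wq pq Eq, nfar r wr pr Er).
  case/orP: uq => [/eqP E0|uq]; first by case/orP: ur => [/eqP in_square'|ur]; config [:: u; q; r].
  case/orP: ur => [/eqP E0|ur]; first by config [:: u; q; r].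
  by config [:: u; w; p; q; r].
have [qu ru] : q != u /\ r != u by config [:: u; p; q; r].
case: (ascend_cases wp nup) => [[t [s ut Et]]|[a [b [[s H] [ua ub wa wb] Ha Hb]]]].
  have Ft : F t = F u by nlia.
  have [k [uk tk dk hk]] := ascend_side s Ft wq (adj_swap pq) Eq qu.
  have [l [ul tl dl hl]] := ascend_side s Ft wr (adj_swap pr) Er ru.
  have nkl : nadj k l.
    case: hk => [E0|sk|[nuq kw kq kp]]; case: hl => [E0'|sl|[nur lw lr lp]];
    try rewrite E0 in uk tk dk *; try rewrite E0' in ul tl dl *;
    by config [:: u; w; p; t; q; r; k; l].
  have := germ_dips gF ut uk ul tk tl nkl; rewrite dk dl; nlia.
have [a' [b' [s' [ua' ub' wa' wb'] Fa Fb]]] : exists a b, [/\ sq u a p b,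
   [/\ adj u a, adj u b, adj w a & adj w b], F a = F u & F b = (F u).+1].
  have [Fa|Fa] := eqVneq (F a) (F u); first by exists a, b; split=> //; nlia.
  exists b, a; split=> //; try by nlia.
  by config [:: u; a; p; b].
have low z : adj w z -> adj p z -> E z = F u -> z != u -> z = a' \/ nadj u z /\ adj a' z.
  move=> wz pz Ez zu; case: (far_or_near wz) => [E0|uz|nuz].
  - by rewrite E0 eqxx in zu.
  - left; have [//|za] := eqVneq z a'.
    have zb : z = b' by config [:: u; w; p; a'; b'; z].
    by rewrite zb ascend_near in Ez; auto; nlia.
  - right; split=> //; apply/contraT => naz; exfalso.
    apply: (high b' z) => //; by config [:: u; w; p; a'; b'; z].
case: (low q wq pq Eq qu) => [E0|[nuq aq]]; case: (low r wr pr Er ru) => [E0'|[nur ar]].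
- by config [:: q; r; a'].
- by rewrite E0 in nqr; config [:: r; a'].
- by rewrite E0' in nqr; config [:: q; a'].
- by config [:: u; w; p; q; r; a'; b'].
Qed.

(** Together with [ascend_compat], this transports germs along ascending edges. *)
Lemma ascend_germ : germ w E.
Proof.
have Ew : E w = (F u).+1 by rewrite ascend_near; auto.
split.
- by move=> x wx; have := ascend_range wx; rewrite Ew; nlia.
- exact: ascend_lip.
- exact: ascend_desc.
- move=> p q r wp wq wr pq pr nqr; rewrite Ew => -[Eq] [Er].
  by rewrite (ascend_conv wp wq wr pq pr nqr Eq Er).
Qed.

End Ascent.

(** * Transport along walks *)

(** A germ of level n that can be transported downwards, along all descending paths,
until level 0. Germs of distance functions have this property; as the transported
germs need not come from a function on the graph, it is carried along. *)
Fixpoint good n u (F : V -> nat) : Prop :=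
  [/\ germ u F, F u = n &
      if n is m.+1 then forall w, adj u w -> F w = m ->
        exists F', good m w F' /\ compat u F w F' else True].

Lemma good_germ n u F : good n u F -> germ u F.
Proof. by case: n => [|n] []. Qed.

Lemma good_val n u F : good n u F -> F u = n.
Proof. by case: n => [|n] []. Qed.

Lemma good_down n u F w : good n u F -> adj u w -> (F w).+1 = n ->
  exists F', good (F w) w F' /\ compat u F w F'.
Proof.
by case: n => // n [_ _ H] uw [Ew]; rewrite Ew; apply: H.
Qed.

(** Germs can be transported along every edge: downwards by definition, along a level
edge through the common descending neighbour of its ends, and upwards by [ascend].
In each case the triangles and squares met are closed by [compat_tri] and
[compat_square], and induction on the level serves the descending germs. *)
Lemma good_step n u F w : good n u F -> adj u w ->
  exists F', good (F w) w F' /\ compat u F w F'.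
Proof.
elim/ltn_ind: n => n IH in u F w *.
have flat v K x : good n v K -> adj v x -> K x = n ->
    exists F', good n x F' /\ compat v K x F'.
  move=> gK vx Kx; have gv := good_germ gK.
  have [r [vr xr Kr]] := germ_desc gv vx (etrans Kx (esym (good_val gK))).
  rewrite (good_val gK) in Kr.
  have [Kr' [gr cr]] := good_down gK vr Kr.
  have lt : K r < n by rewrite -Kr.
  have [Kx' [gx cx]] := IH _ lt _ _ _ gr (adj_swap xr).
  have E : Kr' x = n by rewrite -(compat_eq cr (adj_nbh vx) (adj_nbh (adj_swap xr))).
  rewrite E in gx; exists Kx'; split=> //.
  exact: compat_tri vr (adj_swap xr) vx gv (good_germ gr) (good_germ gx) cr cx.
move=> gF uw; have gu := good_germ gF; have Fu := good_val gF.
have [L1 L2] := germ_step gu uw.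
have [Fw|] := eqVneq (F w).+1 n; first exact: good_down gF uw Fw.
have [Fw _|] := eqVneq (F w) n; first by rewrite Fw; apply: flat.
move=> ne1 ne2; have {ne1 ne2 L1 L2} Fw : F w = (F u).+1 by nlia.
have gE := ascend_germ gu uw Fw; have cE := ascend_compat gu uw Fw.
have Ew : ascend u F w = n.+1 by rewrite ascend_near ?Fw ?Fu //; auto.
exists (ascend u F); split=> //; rewrite Fw Fu; split=> // y wy Ey.
have wu := adj_swap uw.
case: (far_or_near u wy) => [E0|uy|nuy].
- by rewrite E0; exists F; split=> //; apply: compatC.
- have Fy : F y = n by rewrite -(ascend_near F (adj_nbh uy)).
  have [Fy' [gy cy]] := flat _ _ _ gF uy Fy.
  exists Fy'; split=> //.
  exact: compat_tri wu uy wy gE gu (good_germ gy) (compatC uw cE) cy.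
case: (ascend_cases gu uw Fw wy nuy) => [[t [s ut Et]]|[p [q [[s H] [up uq wp wq] Hp Hq]]]].
- have Ft : (F t).+1 = n by rewrite -Et.
  have [Ft' [gt ct]] := good_down gF ut Ft.
  have lt : F t < n by rewrite -Ft.
  have ty : adj t y by config [:: u; w; y; t].
  have [Fy' [gy cy]] := IH _ lt _ _ _ gt ty.
  have s' : sq u t y w by config [:: u; w; y; t].
  have Ety : Ft' y = n by have := compat_sq ct s'; rewrite (good_val gt); nlia.
  rewrite Ety in gy; exists Fy'; split=> //.
  have s2 : sq t u w y by config [:: u; w; y; t].
  apply: compatC; first exact: adj_swap.
  exact: compat_square s2 (good_germ gt) gu gE (good_germ gy) (compatC ut ct) cE cy.
- have Fp : F p = n by nlia.
  have [Fp' [gp cp]] := flat _ _ _ gF up Fp.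
  have cpw := compat_tri (adj_swap up) uw (adj_swap wp) (good_germ gp) gu gE (compatC up cp) cE.
  have py : adj p y by config [:: u; p; y; q].
  have Epy : Fp' y = n by rewrite (compat_eq cpw (adj_nbh py) (adj_nbh wy)).
  have [Fy' [gy cy]] := flat _ _ _ gp py Epy.
  exists Fy'; split=> //.
  exact: compat_tri wp py wy gE (good_germ gp) (good_germ gy) (compatC (adj_swap wp) cpw) cy.
Qed.

(** Homotopy of walks across triangles and squares. A walk from u is given by the
sequence of its later vertices. *)
Inductive walk_homot : V -> seq V -> seq V -> Prop :=
| HomotRefl u p : walk_homot u p p
| HomotSym u p q : walk_homot u p q -> walk_homot u q p
| HomotTrans u p q r : walk_homot u p q -> walk_homot u q r -> walk_homot u p r
| HomotCons u x p q : adj u x -> walk_homot x p q -> walk_homot u (x :: p) (x :: q)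
| HomotBack u x p : adj u x -> walk_homot u [:: x, u & p] p
| HomotTriangle u x y p : adj u x -> adj x y -> adj u y -> walk_homot u [:: x, y & p] (y :: p)
| HomotSquare u x y z p : sq u x y z -> walk_homot u [:: x, y & p] [:: z, y & p].

Lemma walk_homot_catr u p q r : walk_homot u p q -> walk_homot u (p ++ r) (q ++ r).
Proof.
elim=> {u p q} [u p|u p q _|u p q s _ IH1 _ IH2|u x p q ux _|u x p ux|u x y p ux xy uy|u x y z p s] /=.
- exact: HomotRefl.
- exact: HomotSym.
- exact: HomotTrans IH1 IH2.
- exact: HomotCons.
- exact: HomotBack.
- exact: HomotTriangle.
- exact: HomotSquare.
Qed.

Lemma walk_homot_catl u r p q :
  path adj u r -> walk_homot (last u r) p q -> walk_homot u (r ++ p) (r ++ q).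
Proof.
by elim: r u => //= x r IH u /andP[ux pr] h; apply: HomotCons => //; apply: IH.
Qed.

Definition walk_rev u (p : seq V) := rev (belast u p).

Lemma walk_rev_cons u x p : walk_rev u (x :: p) = rcons (walk_rev x p) u.
Proof. by rewrite /walk_rev /= rev_cons. Qed.

Lemma walk_rev_path u p : path adj u p ->
  path adj (last u p) (walk_rev u p) /\ last (last u p) (walk_rev u p) = u.
Proof.
elim: p u => //= x p IH u /andP[ux /IH[h1 h2]].
by rewrite walk_rev_cons rcons_path last_rcons h1 h2 (adj_swap ux).
Qed.

Lemma walk_homot_rev u p q : path adj u p -> walk_homot (last u p) (walk_rev u p ++ p ++ q) q.
Proof.
elim: p u => [|x p IH] u /=; first by move=> _; apply: HomotRefl.
case/andP=> ux px; have [b1 b2] := walk_rev_path px.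
rewrite walk_rev_cons cat_rcons; apply: HomotTrans (IH _ px).
by apply: walk_homot_catl => //; rewrite b2; apply: HomotBack; apply: adj_swap.
Qed.

(** The transport of the germ F along the walk p exists and leads to the germ G at w,
at levels at most N after the first vertex. *)
Fixpoint transport N u (F : V -> nat) p w (G : V -> nat) : Prop :=
  if p is x :: p' then adj u x /\ exists Fx,
    [/\ good (Fx x) x Fx, Fx x <= N, compat u F x Fx & transport N x Fx p' w G]
  else u = w /\ forall x, nbh u x -> F x = G x.

Lemma compat_congr u F F' w G : (forall x, nbh u x -> F x = F' x) ->
  compat u F w G -> compat u F' w G.
Proof.
move=> FF [ceq csq]; split=> [x ux wx|z p s]; first by rewrite -FF // ceq.
have up : adj u p by config [:: u; w; z; p].
by rewrite -!FF ?csq //; auto.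
Qed.

Lemma transport_congr N u F F' p w G : (forall x, nbh u x -> F x = F' x) ->
  transport N u F p w G -> transport N u F' p w G.
Proof.
case: p => [|x p] FF /= [h1 h2]; first by split=> // x ux; rewrite -FF ?h2.
split=> //; case: h2 => [Fx [h h' c l]]; exists Fx; split=> //.
exact: compat_congr FF c.
Qed.

Lemma transport_cat N u F p w G q v H :
  transport N u F p w G -> transport N w G q v H -> transport N u F (p ++ q) v H.
Proof.
elim: p u F => [|x p IH] u F /=.
  by case=> -> FG; apply: transport_congr => x ux; rewrite FG.
by case=> ux [Fx [h1 h2 h3 h4]] l; split=> //; exists Fx; split=> //; apply: IH.
Qed.

Lemma transport_path N u F p w G : transport N u F p w G -> path adj u p /\ last u p = w.
Proof.
elim: p u F => [|x p IH] u F /=; first by case.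
by case=> -> [Fx [_ _ _ /IH[h1 h2]]].
Qed.

Lemma transport_leq N M u F p w G : N <= M -> transport N u F p w G -> transport M u F p w G.
Proof.
move=> NM; elim: p u F => [|x p IH] u F //= [ux [Fx [h1 h2 h3 h4]]].
by split=> //; exists Fx; split=> //; [exact: leq_trans NM|exact: IH].
Qed.

Lemma transport_exists u F p : good (F u) u F -> path adj u p ->
  exists N G, transport N u F p (last u p) G /\ good (G (last u p)) (last u p) G.
Proof.
elim: p u F => [|x p IH] u F gF /=; first by exists 0, F.
case/andP=> ux px; have [Fx [gx cx]] := good_step gF ux.
have [_ E] := compat_ends ux cx; rewrite E in gx.
have [N [G [l g]]] := IH _ _ gx px.
exists (maxn N (Fx x)), G; split=> //; split=> //; exists Fx; split=> //.
  exact: leq_maxr.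
by apply: transport_leq l; apply: leq_maxl.
Qed.

(** Transports of germs that differ by a constant differ by the same constant. *)
Lemma transport_shift N N' u F F' p w G G' a b :
  transport N u F p w G -> transport N' u F' p w G' ->
  (forall x, nbh u x -> F x + a = F' x + b) ->
  forall x, nbh w x -> G x + a = G' x + b.
Proof.
elim: p u F F' => [|x p IH] u F F' /=.
  by case=> <- FG [_ FG'] FF x ux; rewrite -FG // -FG' // FF.
case=> ux [Fx [h1 h2 h3 h4]] [_ [Fx' [h1' h2' h3' h4']]] FF.
apply: (IH x Fx Fx') => //.
exact: compat_uniq ux (good_germ h1) (good_germ h1') h3 h3' FF.
Qed.

Lemma transport_rev N u F p w G : good (F u) u F -> F u <= N ->
  transport N u F p w G -> transport N w G (walk_rev u p) u F.
Proof.
elim: p u F => [|x p IH] u F gF FN /=; first by case=> -> FG; split=> // x wx; rewrite FG.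
case=> ux [Fx [h1 h2 h3 h4]]; rewrite walk_rev_cons -cats1.
apply: transport_cat (IH _ _ h1 h2 h4) _ => /=.
split; first exact: adj_swap.
by exists F; split=> //; apply: compatC.
Qed.

Lemma good_eq u F : good (F u) u F -> forall n, F u = n -> good n u F.
Proof. by move=> g n <-. Qed.

(** A passage u w x over a vertex w of higher level can be pushed to the level of its
ends: across a triangle, or across a square of the interval of u and x that contains
w or is seen by w, whose remaining vertices are lower than w because its two
diagonals have the same sum. The germ at x is not affected. *)
Lemma bypass N u w x Fu Fw Fx : adj u w -> adj w x ->
  good (Fu u) u Fu -> good N.+1 w Fw -> good (Fx x) x Fx ->
  compat u Fu w Fw -> compat w Fw x Fx -> Fu u = N -> Fx x = N ->
  exists q, transport N u Fu q x Fx /\ forall r, walk_homot u [:: w, x & r] (q ++ r).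
Proof.
move=> uw wx gu gw gx cuw cwx Nu Nx.
have wu := adj_swap uw; have xw := adj_swap wx.
have [Euu Euw] := compat_ends uw cuw; have [Eww Ewx] := compat_ends wx cwx.
have Ew := good_val gw.
have [E0|ne] := eqVneq u x.
  exists [::]; split; last by move=> r; rewrite -E0; apply: HomotBack.
  split=> // y uy; rewrite -E0 in gx cwx Nx *.
  have := compat_uniq wu (good_germ gu) (good_germ gx) (compatC uw cuw) cwx
    (fun _ _ => erefl (Fw _ + 0)) uy.
  by nlia.
have [ux|nux] := boolP (adj u x).
  exists [:: x]; split; last by move=> r; apply: HomotTriangle.
  split=> //; exists Fx; split=> //; first by rewrite Nx.
  exact: compat_tri uw wx ux (good_germ gu) (good_germ gw) (good_germ gx) cuw cwx.
have nux' : nadj u x by rewrite /nadj ne.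
have [[y s]|[p [q [s wp wq]]]] := rim_or_hub nux' uw wx.
- have [uy yx] : adj u y /\ adj y x by config [:: u; w; x; y].
  have swu : sq w u y x by config [:: u; w; x; y].
  have H := compat_sq (compatC uw cuw) swu.
  have Ey : (Fu y).+1 = N by nlia.
  have [Fy [gy cy]] := good_down (good_eq gu Nu) uy Ey.
  have [Fx' [gx' cx']] := good_step gy yx.
  have syu : sq y u w x by config [:: u; w; x; y].
  have cxw := compat_square syu (good_germ gy) (good_germ gu) (good_germ gw) (good_germ gx')
    (compatC uy cy) cuw cx'.
  have EF z : nbh x z -> Fx' z = Fx z.
    move=> xz; have := compat_uniq wx (good_germ gx') (good_germ gx) (compatC xw cxw) cwx
      (fun _ _ => erefl (Fw _ + 0)) xz; nlia.
  have cyx : compat y Fy x Fx.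
    apply: compatC; first exact: adj_swap.
    exact: compat_congr EF (compatC yx cx').
  exists [:: y; x]; split; last by move=> r; apply: HomotSquare.
  have Eyy : Fy y = Fu y by have [] := compat_ends uy cy.
  split=> //; exists Fy; split; rewrite ?Eyy //; first by nlia.
  split=> //; exists Fx; split=> //; by rewrite Nx.
- have [up px] : adj u p /\ adj p x by config [:: u; p; x; q].
  have [uq qx] : adj u q /\ adj q x by config [:: u; p; x; q].
  have H := germ_square (good_germ gw) s wu wp wx wq.
  have [_ Lp] := germ_step (good_germ gw) wp; have [_ Lq] := germ_step (good_germ gw) wq.
  have Ep : (Fw p).+1 = N.+1 by nlia.
  have [Fp [gp cp]] := good_down gw wp Ep.
  have [_ Epp] := compat_ends wp cp; rewrite Epp in gp.
  exists [:: p; x]; split.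
    split=> //; exists Fp; split=> //; first by nlia.
      exact: compat_tri uw wp up (good_germ gu) (good_germ gw) (good_germ gp) cuw cp.
    split=> //; exists Fx; split=> //; first by rewrite Nx.
    exact: compat_tri (adj_swap wp) wx px (good_germ gp) (good_germ gw) (good_germ gx)
      (compatC wp cp) cwx.
  move=> r; apply: HomotTrans (HomotSym _) (HomotTriangle _ uw wp up).
  by apply: HomotCons => //; apply: HomotTriangle.
Qed.

(** Mountain pass: with both ends at level at most N, all visits to level N + 1 can be
removed. A single visit is treated by [bypass]. An edge at level N + 1 is first
replaced by the two edges through a common descending neighbour of its ends. *)
Lemma lower_walk N p u F w G : good (F u) u F -> F u <= N -> G w <= N ->
  transport N.+1 u F p w G -> exists q, transport N u F q w G /\ walk_homot u p q.
Proof.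
move: {2}(size p) (leqnn (size p)) => k.
elim: k p u F => [|k IH] [|x p] u F //=; try by exists [::]; split=> //; apply: HomotRefl.
rewrite ltnS => kp gF FN GN [ux [Fx [gx xN cx l]]].
have [Fuu Fux] := compat_ends ux cx.
have [xN'|] := leqP (Fx x) N.
  have [q [lq hq]] := IH _ _ _ kp gx xN' GN l.
  by exists (x :: q); split; [split=> //; exists Fx|apply: HomotCons].
move=> Nx; have Ex : Fx x = N.+1 by nlia.
have Eu : F u = N.
  by have [_ h] := germ_step (good_germ gx) (adj_swap ux); nlia.
rewrite Ex in gx.
case: p kp l => [|y p] kp /=.
  by case=> E0 FG; have := FG _ (nbhx x); rewrite E0 in Ex *; nlia.
case=> xy [Fy [gy yN cy l]].
have [Exx Exy] := compat_ends xy cy.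
have [yN'|yN'] := leqP (Fy y) N.
  have Ey : Fy y = N by have [_ h] := germ_step (good_germ gx) xy; nlia.
  have [q [lq hq]] := bypass ux xy gF gx gy cx cy Eu Ey.
  have [q' [lq' hq']] := IH p y Fy (ltnW kp) gy yN' GN l.
  exists (q ++ q'); split; first exact: transport_cat lq lq'.
  apply: HomotTrans (hq p) _.
  by have [h1 h2] := transport_path lq; apply: walk_homot_catl => //; rewrite h2.
have Ey : Fx y = Fx x by nlia.
have [z [xz yz Ez]] := germ_desc (good_germ gx) xy Ey.
have [Fz [gz cz]] := good_down gx xz (etrans Ez Ex).
have [_ Exz] := compat_ends xz cz; rewrite Exz in gz.
have czy := compat_tri (adj_swap xz) xy (adj_swap yz) (good_germ gz) (good_germ gx) (good_germ gy)
  (compatC xz cz) cy.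
have Ezz : Fz z = N by nlia.
have [q [lq hq]] := bypass ux xz gF gx gz cx cz Eu Ezz.
have [q' [lq' hq']] : exists q, transport N z Fz q w G /\ walk_homot z (y :: p) q.
  apply: IH => //=; first by nlia.
  by split; [exact: adj_swap|exists Fy; split].
exists (q ++ q'); split; first exact: transport_cat lq lq'.
apply: HomotTrans (HomotCons ux (HomotSym (HomotTriangle p xz (adj_swap yz) xy))) _.
apply: HomotTrans (hq _) _.
by have [h1 h2] := transport_path lq; apply: walk_homot_catl => //; rewrite h2.
Qed.

(** The germ of a distance function at the base vertex itself is a source. *)
Definition source u (F : V -> nat) := forall x, adj u x -> F x = (F u).+1.

(** The last step into a source goes down, so a source is never at the highest level
of a walk that leads to it. *)
Lemma transport_source N u F p w G : F u <= N -> source w G -> transport N u F p w G ->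
  p = [::] \/ G w < N.
Proof.
move=> FN sG; elim: p u F FN => [|x p IH] u F FN /=; first by left.
case=> ux [Fx [gx xN cx l]]; right.
have [E0|//] := IH _ _ xN l.
rewrite E0 /= in l; case: l => in_square' FG; rewrite -in_square' in sG *.
have [Euu _] := compat_ends ux cx.
have xu := adj_swap ux; rewrite -(FG _ (nbhx x)).
have := sG _ xu; rewrite -(FG _ (adj_nbh xu)) -(FG _ (nbhx x)); nlia.
Qed.

(** As both ends stay below the highest level, [lower_walk] applies until that level
is 0, where no step is possible. *)
Lemma contract_walk N u F p G :
  good 0 u F -> source u G -> transport N u F p u G -> walk_homot u p [::].
Proof.
move=> gF sG; have Fu := good_val gF.
have gF' : good (F u) u F by rewrite Fu.
elim: N p => [|N IH] p l.
  have [->|//] : p = [::] \/ G u < 0 by apply: transport_source sG l; rewrite Fu.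
  exact: HomotRefl.
have [->|GN] : p = [::] \/ G u < N.+1 by apply: transport_source sG l; rewrite Fu.
  exact: HomotRefl.
have FN : F u <= N by rewrite Fu.
have [q [lq hq]] := lower_walk gF' FN GN l.
exact: HomotTrans hq (IH _ lq).
Qed.

(** The descending neighbours determine the germ up to a constant, as the level ones
are those neighbours that are not descending but adjacent to a descending one. *)
Lemma germ_determined u F G : germ u F -> germ u G ->
  (forall x, adj u x -> (F x < F u) = (G x < G u)) ->
  forall x, nbh u x -> F x + G u = G x + F u.
Proof.
move=> gF gG H.
have half K K' : germ u K -> germ u K' ->
    (forall x, adj u x -> (K x < K u) = (K' x < K' u)) ->
    forall x, adj u x -> K x + K' u <= K' x + K u.
  move=> gK gK' HK x ux.
  have [L1 L2] := germ_step gK ux; have [L1' L2'] := germ_step gK' ux.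
  have Hx := HK _ ux.
  have [lt|le] := ltnP (K x) (K u); first by nlia.
  have [eq|ne] := eqVneq (K' x) (K' u); last by nlia.
  have [y [uy xy Ky]] := germ_desc gK' ux eq.
  have := HK _ uy; have := germ_lip gK ux uy xy; nlia.
move=> x /orP[/eqP ->|ux]; first by nlia.
have := half _ _ gF gG H _ ux.
have := half _ _ gG gF (fun x ux => esym (H x ux)) _ ux; nlia.
Qed.

Definition dist_germ u (x : V) : nat := x != u.

Lemma good_dist_germ u : good 0 u (dist_germ u).
Proof.
have E0 : dist_germ u u = 0 by rewrite /dist_germ eqxx.
have in_square' x : adj u x -> dist_germ u x = 1.
  by move=> ux; rewrite /dist_germ; have -> : x != u by config [:: u; x].
split=> //; split.
- by move=> x ux; rewrite E0 in_square'.
- by move=> x y ux uy _; rewrite !in_square'.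
- by move=> x ux; rewrite E0 in_square'.
- by move=> p q r up uq ur _ _ _; rewrite E0.
Qed.

(** The code of a closed walk p is the set of descending neighbours of v for the germ
obtained at the end of p from the germ of the distance to v. If p and q have the
same code, these final germs agree up to a constant, hence transport along q
backwards turns the final germ of p into a source, and p followed by the inverse
of q is contractible. *)
Lemma walk_code v : exists code : seq V -> V -> Prop,
  (forall p x, code p x -> adj v x) /\
  (forall p q, path adj v p -> last v p = v -> path adj v q -> last v q = v ->
     (forall x, code p x <-> code q x) -> walk_homot v p q).
Proof.
pose F0 := dist_germ v.
have g0 : good (F0 v) v F0 by rewrite {1}/F0 /dist_germ eqxx; apply: good_dist_germ.
have /choice[end_of endP] p : exists NG : nat * (V -> nat), path adj v p -> last v p = v ->
    transport NG.1 v F0 p v NG.2 /\ good (NG.2 v) v NG.2.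
  case: (boolP (path adj v p)) => pp; last by exists (0, F0).
  have [N [G [l g]]] := transport_exists g0 pp.
  by exists (N, G) => _ E0; rewrite E0 in l g.
exists (fun p x => adj v x /\ (end_of p).2 x < (end_of p).2 v); split; first by move=> p x [].
move=> p q pp lp pq lq same.
have [lp' gp] := endP _ pp lp; have [lq' gq] := endP _ pq lq.
set G := (end_of p).2 in lp' gp same *; set G' := (end_of q).2 in lq' gq same *.
have GG := germ_determined (good_germ gp) (good_germ gq).
have {}GG : forall x, nbh v x -> G x + G' v = G' x + G v.
  apply: GG => x vx; apply/idP/idP => h.
    by have /same[] : adj v x /\ G x < G v by [].
  by have /same[] : adj v x /\ G' x < G' v by [].
have [bq1 bq2] := walk_rev_path pq; rewrite lq in bq1 bq2.
have [N [K [lK gK]]] := transport_exists gp bq1; rewrite bq2 in lK gK.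
set M := (end_of q).1 in lq'.
have lqb : transport (maxn M (F0 v)) v G' (walk_rev v q) v F0.
  by apply: transport_rev => //; [exact: leq_maxr|apply: transport_leq lq'; exact: leq_maxl].
have KF := transport_shift lK lqb GG.
have sK : source v K.
  move=> x vx; have := KF _ (adj_nbh vx); have := KF _ (nbhx v).
  have -> : F0 v = 0 by rewrite /F0 /dist_germ eqxx.
  have xv : x != v by config [:: v; x].
  have -> : F0 x = 1 by rewrite /F0 /dist_germ xv.
  nlia.
set M' := (end_of p).1 in lp'.
have l : transport (maxn M' N) v F0 (p ++ walk_rev v q) v K.
  by apply: transport_cat (transport_leq _ lp') (transport_leq _ lK); [exact: leq_maxl|exact: leq_maxr].
have null : walk_homot v (p ++ walk_rev v q) [::] by apply: contract_walk sK l; apply: good_dist_germ.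
have := walk_homot_rev [::] pq; rewrite lq cats0 => bq.
have := @walk_homot_catl v p (walk_rev v q ++ q) [::] pp; rewrite lp cats0 => /(_ bq) h1.
apply: HomotTrans (HomotSym h1) _.
by rewrite catA; apply: walk_homot_catr null.
Qed.
End Graph.

(** * Graphs with the interval and local positioning conditions *)
Section Distance.
Variable G : graph.
Hypothesis G_conn : connected_graph G.
Implicit Types u v w x : G.
Notation apart := (@nadj G adj).
Notation quad := (@sq G adj).

Lemma has_walk0 u v : has_walk u v 0 = (u == v).
Proof.
by apply/asboolP/eqP => [[[|x p] []]//|->]; exists [::].
Qed.

Lemma has_walk1 u v : has_walk u v 1 = adj u v.
Proof.
apply/asboolP/idP => [[[|x [|y p]] []] //=|uv]; first by rewrite andbT => ? <-.
by exists [:: v]; rewrite /= uv.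
Qed.

Lemma has_walk2 u x v : adj u x -> adj x v -> has_walk u v 2.
Proof. by move=> ux xv; apply/asboolP; exists [:: x; v]; rewrite /= ux xv. Qed.

Lemma gdistP u v : has_walk u v (gdist u v) /\ forall n, has_walk u v n -> gdist u v <= n.
Proof.
rewrite /gdist; case: pselect => [h|[]]; last exact: G_conn.
by case: ex_minnP => m hm min; split.
Qed.

Lemma gdist_xx u : gdist u u = 0.
Proof. by apply/eqP; rewrite -leqn0; apply: (gdistP u u).2; rewrite has_walk0. Qed.

Lemma gdist_ge2 u v : apart u v -> 2 <= gdist u v.
Proof.
case/andP=> ne nuv; have [] := gdistP u v; case: gdist => [|[|//]].
  by rewrite has_walk0 (negbTE ne).
by rewrite has_walk1 (negbTE nuv).
Qed.

Lemma gdist1 u v : adj u v -> gdist u v = 1.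
Proof.
move=> uv; have [h min] := gdistP u v.
have := min 1; rewrite has_walk1 => /(_ uv).
case: gdist h => [|[|//]] //; rewrite has_walk0 => /eqP E.
by rewrite E adj_irrefl in uv.
Qed.

Lemma gdist2 u x v : apart u v -> adj u x -> adj x v -> gdist u v = 2.
Proof.
move=> nuv ux xv; apply/eqP; rewrite eqn_leq gdist_ge2 // andbT.
exact: (gdistP u v).2 _ (has_walk2 ux xv).
Qed.

Lemma gdist2P u v : gdist u v = 2 -> exists2 x, adj u x & adj x v.
Proof.
move=> E; have [] := gdistP u v; rewrite E => /asboolP[[|x [|y [|z p]]] []] //=.
by rewrite andbT => /andP[ux xy] <- _ _; exists x.
Qed.

Lemma squareP a b c d : square a b c d <-> quad a b c d.
Proof.
rewrite /sq /nadj; split=> [[[-> -> -> ->]] [-> -> -> ->]//|].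
by case/and5P=> ? ? ? ? /andP[/andP[? ?] /andP[? ?]].
Qed.

Lemma octahedron_clique (u z x y t : 'I_6) : u != z -> ~~ octahedron u z ->
  octahedron u x -> octahedron u y -> octahedron u t ->
  octahedron x y -> octahedron x t -> octahedron y t -> False.
Proof.
have B (i : 'I_6) : i./2 < 3 by case: i => [[|[|[|[|[|[|//]]]]]] h].
rewrite /octahedron => -> /= _ /andP[_ h1] /andP[_ h2] /andP[_ h3] /andP[_ h4] /andP[_ h5] /andP[_ h6].
move: (B u) (B x) (B y) (B t) h1 h2 h3 h4 h5 h6.
move: (u./2) (x./2) (y./2) (t./2) => a b c d.
lia.
Qed.

Lemma octahedron_mates (x y t : 'I_6) : x != y -> ~~ octahedron x y ->
  x != t -> ~~ octahedron x t -> y = t.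
Proof.
rewrite /octahedron => xy; rewrite xy /= negbK => /eqP h xt; rewrite xt /= negbK => /eqP h'.
apply/val_inj/eqP => /=; move: xy xt; rewrite -!val_eqE /=.
rewrite -(odd_double_half x) -(odd_double_half y) -(odd_double_half t) -h -h'.
by case: (odd x); case: (odd y); case: (odd t); rewrite ?eqxx.
Qed.

(** The square and the wheel are induced subgraphs of the octahedron with antipodes
0 1, 2 3 and 4 5: the vertices 0, 1, 2, 3 of the cycle go to 0, 2, 1, 3, the hub
to 4. *)
Definition cycle_code (i : 'I_4) : 'I_6 := inord (i./2 + (odd i).*2).
Definition wheel_code (a : option 'I_4) : 'I_6 := if a is Some i then cycle_code i else inord 4.

Lemma cycle_codeE i : cycle_code i = i./2 + (odd i).*2 :> nat.
Proof. by rewrite inordK //; case: i => [[|[|[|[|//]]]] hi]. Qed.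

Lemma cycle_codeP i j : cycle4 i j = octahedron (cycle_code i) (cycle_code j).
Proof.
rewrite /cycle4 /octahedron -!val_eqE [val]lock /= -lock !cycle_codeE.
by case: i => [[|[|[|[|//]]]] hi]; case: j => [[|[|[|[|//]]]] hj].
Qed.

Lemma wheel_codeP a b : wheel4 a b = octahedron (wheel_code a) (wheel_code b).
Proof.
have E4 : (inord 4 : 'I_6) = 4 :> nat by rewrite inordK.
case: a b => [i|] [j|]; rewrite /wheel_code /=; try exact: cycle_codeP;
  rewrite /octahedron -?val_eqE [val]lock /= -lock ?cycle_codeE ?E4 //.
- by case: i => [[|[|[|[|//]]]] hi].
- by case: j => [[|[|[|[|//]]]] hi].
Qed.

Lemma cycle_code_inj : injective cycle_code.
Proof.
move=> i j /(congr1 val) /=; rewrite !cycle_codeE => E; apply/val_inj; move: E.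
by case: i => [[|[|[|[|//]]]] hi]; case: j => [[|[|[|[|//]]]] hj].
Qed.

Lemma wheel_code_inj : injective wheel_code.
Proof.
have E4 : (inord 4 : 'I_6) = 4 :> nat by rewrite inordK.
move=> [i|] [j|] //=; first by move=> /cycle_code_inj ->.
  by move=> /(congr1 (@nat_of_ord _)); rewrite cycle_codeE E4; case: i => [[|[|[|[|//]]]] hi].
by move=> /(congr1 (@nat_of_ord _)); rewrite cycle_codeE E4; case: j => [[|[|[|[|//]]]] hi].
Qed.

Lemma cycle4_opposite (i j : 'I_4) : i != j -> ~~ cycle4 i j ->
  exists p q, [/\ cycle4 i p, cycle4 p j, cycle4 j q, cycle4 q i & (p != q) && ~~ cycle4 p q].
Proof.
move=> ij nij; exists (ordS i), (ordS j); move: ij nij.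
rewrite /cycle4 -!val_eqE /=.
by case: i => [[|[|[|[|//]]]] hi]; case: j => [[|[|[|[|//]]]] hj].
Qed.

Lemma octahedron_opposite (i j : 'I_6) : i != j -> ~~ octahedron i j ->
  exists p q, [/\ octahedron i p, octahedron p j, octahedron j q, octahedron q i &
    (p != q) && ~~ octahedron p q].
Proof.
(* the two vertices of the next antipodal pair *)
move=> ij nij; exists (inord (((i./2).+1 %% 3).*2)), (inord (((i./2).+1 %% 3).*2.+1)).
move: ij nij; rewrite /octahedron -!val_eqE /= !inordK; try by case: i => [[|[|[|[|[|[|//]]]]]] hi].
by case: i => [[|[|[|[|[|[|//]]]]]] hi]; case: j => [[|[|[|[|[|[|//]]]]]] hj].
Qed.

Hypothesis G_ic : interval_condition G.
Hypothesis G_lpc : local_positioning_condition G.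

(** Hence all three kinds of intervals are treated at once, as parts of the
octahedron. *)
Lemma interval_code u z x0 : apart u z -> adj u x0 -> adj x0 z ->
  exists code : G -> 'I_6, forall x y, ginterval u z x -> ginterval u z y ->
    (x == y) = (code x == code y) /\ adj x y = octahedron (code x) (code y).
Proof.
move=> nuz ux xz; have I2 := gdist2 nuz ux xz.
have mk (T : finType) (H : rel T) (e : T -> 'I_6) : injective e ->
    (forall i j, H i j = octahedron (e i) (e j)) -> induces (ginterval u z) H ->
    exists code : G -> 'I_6, forall x y, ginterval u z x -> ginterval u z y ->
    (x == y) = (code x == code y) /\ adj x y = octahedron (code x) (code y).
  move=> ei eH [f [fi fr fH]].
  have /choice[g gP] x : exists i : option T, ginterval u z x -> exists2 j, i = Some j & f j = x.
    have [|nI] := pselect (ginterval u z x); last by exists None.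
    by rewrite -fr => -[j _ E]; exists (Some j) => _; exists j.
  exists (fun x => if g x is Some i then e i else ord0) => x y /gP[i -> <-] /gP[j -> <-].
  by rewrite fH eH (inj_eq fi) (inj_eq ei).
case: (G_ic I2) => [|/mk|/mk]; [move/mk| |].
- exact: (fun h => h _ cycle_code_inj cycle_codeP).
- exact: (fun h => h _ wheel_code_inj wheel_codeP).
- exact: (fun h => h _ (@inj_id _) (fun _ _ => erefl)).
Qed.

Lemma mem_interval u z x : apart u z -> adj u x -> adj x z ->
  [/\ ginterval u z u, ginterval u z z & ginterval u z x].
Proof.
move=> nuz ux xz; split; rewrite /ginterval /= ?gdist_xx ?addn0 //.
by rewrite (gdist1 ux) (gdist1 xz) (gdist2 nuz ux xz).
Qed.

Lemma interval_clique u z x y t : apart u z -> adj u x -> adj u y -> adj u t ->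
  adj z x -> adj z y -> adj z t -> adj x y -> adj x t -> adj y t -> False.
Proof.
rewrite ![adj z _]adj_sym => nuz ux uy ut xz yz tz.
have [code cP] := interval_code nuz ux xz.
have [Iu Iz Ix] := mem_interval nuz ux xz; have [_ _ Iy] := mem_interval nuz uy yz.
have [_ _ It] := mem_interval nuz ut tz.
move: nuz ux uy ut; rewrite /nadj.
rewrite (cP u z Iu Iz).1 (cP u z Iu Iz).2 (cP u x Iu Ix).2 (cP u y Iu Iy).2 (cP u t Iu It).2.
rewrite (cP x y Ix Iy).2 (cP x t Ix It).2 (cP y t Iy It).2 => /andP[? ?] *.
by apply: (@octahedron_clique (code u) (code z) (code x) (code y) (code t)).
Qed.

Lemma interval_mates u z x y t : apart u z -> adj u x -> adj u y -> adj u t ->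
  adj z x -> adj z y -> adj z t -> apart x y -> apart x t -> y = t.
Proof.
rewrite ![adj z _]adj_sym => nuz ux uy ut xz yz tz.
have [code cP] := interval_code nuz ux xz.
have [Iu Iz Ix] := mem_interval nuz ux xz; have [_ _ Iy] := mem_interval nuz uy yz.
have [_ _ It] := mem_interval nuz ut tz.
rewrite /nadj (cP x y Ix Iy).1 (cP x y Ix Iy).2 (cP x t Ix It).1 (cP x t Ix It).2.
move=> /andP[h1 h2] /andP[h3 h4]; apply/eqP; rewrite (cP y t Iy It).1; apply/eqP.
exact: octahedron_mates h1 h2 h3 h4.
Qed.

Lemma interval_square u z x : apart u z -> adj u x -> adj x z -> exists p q, quad u p z q.
Proof.
move=> nuz ux xz; have I2 := gdist2 nuz ux xz.
have [Iu Iz _] := mem_interval nuz ux xz.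
have mk (T : finType) (H : rel T) :
    (forall i j, i != j -> ~~ H i j -> exists p q, [/\ H i p, H p j, H j q, H q i &
       (p != q) && ~~ H p q]) -> induces (ginterval u z) H -> exists p q, quad u p z q.
  move=> Hop [f [fi fr fH]].
  move: Iu Iz; rewrite -fr => -[i _ Ei] [j _ Ej].
  move: nuz; rewrite /nadj -Ei -Ej fH (inj_eq fi) => /andP[ij nij].
  have [p [q [h1 h2 h3 h4 /andP[h5 h6]]]] := Hop i j ij nij.
  by exists (f p), (f q); rewrite /sq /nadj !fH !(inj_eq fi) h1 h2 h3 h4 ij nij h5 h6.
case: (G_ic I2); apply: mk => i j.
- exact: cycle4_opposite.
- case: i j => [i|] [j|] //= ij nij.
  have [p [q h]] := @cycle4_opposite i j ij nij; exists (Some p), (Some q); exact: h.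
- exact: octahedron_opposite.
Qed.

Lemma positioning_near v a b c d e : quad a b c d -> apart v a -> apart v b -> apart v c ->
  adj v d -> adj v e -> adj e b -> False.
Proof.
move=> s va vb vc vd ve eb; case/and5P: (s) => ab bc cd da _.
move/squareP: s => s; rewrite adj_sym in cd.
have := G_lpc s (gdist2 va vd da) (gdist2 vc vd cd).
by rewrite (gdist2 vb ve eb) (gdist1 vd).
Qed.

Lemma positioning_far a b c d v e f : quad a b c d -> apart v a -> apart v c ->
  adj v e -> adj e a -> adj v f -> adj f c ->
  [\/ adj v b, adj v d | exists g h, [/\ adj v g, adj g b, adj v h & adj h d]].
Proof.
move=> s va vc ve ea vf fc; case/and5P: (s) => ab bc cd da _.
move/squareP: s => s; have H := G_lpc s (gdist2 va ve ea) (gdist2 vc vf fc).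
have [vb|vb] := boolP (adj v b); first by constructor 1.
have [vd|vd] := boolP (adj v d); first by constructor 2.
have nvb : apart v b.
  by rewrite /nadj vb andbT; apply/eqP => E; case/andP: va => _; rewrite E adj_sym ab.
have nvd : apart v d.
  by rewrite /nadj vd andbT; apply/eqP => E; case/andP: va => _; rewrite E da.
have Lb := gdist_ge2 nvb; have Ld := gdist_ge2 nvd.
have two m n : 1 < m -> 1 < n -> m + n = 4 -> m = 2 by clear; lia.
have [g vg gb] := gdist2P (two _ _ Lb Ld H).
have [h vh hd] := gdist2P (two _ _ Ld Lb (etrans (addnC _ _) H)).
by constructor 3; exists g, h.
Qed.

End Distance.

Import Order.TTheory GRing.Theory Num.Theory.
Import numFieldNormedType.Exports.
Local Open Scope ring_scope.

(** * Paths and their homotopies *)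
Section ContinuousReal.
Variables (R : realType) (S : topologicalType).
Implicit Types f g : S -> R.

Lemma contD f g : continuous f -> continuous g -> continuous (fun x => f x + g x).
Proof. by move=> cf cg x; apply: cvgD; [apply: cf|apply: cg]. Qed.

Lemma contB f g : continuous f -> continuous g -> continuous (fun x => f x - g x).
Proof. by move=> cf cg x; apply: cvgB; [apply: cf|apply: cg]. Qed.

Lemma contM f g : continuous f -> continuous g -> continuous (fun x => f x * g x).
Proof. by move=> cf cg x; apply: cvgM; [apply: cf|apply: cg]. Qed.

Lemma cont_cst (T : topologicalType) (a : T) : continuous (fun _ : S => a).
Proof. by move=> x; apply: cvg_cst. Qed.

Lemma cont_max f g : continuous f -> continuous g -> continuous (fun x => Num.max (f x) (g x)).
Proof. by move=> cf cg x; apply: continuous_max; [apply: cf|apply: cg]. Qed.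

Lemma cont_min f g : continuous f -> continuous g -> continuous (fun x => Num.min (f x) (g x)).
Proof. by move=> cf cg x; apply: continuous_min; [apply: cf|apply: cg]. Qed.

Lemma cont_id : continuous (fun x : S => x).
Proof. by move=> x; apply: cvg_id. Qed.

Lemma cont_comp (T U : topologicalType) (h : S -> T) (k : T -> U) :
  continuous h -> continuous k -> continuous (fun x => k (h x)).
Proof. by move=> ch ck x; apply: continuous_comp; [apply: ch|apply: ck]. Qed.

Lemma cont_pair (T U : topologicalType) (h : S -> T) (k : S -> U) :
  continuous h -> continuous k -> continuous (fun x => (h x, k x)).
Proof. by move=> ch ck x; apply: cvg_pair; [apply: ch|apply: ck]. Qed.

Lemma paste (T : topologicalType) (phi : S -> R) (c : R) (h k : S -> T) :
  continuous phi -> continuous h -> continuous k ->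
  (forall x, phi x = c -> h x = k x) ->
  continuous (fun x => if phi x <= c then h x else k x).
Proof.
move=> cphi ch ck hk.
pose A := [set x | phi x <= c]; pose B := [set x | c <= phi x].
have cA : closed A.
  by apply: (@closed_comp _ _ phi [set y | y <= c]); [move=> x _; apply: cphi|apply: closed_le].
have cB : closed B.
  by apply: (@closed_comp _ _ phi [set y | c <= y]); [move=> x _; apply: cphi|apply: closed_ge].
pose F x := if phi x <= c then h x else k x; rewrite -[X in continuous X]/F.
have wA : {within A, continuous F}.
  apply: (@subspace_eq_continuous _ _ _ h).
    by move=> x; rewrite inE /A /F /from_subspace /= => ->.
  exact: continuous_subspaceT.
have wB : {within B, continuous F}.
  apply: (@subspace_eq_continuous _ _ _ k).
    move=> x; rewrite inE /B /F /from_subspace /= => le; case: ifP => // le'; apply/esym/hk.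
    by apply/eqP; rewrite eq_le le le'.
  exact: continuous_subspaceT.
have : {within A `|` B, continuous F} by exact: withinU_continuous.
suff -> : A `|` B = setT by move=> wF; apply/continuous_subspace_setT.
apply/seteqP; split=> // x _; rewrite /A /B /=.
by have [le|/ltW le] := leP (phi x) c; [left|right].
Qed.
End ContinuousReal.

Section Paths.
Variables (R : realType) (T : topologicalType).
Implicit Types (f g h : R -> T) (x y z : T).

Definition clamp (t : R) : R := Num.max 0 (Num.min 1 t).

Lemma clampP t : 0 <= clamp t <= 1.
Proof. by rewrite /clamp le_max lexx /= ge_max ler01 ge_min lexx. Qed.

Lemma clamp_id t : 0 <= t <= 1 -> clamp t = t.
Proof. by case/andP=> t0 t1; rewrite /clamp; rewrite (min_idPr t1) (max_idPr t0). Qed.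

Lemma cont_clamp (S : topologicalType) (a : S -> R) :
  continuous a -> continuous (fun s : S => clamp (a s)).
Proof. by move=> cf; apply: cont_max; [|apply: cont_min]; auto; apply: cont_cst. Qed.

(** Paths are maps defined on the whole line, of which only the values on [0, 1]
matter. This avoids subspace topologies in the constructions below; the fixed ends
of a homotopy are required for all values of its first parameter. *)
Definition is_path f x y := [/\ continuous f, f 0 = x & f 1 = y].

Definition homot f g := exists H : R * R -> T,
  [/\ continuous H,
      (forall t, 0 <= t <= 1 -> H (0, t) = f t /\ H (1, t) = g t) &
      (forall s, H (s, 0) = f 0 /\ H (s, 1) = f 1)].

Definition pcat f g := fun t => if t <= 1/2 then f (2 * t) else g (2 * t - 1).
Definition pinv f := fun t : R => f (1 - t).

Lemma in01_0 : (0 : R) <= (0 : R) <= 1. Proof. by rewrite lexx ler01. Qed.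
Lemma in01_1 : (0 : R) <= (1 : R) <= 1. Proof. by rewrite lexx ler01. Qed.

Lemma le_half0 : ((0 : R) <= 1/2) = true. Proof. by apply/idP; lra. Qed.
Lemma le_half1 : ((1 : R) <= 1/2) = false. Proof. by apply/negbTE; rewrite -ltNge; lra. Qed.

Lemma cont_fst : continuous (fst : R * R -> R). Proof. by move=> x; apply: cvg_fst. Qed.
Lemma cont_snd : continuous (snd : R * R -> R). Proof. by move=> x; apply: cvg_snd. Qed.

(** Two paths in the plane with the same ends are homotopic by linear interpolation,
and so are their images. *)
Lemma homot_map (F : R * R -> T) (a1 a2 b1 b2 : R -> R) :
  continuous F -> continuous a1 -> continuous a2 -> continuous b1 -> continuous b2 ->
  a1 0 = b1 0 -> a2 0 = b2 0 -> a1 1 = b1 1 -> a2 1 = b2 1 ->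
  homot (fun t => F (a1 t, a2 t)) (fun t => F (b1 t, b2 t)).
Proof.
move=> cF ca1 ca2 cb1 cb2 E10 E20 E11 E21.
pose mix (a b : R -> R) (st : R * R) : R := (1 - st.1) * a st.2 + st.1 * b st.2.
have cmix a b : continuous a -> continuous b -> continuous (mix a b).
  move=> ca cb; apply: contD; apply: contM; try exact: cont_fst.
  - by apply: contB; [apply: cont_cst|apply: cont_fst].
  - exact: cont_comp cont_snd ca.
  - exact: cont_comp cont_snd cb.
exists (fun st => F (mix a1 b1 st, mix a2 b2 st)); split.
- by apply: (cont_comp _ cF); apply: cont_pair; apply: cmix.
- by move=> t _; rewrite /mix /= !subr0 !mul1r !mul0r !addr0 !subrr !mul0r !add0r.
- move=> s; rewrite /mix /= -E10 -E20 -E11 -E21.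
  by split; congr F; congr pair; ring.
Qed.

Lemma homot_line f (a b : R -> R) : continuous f -> continuous a -> continuous b ->
  a 0 = b 0 -> a 1 = b 1 -> homot (fun t => f (a t)) (fun t => f (b t)).
Proof.
move=> cf ca cb E0 E1.
have := @homot_map (fun st => f st.1) a (fun=> 0) b (fun=> 0); apply=> //.
- exact: cont_comp cont_fst cf.
- exact: cont_cst.
- exact: cont_cst.
Qed.

Lemma homot_ext f f' g g' : (forall t, 0 <= t <= 1 -> f t = f' t) ->
  (forall t, 0 <= t <= 1 -> g t = g' t) -> homot f g -> homot f' g'.
Proof.
move=> ff gg [H [cH H1 H2]]; exists H; split=> // [t h|s].
  by rewrite -ff // -gg //; apply: H1.
by rewrite -(ff _ in01_0) -(ff _ in01_1); apply: H2.
Qed.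

Lemma homot_refl f : continuous f -> homot f f.
Proof. by move=> cf; apply: (homot_line cf) => //; apply: cont_id. Qed.

Lemma homot_ends f g : homot f g -> f 0 = g 0 /\ f 1 = g 1.
Proof.
by case=> H [_ H1 H2]; rewrite -(H2 1).1 -(H2 1).2 (H1 _ in01_0).2 (H1 _ in01_1).2.
Qed.

Lemma homot_sym f g : homot f g -> homot g f.
Proof.
move=> fg; have [E0 E1] := homot_ends fg; case: fg => H [cH H1 H2].
exists (fun st => H (1 - st.1, st.2)); split.
- apply: (cont_comp _ cH); apply: cont_pair; last exact: cont_snd.
  by apply: contB; [apply: cont_cst|apply: cont_fst].
- by move=> t h; rewrite /= subr0 subrr; have [-> ->] := H1 t h.
- by move=> s /=; rewrite -E0 -E1; apply: H2.
Qed.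

Lemma homot_trans f g h : homot f g -> homot g h -> homot f h.
Proof.
move=> fg; have [E0 E1] := homot_ends fg; case: fg => H [cH H1 H2] [K [cK K1 K2]].
have C2 (c : R) : continuous (fun st : R * R => c * st.1).
  by apply: contM; [apply: cont_cst|apply: cont_fst].
(* outside [0, 1] the homotopies need not agree along their common side *)
exists (fun st => if st.1 <= 1/2 then H (2 * st.1, clamp st.2)
                  else K (2 * st.1 - 1, clamp st.2)); split.
- apply: paste; first exact: cont_fst.
  + by apply: (cont_comp _ cH); apply: cont_pair; [|apply: cont_clamp; apply: cont_snd].
  + apply: (cont_comp _ cK); apply: cont_pair; last by apply: cont_clamp; apply: cont_snd.
    by apply: contB; [|apply: cont_cst].
  + move=> [s t] /= ->; have -> : 2 * (1/2) = 1 :> R by lra.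
    by rewrite subrr (H1 _ (clampP t)).2 (K1 _ (clampP t)).1.
- move=> t ht; rewrite /= le_half0 le_half1 clamp_id // mulr0 (H1 t ht).1.
  have -> : 2 * 1 - 1 = 1 :> R by lra.
  by rewrite (K1 t ht).2.
- move=> s /=; rewrite (clamp_id in01_0) (clamp_id in01_1).
  by case: ifP => _; [have [-> ->] := H2 (2 * s)|rewrite E0 E1; have [-> ->] := K2 (2 * s - 1)].
Qed.

Lemma pcat_path f g x y z : is_path f x y -> is_path g y z -> is_path (pcat f g) x z.
Proof.
move=> [cf f0 f1] [cg g0 g1].
have C2 : continuous (fun t : R => 2 * t) by apply: contM; [apply: cont_cst|apply: cont_id].
split.
- apply: paste; first exact: cont_id.
  + exact: cont_comp C2 cf.
  + by apply: (cont_comp _ cg); apply: contB => //; apply: cont_cst.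
  + move=> t ->; have -> : 2 * (1/2) = 1 :> R by lra.
    by rewrite subrr f1 g0.
- by rewrite /pcat le_half0 mulr0.
- rewrite /pcat le_half1; have -> : 2 * 1 - 1 = 1 :> R by lra.
  by [].
Qed.

Lemma pinv_path f x y : is_path f x y -> is_path (pinv f) y x.
Proof.
move=> [cf f0 f1]; split; rewrite /pinv ?subr0 ?subrr //.
by apply: (cont_comp _ cf); apply: contB; [apply: cont_cst|apply: cont_id].
Qed.

Lemma cst_path x : is_path (fun _ => x) x x.
Proof. by split=> //; apply: cont_cst. Qed.

Lemma homot_pcat f f' g g' x y z : is_path f x y -> is_path g y z ->
  homot f f' -> homot g g' -> homot (pcat f g) (pcat f' g').
Proof.
move=> [cf f0 f1] [cg g0 g1] [H [cH H1 H2]] [K [cK K1 K2]].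
have C2 : continuous (fun st : R * R => 2 * st.2).
  by apply: contM; [apply: cont_cst|apply: cont_snd].
exists (fun st => if st.2 <= 1/2 then H (st.1, 2 * st.2) else K (st.1, 2 * st.2 - 1)); split.
- apply: paste; first exact: cont_snd.
  + by apply: (cont_comp _ cH); apply: cont_pair; [apply: cont_fst|].
  + apply: (cont_comp _ cK); apply: cont_pair; first exact: cont_fst.
    by apply: contB => //; apply: cont_cst.
  + move=> [s t] /= ->; have -> : 2 * (1/2) = 1 :> R by lra.
    by rewrite subrr (H2 s).2 (K2 s).1 f1 g0.
- move=> t /andP[t0 t1]; rewrite /pcat /=; case: (leP t (1/2)) => ht.
    by apply: H1; lra.
  by apply: K1; lra.
- move=> s; rewrite /pcat /= mulr0.
  rewrite le_half0 le_half1; have -> : 2 * 1 - 1 = 1 :> R by lra.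
  by rewrite (H2 s).1 (K2 s).2.
Qed.

Lemma homot_reparam f (rho : R -> R) : continuous f -> continuous rho -> rho 0 = 0 -> rho 1 = 1 ->
  homot f (fun t => f (rho t)).
Proof. by move=> cf cr r0 r1; apply: (homot_line cf) => //; apply: cont_id. Qed.

Ltac cont_poly := repeat first [exact: cont_cst | exact: cont_id | apply: contB
  | apply: contD | apply: contM].
Ltac split_le := repeat match goal with
  | |- context [?a <= ?b] => case: (leP a b) => ? end; lra.

(** This, the unit and the inverse laws come from piecewise affine parametrizations, to
which [homot_line] applies. *)
Lemma pcatA f g h x y z w : is_path f x y -> is_path g y z -> is_path h z w ->
  homot (pcat (pcat f g) h) (pcat f (pcat g h)).
Proof.
move=> pf pg ph; have [c _ _] := pcat_path (pcat_path pf pg) ph.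
(* the time at which (f g) h is where f (g h) is at time t *)
pose rho (t : R) : R := if t <= 1/2 then t / 2 else if t <= 3/4 then t - 1/4 else 2 * t - 1.
have : homot (pcat (pcat f g) h) (fun t => pcat (pcat f g) h (rho t)).
  apply: (homot_reparam c); last 2 first; try by rewrite /rho; split_le.
  apply: paste; try by cont_poly.
    by apply: paste; try cont_poly; move=> t ->; lra.
  by move=> t ->; split_le.
apply: homot_ext => // t _; rewrite /rho /pcat.
case: (leP t (1/2)) => h1; [|case: (leP t (3/4)) => h2].
- by rewrite ifT; [rewrite ifT; [congr f|]|]; lra.
- rewrite ifT; last by lra.
  rewrite ifF; last by apply/negbTE; rewrite -ltNge; lra.
  by rewrite ifT; [congr g|]; lra.
- by rewrite !ifF //; apply/negbTE; rewrite -ltNge; lra.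
Qed.

Lemma pcat1p f x y : is_path f x y -> homot (pcat (fun=> x) f) f.
Proof.
move=> [cf f0 f1]; apply: homot_sym.
pose rho (t : R) : R := if t <= 1/2 then 0 else 2 * t - 1.
have : homot f (fun t => f (rho t)).
  apply: (homot_reparam cf); rewrite /rho; first by apply: paste; try cont_poly; move=> t ->; lra.
  - by split_le.
  - by split_le.
by apply: homot_ext => // t _; rewrite /rho /pcat; case: ifP.
Qed.

Lemma pcatp1 f x y : is_path f x y -> homot (pcat f (fun=> y)) f.
Proof.
move=> [cf f0 f1]; apply: homot_sym.
pose rho (t : R) : R := if t <= 1/2 then 2 * t else 1.
have : homot f (fun t => f (rho t)).
  apply: (homot_reparam cf); rewrite /rho; first by apply: paste; try cont_poly; move=> t ->; lra.
  - by split_le.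
  - by split_le.
by apply: homot_ext => // t _; rewrite /rho /pcat; case: ifP.
Qed.

Lemma pcatpV f x y : is_path f x y -> homot (pcat f (pinv f)) (fun=> x).
Proof.
move=> [cf f0 f1]; pose rho (t : R) : R := if t <= 1/2 then 2 * t else 2 - 2 * t.
have crho : continuous rho by apply: paste; try cont_poly; move=> t ->; lra.
have : homot (fun t => f (rho t)) (fun t => f ((fun=> 0) t)).
  by apply: homot_line; try cont_poly => //; rewrite /rho; split_le.
apply: homot_ext => // t _; rewrite /rho /pcat /pinv; case: ifP => // _.
by congr f; lra.
Qed.

Lemma pinvK f : pinv (pinv f) = f.
Proof. by apply/funext => t; rewrite /pinv; congr f; lra. Qed.

Lemma pcatVp f x y : is_path f x y -> homot (pcat (pinv f) f) (fun=> y).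
Proof. by move=> /pinv_path/pcatpV; rewrite pinvK. Qed.

(** The bounds a, b and c need not be ordered, and the paths are affinely
reparametrized restrictions of f. *)
Lemma pcat_subpath f (a b c : R) : continuous f ->
  homot (pcat (fun t => f (a + t * (b - a))) (fun t => f (b + t * (c - b))))
        (fun t => f (a + t * (c - a))).
Proof.
move=> cf.
pose rho (t : R) : R := if t <= 1/2 then a + 2 * t * (b - a) else b + (2 * t - 1) * (c - b).
have crho : continuous rho by apply: paste; try cont_poly; move=> t ->; field.
have : homot (fun t => f (rho t)) (fun t => f (a + t * (c - a))).
  apply: (homot_line cf crho (b := fun t => a + t * (c - a))).
  - by cont_poly.
  - by rewrite /rho le_half0; ring.
  - by rewrite /rho le_half1; ring.
by apply: homot_ext => // t _; rewrite /rho /pcat; case: ifP.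
Qed.
End Paths.
Arguments in01_0 {R}.
Arguments in01_1 {R}.
Arguments cst_path {R T} x.

(** * Cells and the contraction of open stars *)
Lemma cont_ptws (S : topologicalType) (I : Type) (R : realType) (h : S -> {ptws I -> R}) :
  (forall i, continuous (fun s => h s i)) -> continuous h.
Proof.
move=> H s; apply/cvg_sup => i.
apply: (@continuous_comp_initial _ _ _ (fun f : I -> R => f i) h) => x.
exact: H.
Qed.

Lemma eval_ptws (I : choiceType) (R : realType) (i : I) : continuous (fun f : {ptws I -> R} => f i).
Proof. exact: (@proj_continuous I (fun=> R) i). Qed.

Section Complex.
Variables (R : realType) (G : graph) (x0 : tsq_complex R G).
Notation X := (tsq_complex R G).
Implicit Types (w : G -> R) (u v : G).

Lemma coords_inj (x y : X) : coords x = coords y -> x = y.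
Proof.
case: x y => [w hw] [w' hw'] /= E; case: _ / E hw' => hw'.
by congr TsqComplex; apply: Prop_irrelevance.
Qed.

(** The point with coordinates w, with the dummy value x0 when there is none. *)
Definition pt w : X :=
  if pselect (exists2 C, closed_cell C & C w) is left h then TsqComplex h else x0.

Lemma ptE C w : closed_cell C -> C w -> coords (pt w) = w.
Proof.
by move=> cC Cw; rewrite /pt; case: pselect => // -[]; exists C.
Qed.

Lemma pt_coords (x : X) : pt (coords x) = x.
Proof. by have [C cC Cx] := coords_cell x; apply: coords_inj; apply: ptE Cx. Qed.

(** The weak topology induces on each closed cell the topology of pointwise
convergence. *)
Lemma cont_pt (S : topologicalType) (h : S -> G -> R) C : closed_cell C ->
  (forall s, C (h s)) -> (forall i, continuous (fun s => h s i)) ->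
  continuous (fun s => pt (h s)).
Proof.
move=> cC Ch ch; apply/continuousP => U oU.
have tU : tsq_open U by exact: oU.
have [A oA UA] := tU _ cC.
have ch' : continuous (h : S -> {ptws G -> R}) by apply: cont_ptws.
suff -> : (fun s => pt (h s)) @^-1` U = (h : S -> {ptws G -> R}) @^-1` A.
  by apply: open_comp => // ? _; apply: ch'.
apply/seteqP; split => s /=; have := UA (pt (h s)); rewrite (ptE cC (Ch s)).
  by move/(_ (Ch s)) => [].
by move/(_ (Ch s)) => [].
Qed.

Lemma cont_coord v : continuous (fun x : X => coords x v).
Proof.
apply/continuousP => O oO.
suff: tsq_open ((fun x : X => coords x v) @^-1` O) by [].
move=> C cC; exists ((fun f : {ptws G -> R} => f v) @^-1` O) => //.
by apply: open_comp => // ? _; apply: eval_ptws.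
Qed.

Definition vx v : X := pt (vertex_pt R v).

Lemma vxE v : coords (vx v) = vertex_pt R v.
Proof. by apply: ptE (VertexCell R v) _. Qed.

Definition convex_set (C : set (G -> R)) := forall w w' (s : R), C w -> C w' -> 0 <= s <= 1 ->
  C (fun y => (1 - s) * w y + s * w' y).

(** Vertices, edges and triangles: convex cells, each the hull of a clique. Only
the cells of squares are not of this kind. *)
Definition flat_cell (C : set (G -> R)) := convex_set C /\ exists vs : seq G,
  [/\ forall w y, C w -> 0 < w y -> y \in vs,
      forall y, y \in vs -> C (vertex_pt R y) &
      forall y z, y \in vs -> z \in vs -> y = z \/ adj y z].

Lemma vertex_pt_ge0 u y : 0 <= vertex_pt R u y.
Proof. by rewrite /vertex_pt ler0n. Qed.

Lemma vertex_pt_self u : vertex_pt R u u = 1. Proof. by rewrite /vertex_pt eqxx. Qed.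

Lemma vertex_pt_other u y : y != u -> vertex_pt R u y = 0.
Proof. by rewrite /vertex_pt => /negbTE ->. Qed.

Lemma triangle_flat (a b c : G) : triangle a b c -> flat_cell (triangle_cell a b c).
Proof.
move=> [ab bc ca]; split.
  move=> w w' s [p [q [r [p0 q0 r0 E ->]]]] [p' [q' [r' [p0' q0' r0' E' ->]]]] /andP[s0 s1].
  exists ((1 - s) * p + s * p'), ((1 - s) * q + s * q'), ((1 - s) * r + s * r').
  have s1' : 0 <= 1 - s by lra.
  split; try by rewrite addr_ge0 // mulr_ge0.
    have -> : (1 - s) * p + s * p' + ((1 - s) * q + s * q') + ((1 - s) * r + s * r') =
      (1 - s) * (p + q + r) + s * (p' + q' + r') by ring.
    by rewrite E E'; ring.
  by apply/funext => y; ring.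
exists [:: a; b; c]; split.
- move=> w y [p [q [r [_ _ _ _ ->]]]]; rewrite !inE; apply: contraTT.
  rewrite !negb_or => /and3P[ya yb yc].
  by rewrite !vertex_pt_other // !mulr0 !addr0 ltxx.
- move=> y; rewrite !inE => /or3P[] /eqP ->.
  + by exists 1, 0, 0; split; [lra|lra|lra|lra|apply/funext => z; ring].
  + by exists 0, 1, 0; split; [lra|lra|lra|lra|apply/funext => z; ring].
  + by exists 0, 0, 1; split; [lra|lra|lra|lra|apply/funext => z; ring].
- move=> y z; rewrite !inE => /or3P[] /eqP -> /or3P[] /eqP ->;
    by [left|right; rewrite // adj_sym].
Qed.

Lemma edge_flat (a b : G) : adj a b -> flat_cell (edge_cell a b).
Proof.
move=> ab; split.
  move=> w w' s [p [q [p0 q0 E ->]]] [p' [q' [p0' q0' E' ->]]] /andP[s0 s1].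
  exists ((1 - s) * p + s * p'), ((1 - s) * q + s * q').
  have s1' : 0 <= 1 - s by lra.
  split; try by rewrite addr_ge0 // mulr_ge0.
    have -> : (1 - s) * p + s * p' + ((1 - s) * q + s * q') =
      (1 - s) * (p + q) + s * (p' + q') by ring.
    by rewrite E E'; ring.
  by apply/funext => y; ring.
exists [:: a; b]; split.
- move=> w y [p [q [_ _ _ ->]]]; rewrite !inE; apply: contraTT.
  rewrite !negb_or => /andP[ya yb].
  by rewrite !vertex_pt_other // !mulr0 !addr0 ltxx.
- move=> y; rewrite !inE => /orP[] /eqP ->.
  + by exists 1, 0; split; [lra|lra|lra|apply/funext => z; ring].
  + by exists 0, 1; split; [lra|lra|lra|apply/funext => z; ring].
- move=> y z; rewrite !inE => /orP[] /eqP -> /orP[] /eqP ->;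
    by [left|right; rewrite // adj_sym].
Qed.

Lemma vertex_flat (a : G) : flat_cell (@vertex_cell R G a).
Proof.
split; first by move=> w w' s -> -> _; apply/funext => y; ring.
exists [:: a]; split.
- move=> w y ->; rewrite inE; apply: contraTT => ya.
  by rewrite vertex_pt_other // ltxx.
- by move=> y; rewrite inE => /eqP ->.
- by move=> y z; rewrite !inE => /eqP -> /eqP ->; left.
Qed.

Lemma cell_cases C : closed_cell C ->
  flat_cell C \/ exists a b c d, square a b c d /\ C = square_cell a b c d.
Proof.
case=> [v|a b ab|a b c t|a b c d s]; [left|left|left|right].
- exact: vertex_flat.
- exact: edge_flat.
- exact: triangle_flat.
- by exists a, b, c, d.
Qed.

Definition bil a b c d (s t : R) : G -> R := fun x =>
  (1 - s) * (1 - t) * vertex_pt R a x + s * (1 - t) * vertex_pt R b x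
  + s * t * vertex_pt R c x + (1 - s) * t * vertex_pt R d x.

Lemma bil_cell a b c d s t : 0 <= s <= 1 -> 0 <= t <= 1 -> square_cell a b c d (bil a b c d s t).
Proof. by move=> s01 t01; exists s, t. Qed.

Lemma bil_rot a b c d s t : bil a b c d s t = bil b c d a t (1 - s).
Proof. by apply/funext => x; rewrite /bil; ring. Qed.

Lemma bil_flip a b c d s t : bil a b c d s t = bil a d c b t s.
Proof. by apply/funext => x; rewrite /bil; ring. Qed.

Lemma square_rot (a b c d : G) : square a b c d -> square b c d a.
Proof.
case=> [[ab bc cd da] [ac bd nac nbd]]; split; split=> //; first by rewrite eq_sym.
by rewrite adj_sym.
Qed.

Lemma square_flip (a b c d : G) : square a b c d -> square a d c b.
Proof.
by case=> [[ab bc cd da] [ac bd nac nbd]]; split; split=> //; rewrite 1?eq_sym // adj_sym.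
Qed.

Lemma square_cell_rot (a b c d : G) : square_cell a b c d = square_cell b c d a :> set (G -> R).
Proof.
apply/seteqP; split => w [s [t [s01 t01 ->]]].
  exists t, (1 - s); split=> //; first by move: s01 => /andP[? ?]; lra.
  exact: bil_rot.
exists (1 - t), s; split=> //; first by move: t01 => /andP[? ?]; lra.
by apply/funext => x; ring.
Qed.

(** The listing of a square can start at any corner v; v is a corner as soon as the
v-coordinate is positive somewhere on the cell. *)
Lemma square_cell_from a b c d v w : square a b c d -> square_cell a b c d w -> 0 < w v ->
  exists b' c' d', square v b' c' d' /\ square_cell a b c d = square_cell v b' c' d' :> set (G -> R).
Proof.
move=> s [p [q [_ _ ->]]] wv.
have : v \in [:: a; b; c; d].
  apply: contraTT wv; rewrite !inE !negb_or => /and4P[va vb vc vd].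
  by rewrite !vertex_pt_other // !mulr0 !addr0 ltxx.
rewrite !inE => /or4P[] /eqP ->.
- by exists b, c, d.
- by exists c, d, a; split; [apply: square_rot|apply: square_cell_rot].
- exists d, a, b; split; first by do 2!apply: square_rot.
  by rewrite square_cell_rot; apply: square_cell_rot.
- exists a, b, c; split; first by do 3!apply: square_rot.
  by rewrite square_cell_rot square_cell_rot; apply: square_cell_rot.
Qed.

Lemma square_neq (a b c d : G) : square a b c d ->
  [/\ a != b, b != c, c != d & d != a].
Proof.
case=> [[ab bc cd da] _]; have ne x y : adj x y -> x != y.
  by move=> xy; apply/eqP => E; rewrite E adj_irrefl in xy.
by split; apply: ne.
Qed.

Lemma bilE a b c d s t : square a b c d ->
  [/\ bil a b c d s t a = (1 - s) * (1 - t), bil a b c d s t b = s * (1 - t),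
      bil a b c d s t c = s * t & bil a b c d s t d = (1 - s) * t].
Proof.
move=> sq; have [ab bc cd da] := square_neq sq; case: (sq) => _ [ac bd _ _].
by split; rewrite /bil vertex_pt_self !vertex_pt_other // 1?eq_sym //; ring.
Qed.

Lemma bil_supp a b c d s t y : 0 < bil a b c d s t y -> y \in [:: a; b; c; d].
Proof.
apply: contraTT; rewrite !inE !negb_or => /and4P[va vb vc vd].
by rewrite /bil !vertex_pt_other // !mulr0 !addr0 ltxx.
Qed.

(** The contraction of the star of v onto v moves points along straight segments in
flat cells. In the cell of a square v b c d it moves the point with chart
coordinates (s, t) to (l s, l t), which deviates from the straight segment by
l - l^2 times s t (b + d - v - c). As s t is the coordinate at c, this multiple is
a function of the point alone: in the star of v it is nonzero only at interior
points of the cell, where precisely v, b, c and d have positive coordinates, so that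
the square can be recovered. *)
Definition bend v w : G -> R :=
  if pselect (exists bcd : G * G * G, square v bcd.1.1 bcd.1.2 bcd.2 /\
      [/\ 0 < w bcd.1.1, 0 < w bcd.1.2 & 0 < w bcd.2]) is left h
  then let: (b, c, d) := sval (cid h) in
    fun y => w c * (vertex_pt R b y + vertex_pt R d y - vertex_pt R v y - vertex_pt R c y)
  else fun=> 0.

Lemma bend_flat C v w : flat_cell C -> C w -> 0 < w v -> bend v w = fun=> 0.
Proof.
move=> [_ [vs [supp _ clique]]] Cw wv; rewrite /bend.
case: pselect => [h|//]; exfalso; case: h => -[[b c] d] /= [[_ [vc _ nvc _]] [_ wc _]].
have [E|vc'] := clique v c (supp _ _ Cw wv) (supp _ _ Cw wc).
  by rewrite E eqxx in vc.
by rewrite vc' in nvc.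
Qed.

Lemma bend_square v b c d s t : square v b c d -> 0 <= s <= 1 -> 0 <= t <= 1 ->
  0 < bil v b c d s t v ->
  bend v (bil v b c d s t) =
    fun y => s * t * (vertex_pt R b y + vertex_pt R d y - vertex_pt R v y - vertex_pt R c y).
Proof.
move=> sq s01 t01 wv; have [Ev Eb Ec Ed] := bilE s t sq.
have [vb bc cd dv] := square_neq sq.
case: (sq) => [[avb abc acd adv] [vc bd nvc nbd]].
rewrite /bend; case: pselect => [h|nh]; last first.
  have -> : s * t = 0; last by apply/funext => y; rewrite mul0r.
  apply: contrapT => st0; apply: nh; exists (b, c, d) => /=; split=> //.
  move/eqP: st0; rewrite mulf_eq0 negb_or => /andP[sn tn].
  rewrite Ev in wv.
  have s1 : s != 1 by apply/eqP => E; rewrite E subrr mul0r ltxx in wv.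
  have t1 : t != 1 by apply/eqP => E; rewrite E subrr mulr0 ltxx in wv.
  rewrite Eb Ec Ed; case/andP: s01 => s0 s1'; case/andP: t01 => t0 t1'.
  by split; apply: mulr_gt0; rewrite ?subr_gt0 lt_neqAle ?s0 ?t0 ?s1' ?t1' andbT // eq_sym.
case: (cid h) => [[[b' c'] d'] /= [sq' [wb wc wd]]].
have [[avb' abc' acd' adv'] [vc' bd' nvc' nbd']] := sq'.
have Ec' : c' = c.
  move: (bil_supp wc); rewrite !inE => /or4P[] /eqP E //.
  - by rewrite E eqxx in vc'.
  - by rewrite E avb in nvc'.
  - by rewrite E adj_sym adv in nvc'.
have nb y : 0 < bil v b c d s t y -> adj v y -> y = b \/ y = d.
  move=> wy avy; move: (bil_supp wy); rewrite !inE => /or4P[] /eqP E.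
  - by rewrite E adj_irrefl in avy.
  - by left.
  - by rewrite E (negbTE nvc) in avy.
  - by right.
have adv'' : adj v d' by rewrite adj_sym.
rewrite Ec' Ec; apply/funext => y.
case: (nb _ wb avb') (nb _ wd adv'') => [Eb'|Eb'] [Ed'|Ed'].
- by rewrite Eb' Ed' eqxx in bd'.
- by rewrite Eb' Ed'.
- by rewrite Eb' Ed'; ring.
- by rewrite Eb' Ed' eqxx in bd'.
Qed.

(** The contraction of the open star of v to v on coordinates, the identity for l = 1
and constant for l = 0, preserves every closed cell. *)
Definition ctrw v (l : R) w : G -> R := fun y =>
  (1 - l) * vertex_pt R v y + l * w y + (l - l * l) * bend v w y.

Definition ctr v (l : R) (x : X) : X := pt (ctrw v (clamp l) (coords x)).

Definition star v : set X := [set x | 0 < coords x v].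

Lemma ctrw_flat C v w l : flat_cell C -> C w -> 0 < w v ->
  ctrw v l w = fun y => (1 - l) * vertex_pt R v y + l * w y.
Proof.
by move=> fC Cw wv; apply/funext => y; rewrite /ctrw (bend_flat fC) // mulr0 addr0.
Qed.

Lemma ctrw_square v b c d s t l : square v b c d -> 0 <= s <= 1 -> 0 <= t <= 1 ->
  0 < bil v b c d s t v -> ctrw v l (bil v b c d s t) = bil v b c d (l * s) (l * t).
Proof.
move=> sq s01 t01 wv; apply/funext => y.
by rewrite /ctrw (bend_square sq) // /bil; ring.
Qed.

Lemma ctrw_cell C v w l : closed_cell C -> C w -> 0 < w v -> 0 <= l <= 1 -> C (ctrw v l w).
Proof.
move=> cC Cw wv l01.
have [fC|[a [b [c [d [sq E]]]]]] := cell_cases cC.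
  rewrite (ctrw_flat _ fC Cw wv); case: (fC) => conv [vs [supp Cvs _]].
  by apply: conv => //; apply: Cvs; apply: supp Cw wv.
rewrite {}E in Cw *.
have [b' [c' [d' [sq' E']]]] := square_cell_from sq Cw wv.
rewrite {}E' in Cw *; case: Cw wv => [s [t [s01 t01 ->]]] wv.
rewrite ctrw_square //; apply: bil_cell;
  move: l01 s01 t01 => /andP[l0 l1] /andP[s0 s1] /andP[t0 t1];
  by rewrite mulr_ge0 //= mulr_ile1.
Qed.

Lemma ctrE v l x : star v x -> 0 <= l <= 1 -> coords (ctr v l x) = ctrw v l (coords x).
Proof.
move=> sx l01; rewrite /ctr clamp_id //; have [C cC Cx] := coords_cell x.
exact: (ptE cC (ctrw_cell cC Cx sx l01)).
Qed.

Lemma ctr0 v x : star v x -> ctr v 0 x = vx v.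
Proof.
move=> sx; apply: coords_inj; rewrite ctrE // ?lexx ?ler01 // vxE.
by apply/funext => y; rewrite /ctrw; ring.
Qed.

Lemma ctr1 v x : star v x -> ctr v 1 x = x.
Proof.
move=> sx; apply: coords_inj; rewrite ctrE // ?lexx ?ler01 //.
by apply/funext => y; rewrite /ctrw; ring.
Qed.

(** On a square cell the coordinate at the corner opposite to v replaces the choice
made in [bend], so that on each cell the contraction is the restriction of a map
continuous on the whole ambient space. *)
Lemma ctrw_ambient C v : closed_cell C -> exists Gam : R * (G -> R) -> G -> R,
  (forall l w, C w -> 0 < w v -> ctrw v l w = Gam (l, w)) /\
  (forall y, continuous (fun lw : R * {ptws G -> R} => Gam lw y)).
Proof.
move=> cC.
have cfst : continuous (fun lw : R * {ptws G -> R} => lw.1) by move=> z; apply: cvg_fst.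
have csnd : continuous (fun lw : R * {ptws G -> R} => lw.2) by move=> z; apply: cvg_snd.
have cev y : continuous (fun lw : R * {ptws G -> R} => lw.2 y).
  exact: (cont_comp csnd (@eval_ptws G R y)).
have c1 : continuous (fun lw : R * {ptws G -> R} => 1 - lw.1).
  by apply: contB => //; apply: cont_cst.
have [fC|[a [b [c [d [sq E]]]]]] := cell_cases cC.
  exists (fun lw y => (1 - lw.1) * vertex_pt R v y + lw.1 * lw.2 y); split.
    by move=> l w Cw wv; rewrite (ctrw_flat _ fC).
  by move=> y; apply: contD; apply: contM => //; apply: cont_cst.
have [[w0 [Cw0 wv0]]|none] := pselect (exists w, C w /\ 0 < w v); last first.
  exists (fun _ _ => 0); split; first by move=> l w Cw wv; case: none; exists w.
  by move=> y; apply: cont_cst.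
rewrite {}E in Cw0 *.
have [b' [c' [d' [sq' E']]]] := square_cell_from sq Cw0 wv0.
rewrite {}E'.
exists (fun lw y => (1 - lw.1) * vertex_pt R v y + lw.1 * lw.2 y + (lw.1 - lw.1 * lw.1) *
   (lw.2 c' * (vertex_pt R b' y + vertex_pt R d' y - vertex_pt R v y - vertex_pt R c' y))).
split.
  move=> l w [s [t [s01 t01 Ew]]] wv.
  have {}Ew : w = bil v b' c' d' s t by [].
  rewrite {}Ew in wv *.
  rewrite /ctrw (bend_square sq') //=.
  by have [_ _ -> _] := bilE s t sq'.
move=> y; apply: contD.
  by apply: contD; apply: contM => //; apply: cont_cst.
apply: contM; first by apply: contB => //; apply: contM.
by apply: contM => //; apply: cont_cst.
Qed.

(** The tube lemma for the compact segment [a, b]. *)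
Lemma tube (S : topologicalType) (a b : R) (A : set (R * S)) : open A ->
  open [set z | forall l, a <= l <= b -> A (l, z)].
Proof.
move=> oA; rewrite openE => z /= Az.
have /compact_near_coveringP cover := @segment_compact R a b.
have near_z : nbhs z (fun z' => `[a, b] `<=` (fun l => A (l, z'))).
  apply: (cover S (nbhs z) (fun z' l => A (l, z')) _) => l.
  rewrite /= in_itv /= => lab; suff: nbhs (l, z) A by apply: filterS => -[].
  by apply: open_nbhs_nbhs; split=> //; apply: Az.
by apply: filterS near_z => z' H l lab; apply: H; rewrite /= in_itv.
Qed.

(** The product of the weak topology with the line need not be a weak topology, so
continuity on cells does not suffice. Joint continuity is obtained by fixing a
segment of parameters around l s that is sent by the contraction of f s into the
given neighbourhood W0: the points for which this segment is sent into W0 form an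
open set V, because on each cell V is given by the tube lemma. *)
Lemma ctr_continuous v (S : topologicalType) (l : S -> R) (f : S -> X) :
  continuous l -> continuous f -> (forall s, star v (f s)) ->
  continuous (fun s => ctr v (l s) (f s)).
Proof.
move=> cl cf sf s W; rewrite nbhsE => -[W0 [oW W0s] sub]; apply: filterS sub _.
have cc : continuous (fun k : R => ctr v k (f s)).
  have [C cC Cx] := coords_cell (f s).
  apply: (@cont_pt _ _ C) => //.
    by move=> k; apply: ctrw_cell => //; [apply: sf|apply: clampP].
  have ck : continuous (fun k : R => clamp k) by apply: cont_clamp; apply: cont_id.
  move=> y; apply: contD; first by apply: contD; apply: contM; try apply: contB; try apply: cont_cst.
  by apply: contM; [apply: contB => //; apply: contM|apply: cont_cst].
have : nbhs (l s) ((fun k : R => ctr v k (f s)) @^-1` W0).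
  by apply: cc; apply: open_nbhs_nbhs.
move/nbhs_ballP => [e /= e0 ball_sub].
pose a := l s - e / 2; pose b := l s + e / 2.
pose V : set X := [set x | star v x /\ forall k, a <= k <= b -> W0 (ctr v k x)].
have oV : open V.
  suff: tsq_open V by [].
  move=> C cC; have tW : tsq_open W0 by exact: oW.
  have [A oA WA] := tW _ cC; have [Gam [GamE cGam]] := ctrw_ambient v cC.
  pose B : set {ptws G -> R} := [set w | 0 < w v] `&`
    [set w : {ptws G -> R} | forall k, a <= k <= b -> A (Gam (clamp k, w))].
  exists B.
    apply: openI.
      apply: (@open_comp _ _ (fun w : {ptws G -> R} => w v) [set r : R | 0 < r]).
        by move=> ? _; apply: eval_ptws.
      exact: open_gt.
    apply: (@tube _ a b [set kw : R * {ptws G -> R} | A (Gam (clamp kw.1, kw.2))]).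
    apply: (@open_comp _ _ (fun kw : R * {ptws G -> R} => Gam (clamp kw.1, kw.2) : {ptws G -> R}) A) => //.
    move=> kw _; apply: cont_ptws => y.
    apply: (@cont_comp _ _ _ (fun kw : R * {ptws G -> R} => (clamp kw.1, kw.2) : R * {ptws G -> R}) _ _ (cGam y)).
    apply: cont_pair; last by move=> z; apply: cvg_snd.
    by apply: cont_clamp => z; apply: cvg_fst.
  move=> x Cx; rewrite /V /B /star /=; split=> -[xv H]; split=> // k kab;
    have Ck : C (ctrw v (clamp k) (coords x)) by [apply: ctrw_cell => //; apply: clampP];
    have E : coords (ctr v k x) = Gam (clamp k, coords x) by rewrite /ctr (ptE cC Ck) GamE.
  - by rewrite -E; apply/(WA (ctr v k x)); [rewrite /ctr (ptE cC Ck)|apply: H].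
  - by apply/(WA (ctr v k x)); [rewrite /ctr (ptE cC Ck)|rewrite E; apply: H].
have Vs : V (f s).
  split; first exact: sf.
  move=> k /andP[ak kb]; apply: ball_sub.
  rewrite -ball_normE /=; rewrite ltr_norml; rewrite /a /b in ak kb.
  by apply/andP; split; lra.
have nV : nbhs s (f @^-1` V) by apply: cf; apply: open_nbhs_nbhs.
have nl : nbhs s (l @^-1` [set k | a <= k <= b]).
  apply: cl; apply/nbhs_ballP; exists (e / 2) => /=; first by rewrite divr_gt0.
  move=> k; rewrite -ball_normE /= ltr_norml => /andP[? ?]; rewrite /a /b.
  by apply/andP; split; lra.
by apply: filterS (filterI nV nl) => z [[_ H] kab] /=; apply: H.
Qed.

(** * Walks as paths *)
Lemma homot_chart (T : topologicalType) (F : R * R -> T) (a b : R -> R * R) :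
  continuous F -> continuous a -> continuous b -> a 0 = b 0 -> a 1 = b 1 ->
  homot (fun t => F (a t)) (fun t => F (b t)).
Proof.
move=> cF ca cb E0 E1.
have c1 (h : R -> R * R) : continuous h -> continuous (fun t => (h t).1).
  by move=> ch; apply: (cont_comp ch); apply: cont_fst.
have c2 (h : R -> R * R) : continuous h -> continuous (fun t => (h t).2).
  by move=> ch; apply: (cont_comp ch); apply: cont_snd.
have := homot_map cF (c1 _ ca) (c2 _ ca) (c1 _ cb) (c2 _ cb).
rewrite E0 E1 => /(_ erefl erefl erefl erefl).
by apply: homot_ext => t _; rewrite -surjective_pairing.
Qed.

Lemma map_pcat (T U : topologicalType) (F : T -> U) (f g : R -> T) :
  (fun t => F (pcat f g t)) = pcat (fun t => F (f t)) (fun t => F (g t)).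
Proof. by apply/funext => t; rewrite /pcat; case: ifP. Qed.

Lemma pcat_all (T : topologicalType) (P : T -> Prop) (f g : R -> T) :
  (forall t, P (f t)) -> (forall t, P (g t)) -> forall t, P (pcat f g t).
Proof. by move=> Pf Pg t; rewrite /pcat; case: ifP. Qed.

(** The track of x under the contraction of the star of v. *)
Definition spoke v (x : X) : R -> X := fun t => ctr v (1 - t) x.

Lemma cont_opp1 : continuous (fun t : R => 1 - t).
Proof. by apply: contB; [apply: cont_cst|apply: cont_id]. Qed.

Lemma spoke_ends v x : star v x -> is_path (spoke v x) x (vx v).
Proof.
move=> sx; split; rewrite /spoke.
- by apply: ctr_continuous => //; [apply: cont_opp1|apply: cont_cst].
- by rewrite subr0 ctr1.
- by rewrite subrr ctr0.
Qed.

(** A path f inside the star of v is one side of the rectangle of points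
obtained by contracting f; the other three sides are the spoke of its origin, a
constant path and the reversed spoke of its end. *)
Lemma star_path v (f : R -> X) : continuous f -> (forall t, star v (f t)) ->
  homot f (pcat (spoke v (f 0)) (pinv (spoke v (f 1)))).
Proof.
move=> cf sf.
pose F (lt : R * R) := ctr v lt.1 (f lt.2).
have cF : continuous F.
  by apply: ctr_continuous; [exact: cont_fst|apply: (cont_comp _ cf); exact: cont_snd|move=> s].
pose a := fun t : R => ((1 : R), t).
pose b1 := fun t : R => (1 - t, (0 : R)); pose b2 := fun t : R => ((0 : R), t).
pose b3 := fun t : R => (t, (1 : R)).
have pa : is_path a (1, 0) (1, 1).
  by split=> //; apply: cont_pair; [apply: cont_cst|apply: cont_id].
have p1 : is_path b1 (1, 0) (0, 0).
  split; rewrite /b1 ?subr0 ?subrr //.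
  by apply: cont_pair; [apply: cont_opp1|apply: cont_cst].
have p2 : is_path b2 (0, 0) (0, 1).
  by split=> //; apply: cont_pair; [apply: cont_cst|apply: cont_id].
have p3 : is_path b3 (0, 1) (1, 1).
  by split=> //; apply: cont_pair; [apply: cont_id|apply: cont_cst].
have [cb b0 b1'] := pcat_path (pcat_path p1 p2) p3; have [ca a0 a1] := pa.
have := homot_chart cF ca cb (etrans a0 (esym b0)) (etrans a1 (esym b1')).
rewrite map_pcat map_pcat => H.
have E1 : (fun t => F (a t)) = f by apply/funext => t; rewrite /F /a /= ctr1.
have E2 : (fun t => F (b1 t)) = spoke v (f 0) by [].
have E3 : (fun t => F (b2 t)) = fun=> vx v by apply/funext => t; rewrite /F /b2 /= ctr0.
have E4 : (fun t => F (b3 t)) = pinv (spoke v (f 1)).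
  by apply/funext => t; rewrite /F /b3 /pinv /spoke /=; congr ctr; ring.
rewrite E1 E2 E3 E4 in H; apply: homot_trans H _.
have pt0 := spoke_ends (sf 0); have pt1 := pinv_path (spoke_ends (sf 1)).
apply: (homot_pcat (pcat_path pt0 (cst_path _)) pt1); first exact: pcatp1 pt0.
by apply: homot_refl; case: pt1.
Qed.

Lemma flat_homot C (f g : R -> X) : closed_cell C -> flat_cell C -> continuous f -> continuous g ->
  (forall t, C (coords (f t))) -> (forall t, C (coords (g t))) ->
  f 0 = g 0 -> f 1 = g 1 -> homot f g.
Proof.
move=> cC [conv _] cf cg Cf Cg E0 E1.
pose h (st : R * R) : G -> R := fun y =>
  (1 - clamp st.1) * coords (f st.2) y + clamp st.1 * coords (g st.2) y.
exists (fun st => pt (h st)); split.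
- apply: (cont_pt cC); first by move=> s; apply: conv => //; apply: clampP.
  have cl : continuous (fun st : R * R => clamp st.1) by apply: cont_clamp; apply: cont_fst.
  have cc (k : R -> X) y : continuous k -> continuous (fun st : R * R => coords (k st.2) y).
    move=> ck; apply: (@cont_comp _ _ _ (fun st : R * R => st.2) (fun t => coords (k t) y)).
      exact: cont_snd.
    exact: (@cont_comp _ _ _ k (fun x : X => coords x y) ck (@cont_coord y)).
  move=> y; apply: contD; apply: contM => //; try exact: cc.
  by apply: contB => //; apply: cont_cst.
- move=> t _; rewrite /h /= (clamp_id in01_0) (clamp_id in01_1).
  by split; rewrite -[RHS]pt_coords; congr pt; apply/funext => y; ring.
- move=> s; rewrite /h /= -E0 -E1.
  by split; rewrite -[RHS]pt_coords; congr pt; apply/funext => y; ring.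
Qed.

Definition edge_path u v : R -> X := fun t =>
  pt (fun y => (1 - clamp t) * vertex_pt R u y + clamp t * vertex_pt R v y).

Lemma edge_path_in C u v t :
  closed_cell C -> flat_cell C -> C (vertex_pt R u) -> C (vertex_pt R v) ->
  C (coords (edge_path u v t)).
Proof.
move=> cC [conv _] Cu Cv; have Ct := conv _ _ _ Cu Cv (clampP t).
by rewrite /edge_path (ptE cC Ct).
Qed.

Lemma edge_ends u v : edge_cell u v (vertex_pt R u) /\ edge_cell u v (vertex_pt R v).
Proof.
split; [exists 1, 0|exists 0, 1]; by split; [lra|lra|lra|apply/funext => y; ring].
Qed.

Lemma edge_path_ends u v : adj u v -> is_path (edge_path u v) (vx u) (vx v).
Proof.
move=> uv; have [conv _] := edge_flat uv; have [eu ev] := edge_ends u v.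
split.
- apply: (cont_pt (EdgeCell R uv)).
    by move=> t; apply: conv => //; apply: clampP.
  have cl : continuous (fun t : R => clamp t) by apply: cont_clamp; apply: cont_id.
  move=> y; apply: contD; apply: contM; try apply: cont_cst => //; try done.
  by apply: contB => //; apply: cont_cst.
- by rewrite /edge_path (clamp_id in01_0); congr pt; apply/funext => y; ring.
- by rewrite /edge_path (clamp_id in01_1); congr pt; apply/funext => y; ring.
Qed.

Lemma edge_path_inv u v t : 0 <= t <= 1 -> pinv (edge_path u v) t = edge_path v u t.
Proof.
move=> t01; rewrite /pinv /edge_path !clamp_id //; last by case/andP: t01 => ? ?; lra.
by congr pt; apply/funext => y; ring.
Qed.

Definition square_map a b c d (st : R * R) : X := pt (bil a b c d (clamp st.1) (clamp st.2)).

Lemma square_map_cont a b c d : square a b c d -> continuous (square_map a b c d).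
Proof.
move=> sq; apply: (cont_pt (SquareCell R sq)).
  by move=> st; apply: bil_cell; apply: clampP.
have c1 : continuous (fun st : R * R => clamp st.1) by apply: cont_clamp; apply: cont_fst.
have c2 : continuous (fun st : R * R => clamp st.2) by apply: cont_clamp; apply: cont_snd.
have c1' : continuous (fun st : R * R => 1 - clamp st.1) by apply: contB => //; apply: cont_cst.
have c2' : continuous (fun st : R * R => 1 - clamp st.2) by apply: contB => //; apply: cont_cst.
move=> y; rewrite /bil; have cc (z : R) : continuous (fun _ : R * R => z) by apply: cont_cst.
by apply: contD; [apply: contD; [apply: contD|]|]; apply: contM => //; apply: contM.
Qed.

Fixpoint walk_path u (p : seq G) : R -> X :=
  if p is x :: p' then pcat (edge_path u x) (walk_path x p') else fun=> vx u.

Lemma walk_path_ends u p : path adj u p -> is_path (walk_path u p) (vx u) (vx (last u p)).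
Proof.
elim: p u => [|x p IH] u /=; first by move=> _; apply: cst_path.
by case/andP=> ux px; apply: pcat_path (edge_path_ends ux) (IH _ px).
Qed.

Lemma walk_path_cat u p q : path adj u p -> path adj (last u p) q ->
  homot (pcat (walk_path u p) (walk_path (last u p) q)) (walk_path u (p ++ q)).
Proof.
elim: p u => [|x p IH] u /=; first by move=> _ pq; apply: pcat1p (walk_path_ends pq).
case/andP=> ux px pq; have e := edge_path_ends ux; have wp := walk_path_ends px.
have wq := walk_path_ends pq.
apply: homot_trans (pcatA e wp wq) _.
apply: (homot_pcat e (pcat_path wp wq)); last exact: IH.
by apply: homot_refl; case: e.
Qed.

Lemma triangle_homot u x y : adj u x -> adj x y -> adj u y ->
  homot (pcat (edge_path u x) (edge_path x y)) (edge_path u y).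
Proof.
move=> ux xy uy; have tri : triangle u x y by split; rewrite // adj_sym.
have [cC fC] := (TriangleCell R tri, triangle_flat tri).
have Cv z : z \in [:: u; x; y] -> triangle_cell u x y (vertex_pt R z).
  rewrite !inE => /or3P[] /eqP ->; [exists 1, 0, 0|exists 0, 1, 0|exists 0, 0, 1];
  by split; [lra|lra|lra|lra|apply/funext => t; ring].
have [Cu Cx Cy] : [/\ triangle_cell u x y (vertex_pt R u), triangle_cell u x y (vertex_pt R x)
  & triangle_cell u x y (vertex_pt R y)] by split; apply: Cv; rewrite !inE eqxx ?orbT.
have [c1 a0 a1] := pcat_path (edge_path_ends ux) (edge_path_ends xy).
have [c2 b0 b1] := edge_path_ends uy.
apply: (flat_homot cC fC c1 c2); rewrite ?a0 ?a1 ?b0 ?b1 //.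
- by apply: (pcat_all (P := fun x => triangle_cell u _ y (coords x))) => t; apply: edge_path_in.
- by move=> t; apply: edge_path_in.
Qed.

Lemma square_map_edges a b c d : square a b c d ->
  [/\ (fun t => square_map a b c d (t, 0)) = edge_path a b,
      (fun t => square_map a b c d (1, t)) = edge_path b c,
      (fun t => square_map a b c d (0, t)) = edge_path a d &
      (fun t => square_map a b c d (t, 1)) = edge_path d c].
Proof.
by move=> sq; split; apply/funext => t; rewrite /square_map /edge_path /= ?(clamp_id in01_0) ?(clamp_id in01_1);
   congr pt; apply/funext => y; rewrite /bil; ring.
Qed.

Lemma square_homot a b c d : square a b c d ->
  homot (pcat (edge_path a b) (edge_path b c)) (pcat (edge_path a d) (edge_path d c)).
Proof.
move=> sq; have [<- <- <- <-] := square_map_edges sq; rewrite -!map_pcat.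
have p1 : is_path (fun t : R => (t, (0 : R))) (0, 0) (1, 0).
  by split=> //; apply: cont_pair; [apply: cont_id|apply: cont_cst].
have p2 : is_path (fun t : R => ((1 : R), t)) (1, 0) (1, 1).
  by split=> //; apply: cont_pair; [apply: cont_cst|apply: cont_id].
have p3 : is_path (fun t : R => ((0 : R), t)) (0, 0) (0, 1).
  by split=> //; apply: cont_pair; [apply: cont_cst|apply: cont_id].
have p4 : is_path (fun t : R => (t, (1 : R))) (0, 1) (1, 1).
  by split=> //; apply: cont_pair; [apply: cont_id|apply: cont_cst].
have [c1 a0 a1] := pcat_path p1 p2; have [c2 b0 b1] := pcat_path p3 p4.
by apply: homot_chart; rewrite ?a0 ?a1 ?b0 ?b1 //; apply: square_map_cont.
Qed.

(** Backtracking is undone by [pcatpV], and the other two elementary homotopies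
take place inside one closed cell, by convexity of a triangle and by the chart of
a square. *)
Lemma walk_homot_sound u p q : walk_homot (@adj G) u p q ->
  path adj u p = path adj u q /\
  (path adj u p -> last u p = last u q /\ homot (walk_path u p) (walk_path u q)).
Proof.
have two a b c r (e : R -> X) : adj a b -> adj b c -> path adj c r ->
    homot (pcat (edge_path a b) (edge_path b c)) e ->
    homot (walk_path a [:: b, c & r]) (pcat e (walk_path c r)).
  move=> ab bc pr H; have w := walk_path_ends pr.
  have [e1 e2] := (edge_path_ends ab, edge_path_ends bc).
  apply: homot_trans (homot_sym (pcatA e1 e2 w)) _.
  apply: (homot_pcat (pcat_path e1 e2) w H).
  by apply: homot_refl; case: w.
elim=> {u p q} [u p|u p q _ [E H]|u p q r _ [E1 H1] _ [E2 H2]|u x p q ux _ [E H]|u x p ux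
   |u x y p ux xy uy|u x y z p s] /=.
- by split=> // pp; split=> //; apply: homot_refl; case: (walk_path_ends pp).
- split=> // pq; have [-> h] : last u p = last u q /\ homot (walk_path u p) (walk_path u q).
    by apply: H; rewrite E.
  by split=> //; apply: homot_sym.
- split; first by rewrite E1.
  move=> pp; have [-> h1] := H1 pp; have [|-> h2] := H2; first by rewrite -E1.
  by split=> //; apply: homot_trans h1 h2.
- split; first by rewrite E.
  case/andP=> _ pp; have [-> h] := H pp; split=> //.
  apply: (homot_pcat (edge_path_ends ux) (walk_path_ends pp)) h.
  by apply: homot_refl; case: (edge_path_ends ux).
- have xu : adj x u by rewrite adj_sym.
  split; first by rewrite ux xu.
  case/and3P=> _ _ pp; split=> //; have w := walk_path_ends pp.
  apply: homot_trans (two _ _ _ _ (fun=> vx u) ux xu pp _) (pcat1p w).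
  apply: homot_trans (pcatpV (edge_path_ends ux)).
  have [e1 e2] := (edge_path_ends ux, edge_path_ends xu).
  apply: (homot_pcat e1 e2); first by apply: homot_refl; case: e1.
  apply: (homot_ext (f := edge_path x u) (g := edge_path x u)) => //.
    by move=> t t01; rewrite edge_path_inv.
  by apply: homot_refl; case: e2.
- split; first by rewrite ux xy uy.
  case/and3P=> _ _ pp; split=> //.
  exact: (two _ _ _ _ _ ux xy pp (triangle_homot ux xy uy)).
- move/squareP: s => s; have [[ux xy yz zu] _] := s.
  rewrite adj_sym in yz; rewrite adj_sym in zu.
  split; first by rewrite ux xy yz zu.
  case/and3P=> _ _ pp; split=> //.
  apply: homot_trans (two _ _ _ _ _ ux xy pp (square_homot s)) _.
  exact: pcatA (edge_path_ends zu) (edge_path_ends yz) (walk_path_ends pp).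
Qed.

(** * From paths to walks *)
Lemma square_map_rot a b c d (s t : R) : 0 <= s <= 1 -> 0 <= t <= 1 ->
  square_map b c d a (s, t) = square_map a b c d (1 - t, s).
Proof.
move=> s01 t01; rewrite /square_map /= !clamp_id //; last by case/andP: t01 => ? ?; lra.
by rewrite [bil a b c d _ _]bil_rot; congr pt; congr bil; ring.
Qed.

Lemma scale01 (r s : R) : 0 <= r <= 1 -> 0 <= s <= 1 -> 0 <= r * s <= 1.
Proof. by move=> /andP[r0 r1] /andP[s0 s1]; rewrite mulr_ge0 //= mulr_ile1. Qed.

Lemma compl01 (r : R) : 0 <= r <= 1 -> 0 <= 1 - r <= 1.
Proof. by case/andP=> ? ?; apply/andP; split; lra. Qed.

(** In the chart of a square with corner v, spokes towards v are straight. *)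
Lemma spoke_square v b c d s t x r : square v b c d -> 0 <= s <= 1 -> 0 <= t <= 1 ->
  coords x = bil v b c d s t -> star v x -> 0 <= r <= 1 ->
  spoke v x r = square_map v b c d ((1 - r) * s, (1 - r) * t).
Proof.
move=> sq s01 t01 Ex sx /compl01 r01; rewrite /spoke /ctr clamp_id // Ex ctrw_square //.
  by rewrite /square_map /= !clamp_id //; apply: scale01.
by rewrite -Ex.
Qed.

(** Two spokes in one square are straight in its chart, so that they are homotopic
to any path beta in the chart between the two corners (0, 0) and (i, j). *)
Lemma square_turn v b c d s t x v' (i j : R) (beta : R -> R * R) (k : R -> X) :
  square v b c d -> 0 <= s <= 1 -> 0 <= t <= 1 ->
  coords x = bil v b c d s t -> star v x ->
  (forall r, 0 <= r <= 1 -> spoke v' x r = square_map v b c d (s + r * (i - s), t + r * (j - t))) ->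
  is_path beta (0, 0) (i, j) ->
  homot (fun r => square_map v b c d (beta r)) k ->
  homot (pcat (pinv (spoke v x)) (spoke v' x)) k.
Proof.
move=> sq s01 t01 Ex sx tauE pb; apply: homot_trans.
have p1 : is_path (fun r : R => (r * s, r * t)) (0, 0) (s, t).
  split; rewrite ?mul0r ?mul1r //.
  by apply: cont_pair; apply: contM; try apply: cont_id; apply: cont_cst.
have p2 : is_path (fun r : R => (s + r * (i - s), t + r * (j - t))) (s, t) (i, j).
  split; rewrite ?mul0r ?mul1r ?addr0 //; last by congr pair; ring.
  by apply: cont_pair; apply: contD; try apply: cont_cst; apply: contM;
    try apply: cont_id; apply: cont_cst.
have [c1 a0 a1] := pcat_path p1 p2; have [c2 b0 b1] := pb.
have := homot_chart (square_map_cont sq) c1 c2 (etrans a0 (esym b0)) (etrans a1 (esym b1)).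
rewrite map_pcat; apply: homot_ext => // r /andP[r0 r1]; rewrite /pcat; case: leP => hr.
  have r01 : 0 <= 2 * r <= 1 by apply/andP; split; lra.
  rewrite /pinv (spoke_square sq s01 t01 Ex sx (compl01 r01)).
  by congr square_map; congr pair; ring.
by rewrite tauE //; apply/andP; split; lra.
Qed.

(** The vertices v and v' belong to the cell of x, as both have a positive coordinate
at x. In a flat cell they are equal or adjacent and convexity applies; in a square
they are joined by at most two of its sides. *)
Lemma spoke_turn v v' x : star v x -> star v' x -> exists p,
  [/\ path adj v p, last v p = v' & homot (pcat (pinv (spoke v x)) (spoke v' x)) (walk_path v p)].
Proof.
move=> sx sx'; have [C cC Cx] := coords_cell x.
have same u : star u x -> homot (pcat (pinv (spoke u x)) (spoke u x)) (walk_path u [::]).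
  by move=> su; apply: (pcatVp (spoke_ends su)).
have [E|ne] := eqVneq v v'; first by exists [::]; split=> //; rewrite -E; apply: same.
have edge (u u' : G) (uu : adj u u') (k : R -> X) : homot k (edge_path u u') -> homot k (walk_path u [:: u']).
  move=> h; apply: homot_trans h _; apply: homot_sym.
  exact: pcatp1 (edge_path_ends uu).
have [p1 p2] := (spoke_ends sx, spoke_ends sx').
have [fC|[a0 [b0 [c0 [d0 [sq0 E0]]]]]] := cell_cases cC.
  have [conv [vs [supp Cvs clique]]] := fC.
  have [vv v'v] := (supp _ _ Cx sx, supp _ _ Cx sx').
  have vv' : adj v v' by case: (clique v v' vv v'v) => // E; rewrite E eqxx in ne.
  exists [:: v']; split=> //=; first by rewrite vv'.
  apply: edge => //.
  have inC u t : star u x -> C (coords (spoke u x t)).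
    move=> su; have H := ctrw_cell cC Cx su (clampP (1 - t)).
    by rewrite /spoke /ctr (ptE cC H).
  have [ca a0 a1] := pcat_path (pinv_path p1) p2.
  have [cb b0 b1] := edge_path_ends vv'.
  apply: (flat_homot cC fC ca cb); rewrite ?a0 ?a1 ?b0 ?b1 //.
    by apply: (pcat_all (P := fun y : X => C (coords y))) => t; apply: inC.
  by move=> t; apply: edge_path_in => //; apply: Cvs.
rewrite {}E0 in Cx.
have [b [c [d [sq E]]]] := square_cell_from sq0 Cx sx; rewrite {}E in Cx.
case: Cx => s [t [s01 t01 Ex]].
have {}Ex : coords x = bil v b c d s t by [].
have near_case b' d' s' t' : square v b' c d' -> 0 <= s' <= 1 -> 0 <= t' <= 1 ->
    coords x = bil v b' c d' s' t' -> star b' x -> exists p,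
    [/\ path adj v p, last v p = b' & homot (pcat (pinv (spoke v x)) (spoke b' x)) (walk_path v p)].
  move=> {sq s01 t01 Ex b d s t} sq s01 t01 Ex sb.
  have [[vb bc cd dv] _] := sq.
  exists [:: b']; split=> //=; first by rewrite vb.
  apply: edge => //.
  apply: (square_turn (i := 1) (j := 0) (beta := fun r => (r, 0)) sq s01 t01 Ex sx).
  - move=> r r01; have r01' := compl01 r01.
    rewrite bil_rot in Ex.
    rewrite (spoke_square (square_rot sq) t01 (compl01 s01) Ex sb r01).
    rewrite square_map_rot //; try by apply: scale01 => //; apply: compl01.
    by congr square_map; congr pair; ring.
  - by split=> //; apply: cont_pair; [apply: cont_id|apply: cont_cst].
  - by have [-> _ _ _] := square_map_edges sq; apply: homot_refl; case: (edge_path_ends vb).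
have : v' \in [:: v; b; c; d] by apply: (@bil_supp v b c d s t); rewrite -Ex.
rewrite !inE => /or4P[] /eqP Ev.
- by rewrite Ev eqxx in ne.
- by rewrite Ev in sx' *; apply: near_case sq s01 t01 Ex sx'.
- rewrite Ev in sx' *; have [[vb bc cd dv] _] := sq.
  exists [:: b; c]; split=> //=; first by rewrite vb bc.
  pose b1 := fun r : R => (r, (0 : R)); pose b2 := fun r : R => ((1 : R), r).
  have q1 : is_path b1 (0, 0) (1, 0).
    by split=> //; apply: cont_pair; [apply: cont_id|apply: cont_cst].
  have q2 : is_path b2 (1, 0) (1, 1).
    by split=> //; apply: cont_pair; [apply: cont_cst|apply: cont_id].
  apply: (square_turn (i := 1) (j := 1) (beta := pcat b1 b2) sq s01 t01 Ex sx).
  - move=> r r01; have r01' := compl01 r01.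
    rewrite bil_rot bil_rot in Ex.
    rewrite (spoke_square (square_rot (square_rot sq)) (compl01 s01) (compl01 t01) Ex sx' r01).
    have S1 : 0 <= (1 - r) * (1 - s) <= 1 by apply: scale01 => //; apply: compl01.
    have T1 : 0 <= (1 - r) * (1 - t) <= 1 by apply: scale01 => //; apply: compl01.
    rewrite square_map_rot // square_map_rot //; last exact: compl01.
    by congr square_map; congr pair; ring.
  - exact: pcat_path q1 q2.
  - rewrite map_pcat; have [-> -> _ _] := square_map_edges sq.
    have [e1 e2] := (edge_path_ends vb, edge_path_ends bc).
    apply: (homot_pcat e1 e2); first by apply: homot_refl; case: e1.
    exact: homot_sym (pcatp1 e2).
- rewrite Ev in sx' *; rewrite bil_flip in Ex.
  exact: near_case (square_flip sq) t01 s01 Ex sx'.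
Qed.

Lemma star_exists (x : X) : exists v, star v x.
Proof.
have [C cC Cx] := coords_cell x; apply: contrapT => none.
have z y : coords x y <= 0 by rewrite leNgt; apply/negP => h; apply: none; exists y.
case: cC Cx => [v E|a b ab [p [q [p0 q0 E1 E]]]|a b c tr [p [q [r [p0 q0 r0 E1 E]]]]
  |a b c d sq [s [t [s01 t01 E]]]].
- by have := z v; rewrite E vertex_pt_self ler10.
- have : coords x a + coords x b >= 1.
    rewrite E !vertex_pt_self; have := vertex_pt_ge0 a b; have := vertex_pt_ge0 b a.
    by move=> h1 h2; have := mulr_ge0 q0 h1; have := mulr_ge0 p0 h2; lra.
  have := z a; have := z b; lra.
- have ge u := vertex_pt_ge0 u.
  have : coords x a + coords x b + coords x c >= 1.
    rewrite E !vertex_pt_self.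
    have := mulr_ge0 p0 (ge a b); have := mulr_ge0 p0 (ge a c).
    have := mulr_ge0 q0 (ge b a); have := mulr_ge0 q0 (ge b c).
    have := mulr_ge0 r0 (ge c a); have := mulr_ge0 r0 (ge c b); lra.
  have := z a; have := z b; have := z c; lra.
- have {}E : coords x = bil a b c d s t by [].
  have [Ea Eb Ec Ed] := bilE s t sq.
  have := z a; have := z b; have := z c; have := z d; rewrite E Ea Eb Ec Ed; lra.
Qed.

(** Induction along the line: a property that is locally constant, and true at 0,
is true everywhere. *)
Lemma connected_R (P : R -> Prop) : P 0 ->
  (forall t, exists e : R, 0 < e /\ forall t1 t2, `|t1 - t| < e -> `|t2 - t| < e -> P t1 -> P t2) ->
  forall t, P t.
Proof.
move=> P0 loc t; have cR : connected [set: R] by apply/connected_intervalP.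
have E : [set s | P s] = [set: R].
  apply: cR; first by exists 0.
  - exists [set s | P s]; last by rewrite setTI.
    rewrite openE => s Ps; have [e [e0 H]] := loc s.
    apply/nbhs_ballP; exists e => //= s'; rewrite -ball_normE /= distrC => h.
    by apply: (H s) => //; rewrite subrr normr0.
  - exists [set s | P s]; last by rewrite setTI.
    rewrite -[X in closed X]setCK; apply: open_closedC; rewrite openE => s nPs.
    have [e [e0 H]] := loc s.
    apply/nbhs_ballP; exists e => //= s'; rewrite -ball_normE /= distrC => h Ps'.
    by apply: nPs; apply: (H s') => //; rewrite subrr normr0.
by have : [set s | P s] t by rewrite E.
Qed.

(** The initial segments of f with the desired property form an open and closed set:
near t0 the path stays in the star of some vertex v by continuity, where the
path between two parameters t1 and t2 is homotopic to two spokes of v; the spoke of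
the walk at t1 and the first of these combine to a walk by [spoke_turn]. *)
Lemma path_walk v0 (f : R -> X) : continuous f -> star v0 (f 0) ->
  exists p, [/\ path adj v0 p, star (last v0 p) (f 1) &
    homot f (pcat (spoke v0 (f 0)) (pcat (walk_path v0 p) (pinv (spoke (last v0 p) (f 1)))))].
Proof.
move=> cf s0.
pose g t := f (clamp t).
have cg : continuous g.
  by move=> t; apply: continuous_comp; [apply: cont_clamp; apply: cont_id|apply: cf].
have g0 : g 0 = f 0 by rewrite /g (clamp_id in01_0).
have g1 : g 1 = f 1 by rewrite /g (clamp_id in01_1).
pose P t := exists p, [/\ path adj v0 p, star (last v0 p) (g t) &
  homot (fun s => g (0 + s * (t - 0)))
    (pcat (spoke v0 (f 0)) (pcat (walk_path v0 p) (pinv (spoke (last v0 p) (g t)))))].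
have ptau u x (sx : star u x) := spoke_ends sx.
have lin (a b : R) : continuous (fun s : R => g (a + s * b)).
  move=> t; apply: continuous_comp; last exact: cg.
  by apply: contD; [apply: cont_cst|apply: contM; [apply: cont_id|apply: cont_cst]].
suff: P 1.
  case=> p [pp sp H]; rewrite g1 in sp H; exists p; split=> //.
  by apply: homot_ext H => // t t01; rewrite add0r subr0 mulr1 /g clamp_id.
apply: connected_R.
  exists [::]; rewrite g0; split=> //=.
  have [h1 h2] := (ptau _ _ s0, pinv_path (ptau _ _ s0)).
  apply: homot_trans (homot_sym (homot_trans _ (pcatpV h1))).
    apply: (homot_ext (f := fun=> f 0) (g := fun=> f 0)) => //.
      by move=> t _; rewrite subr0 mulr0 addr0 g0.
    by apply: homot_refl; apply: cont_cst.
  apply: (homot_pcat h1 (pcat_path (cst_path _) h2)); first by apply: homot_refl; case: h1.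
  exact: pcat1p h2.
move=> t0; have [v sv] := star_exists (g t0).
have : nbhs t0 (g @^-1` star v).
  apply: cg; apply: open_nbhs_nbhs; split=> //.
  apply: (@open_comp _ _ (fun x : X => coords x v) [set r : R | 0 < r]).
    by move=> ? _; apply: cont_coord.
  exact: open_gt.
move/nbhs_ballP => [e /= e0 be]; exists e; split=> // t1 t2 h1 h2 [p [pp sp H]].
(* the path from g t1 to g t2, made constant outside [0, 1] so that it stays in the star *)
pose sig s := g (t1 + clamp s * (t2 - t1)).
have ssig s : star v (sig s).
  apply: be; rewrite -ball_normE /= distrC; have /andP[c0 c1] := clampP s.
  have -> : t1 + clamp s * (t2 - t1) - t0 = (1 - clamp s) * (t1 - t0) + clamp s * (t2 - t0) by ring.
  apply: le_lt_trans (ler_normD _ _) _; rewrite !normrM (ger0_norm c0) ger0_norm ?subr_ge0 //.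
  have [c0'|c0'] := eqVneq (clamp s) 0; first by rewrite c0' subr0 mul1r mul0r addr0.
  have c0'' : 0 < clamp s by rewrite lt_neqAle eq_sym c0'.
  have : (1 - clamp s) * `|t1 - t0| <= (1 - clamp s) * e.
    by apply: ler_wpM2l; [rewrite subr_ge0|apply: ltW].
  have : clamp s * `|t2 - t0| < clamp s * e by rewrite ltr_pM2l.
  lra.
have csig : continuous sig.
  move=> s; apply: continuous_comp; last exact: cg.
  apply: contD; first exact: cont_cst.
  by apply: contM; [apply: cont_clamp; apply: cont_id|apply: cont_cst].
have sig0 : sig 0 = g t1 by rewrite /sig (clamp_id in01_0) mul0r addr0.
have sig1 : sig 1 = g t2 by rewrite /sig (clamp_id in01_1); congr g; ring.
have S := star_path csig ssig; rewrite sig0 sig1 in S.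
have [sv1 sv2] : star v (g t1) /\ star v (g t2) by rewrite -sig0 -sig1.
have [q [pq lq turnq]] := spoke_turn sp sv1.
exists (p ++ q); rewrite cat_path pp last_cat lq; split=> //.
have A := ptau _ _ s0; have B := walk_path_ends pp; have C := ptau _ _ sp.
have D := ptau _ _ sv1; have E := ptau _ _ sv2; have Q := walk_path_ends pq.
have [iC iE] := (pinv_path C, pinv_path E).
have Hsub := pcat_subpath 0 t1 t2 cg.
have pH : is_path (fun s => g (0 + s * (t1 - 0))) (f 0) (g t1).
  by split; [exact: lin|rewrite mul0r addr0 g0|congr g; ring].
have pS : is_path (fun s => g (t1 + s * (t2 - t1))) (g t1) (g t2).
  by split; [exact: lin|rewrite mul0r addr0|congr g; ring].
have Sg : homot (fun s => g (t1 + s * (t2 - t1))) (pcat (spoke v (g t1)) (pinv (spoke v (g t2)))).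
  by apply: homot_ext S => // s s01; rewrite /sig clamp_id.
have refl (h : R -> X) a b : is_path h a b -> homot h h by case=> ch _ _; apply: homot_refl.
apply: homot_trans (homot_sym Hsub) _.
apply: homot_trans (homot_pcat pH pS H Sg) _.
have DE := pcat_path D iE; have BC := pcat_path B iC.
apply: homot_trans (pcatA A BC DE) _.
apply: (homot_pcat A (pcat_path BC DE) (refl _ _ _ A)).
apply: homot_trans (pcatA B iC DE) _.
have CDE := pcat_path iC DE.
have CD := pcat_path iC D.
apply: homot_trans (homot_pcat B CDE (refl _ _ _ B) (homot_sym (pcatA iC D iE))) _.
have cdq : homot (pcat (pcat (pinv (spoke (last v0 p) (g t1))) (spoke v (g t1))) (pinv (spoke v (g t2))))
   (pcat (walk_path (last v0 p) q) (pinv (spoke v (g t2)))).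
  exact: (homot_pcat CD iE turnq (refl _ _ _ iE)).
apply: homot_trans (homot_pcat B (pcat_path CD iE) (refl _ _ _ B) cdq) _.
rewrite lq in Q.
apply: homot_trans (homot_sym (pcatA B Q iE)) _.
apply: (homot_pcat (pcat_path B Q) iE); last exact: refl iE.
exact: walk_path_cat.
Qed.

End Complex.

(** * Finiteness of the fundamental group *)
Section UnitIntervalMaps.
Variable R : realType.

Lemma clamp_itv (t : R) : clamp t \in [set` `[(0 : R), 1]].
Proof. by rewrite inE /= in_itv /= clampP. Qed.

Definition to_itv (t : R) : unit_itv R := exist _ (clamp t) (clamp_itv t).

Lemma to_itv_val (s : unit_itv R) : to_itv (val s) = s.
Proof.
apply: val_inj; rewrite /= clamp_id //.
by have := valP s; rewrite inE /= in_itv.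
Qed.

Lemma cont_val : continuous (val : unit_itv R -> R).
Proof. exact: initial_continuous. Qed.

Lemma cont_to_itv : continuous to_itv.
Proof.
apply: (@continuous_comp_initial _ _ _ (val : unit_itv R -> R)).
by apply: cont_clamp; apply: cont_id.
Qed.

Lemma to_itv0 : to_itv 0 = zero.
Proof. by apply: val_inj; rewrite /= (clamp_id in01_0). Qed.

Lemma to_itv1 : to_itv 1 = one.
Proof. by apply: val_inj; rewrite /= (clamp_id in01_1). Qed.

Lemma val_in01 (s : unit_itv R) : 0 <= val s <= 1.
Proof. by have := valP s; rewrite inE /= in_itv. Qed.

End UnitIntervalMaps.

Section Loops.
Variables (R : realType) (T : topologicalType) (x : T).
Implicit Types p q r : loop R x.

Definition unroll p : R -> T := fun t => p (to_itv t).

Lemma unroll_path p : is_path (unroll p) x x.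
Proof.
split; rewrite /unroll.
- by apply: (cont_comp (@cont_to_itv R)); apply: cts_fun.
- by rewrite to_itv0 path_zero.
- by rewrite to_itv1 path_one.
Qed.

(** Composition with the retraction [to_itv] and restriction to the interval turn
the two kinds of homotopies into each other. *)
Lemma homotopicP p q : loop_homotopic p q <-> homot (unroll p) (unroll q).
Proof.
have [cp p0 p1] := unroll_path p.
split=> -[H [cH H1 H2]].
- exists (fun st => H (to_itv st.1, to_itv st.2)); split=> [|t _|s] /=.
  + apply: (cont_comp _ cH); apply: cont_pair; apply: cont_comp (@cont_to_itv R).
      exact: cont_fst.
    exact: cont_snd.
  + by rewrite to_itv0 to_itv1 H1.1 H1.2.
  + by rewrite to_itv0 to_itv1 p0 p1 H2.1 H2.2.
- exists (fun st => H (val st.1, val st.2)); split=> /=.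
  + apply: (cont_comp _ cH); apply: cont_pair; apply: cont_comp (@cont_val R).
      by move=> z; apply: cvg_fst.
    by move=> z; apply: cvg_snd.
  + by split=> t; have [E0 E1] := H1 _ (val_in01 t); rewrite ?E0 ?E1 /unroll to_itv_val.
  + by split=> s; have [E0 E1] := H2 (val s); rewrite ?E0 ?E1 ?p0 ?p1.
Qed.

End Loops.

Section Cancel.
Variables (R : realType) (T : topologicalType).
Implicit Types f g h : R -> T.

Lemma pcat_cancel_l f g h x y z : is_path h x y -> is_path f y z -> is_path g y z ->
  homot (pcat h f) (pcat h g) -> homot f g.
Proof.
move=> ph pf pg H.
have cancel k : is_path k y z -> homot (pcat (pinv h) (pcat h k)) k.
  move=> pk; have ih := pinv_path ph; have [ck _ _] := pk.
  apply: homot_trans (homot_sym (pcatA ih ph pk)) _.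
  exact: homot_trans (homot_pcat (pcat_path ih ph) pk (pcatVp ph) (homot_refl ck)) (pcat1p pk).
apply: homot_trans (homot_sym (cancel _ pf)) (homot_trans _ (cancel _ pg)).
have [ci i0 i1] := pinv_path ph.
exact: homot_pcat (pinv_path ph) (pcat_path ph pf) (homot_refl ci) H.
Qed.

Lemma pcat_cancel_r f g h x y z : is_path f x y -> is_path g x y -> is_path h y z ->
  homot (pcat f h) (pcat g h) -> homot f g.
Proof.
move=> pf pg ph H.
have cancel k : is_path k x y -> homot (pcat (pcat k h) (pinv h)) k.
  move=> pk; have ih := pinv_path ph; have [ck _ _] := pk.
  apply: homot_trans (pcatA pk ph ih) _.
  exact: homot_trans (homot_pcat pk (pcat_path ph ih) (homot_refl ck) (pcatpV ph)) (pcatp1 pk).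
apply: homot_trans (homot_sym (cancel _ pf)) (homot_trans _ (cancel _ pg)).
have [ci i0 i1] := pinv_path ph.
exact: homot_pcat (pcat_path pf ph) (pinv_path ph) H (homot_refl ci).
Qed.

End Cancel.

Lemma finite_subsets (K : choiceType) (N : set K) :
  finite_set N -> finite_set [set C : set K | C `<=` N].
Proof.
move=> /finite_fsetP[X ->].
apply: (@sub_finite_set _ _ ((fun Y : {fset K} => [set` Y]) @` [set` fpowerset X])).
  move=> C /= CX; exists [fset y in X | `[< C y >]]%fset; first by rewrite /= fpowersetE fset_sub.
  apply/seteqP; split=> y /=; rewrite !inE; first by case/andP=> _ /asboolP.
  by move=> Cy; apply/andP; split; [apply: CX|apply/asboolP].
exact: finite_image.
Qed.

Section Finiteness.
Variables (R : realType) (G : graph).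
Hypotheses (G_conn : connected_graph G) (G_ic : interval_condition G)
  (G_lpc : local_positioning_condition G).
Variable x0 : tsq_complex R G.
Notation spoke := (spoke x0).
Notation walk_path := (walk_path x0).

(** The walk given by [path_walk] ends at a vertex w whose star contains x0, but
which may differ from v0: [spoke_turn] at x0 continues the walk from w to v0. *)
Lemma loop_walk v0 (f : R -> tsq_complex R G) : is_path f x0 x0 -> star v0 x0 -> exists p,
  [/\ path adj v0 p, last v0 p = v0 &
    homot f (pcat (spoke v0 x0) (pcat (walk_path v0 p) (pinv (spoke v0 x0))))].
Proof.
move=> [cf f0 f1] s0; have := path_walk x0 cf; rewrite f0 f1 => /(_ v0 s0).
case=> p [pp sw H]; have [q [pq lq Hq]] := spoke_turn x0 sw s0.
set w := last v0 p in sw H pq lq Hq *.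
exists (p ++ q); rewrite cat_path pp last_cat -/w; split=> //.
apply: homot_trans H _.
have A := spoke_ends x0 s0; have iA := pinv_path A.
have B := spoke_ends x0 sw; have iB := pinv_path B.
have P := walk_path_ends x0 pp; have Q := walk_path_ends x0 pq; rewrite lq in Q.
have rf (k : R -> tsq_complex R G) a b : is_path k a b -> homot k k.
  by case=> ck _ _; apply: homot_refl.
apply: (homot_pcat A (pcat_path P iB)); first exact: (rf _ _ _ A).
apply: homot_trans (homot_trans _ (homot_sym (pcatA P Q iA))) _.
  apply: (homot_pcat P iB); first exact: (rf _ _ _ P).
  apply: homot_trans (homot_sym (pcatp1 iB)) _.
  have E : homot (fun=> x0) (pcat (spoke v0 x0) (pinv (spoke v0 x0))) by apply/homot_sym/(pcatpV A).
  apply: homot_trans (homot_pcat iB (cst_path x0) (rf _ _ _ iB) E) _.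
  apply: homot_trans (homot_sym (pcatA iB A iA)) _.
  exact: homot_pcat (pcat_path iB A) iA Hq (rf _ _ _ iA).
apply: (homot_pcat (pcat_path P Q) iA); last exact: (rf _ _ _ iA).
exact: walk_path_cat.
Qed.

(** Conjugation by a walk between v0 and v turns the closed walk of a loop at x0 into
a closed walk at v, and the code of the latter, a subset of the finite set of
neighbours of v, determines the homotopy class of the loop. *)
Lemma pi1_finite (v : G) : finite_set [set w : G | adj v w] -> finite_set (pi1 R x0).
Proof.
move=> /finite_subsets finN; have [v0 s0] := star_exists x0.
have /choice[eta etaP] (p : loop R x0) := loop_walk (unroll_path p) s0.
have [n /asboolP[b [pb lb _]]] := G_conn v v0.
have [c [pc lc _]] : exists c : seq G, [/\ path adj v0 c, last v0 c = v & True].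
  by have [m /asboolP[c [pc lc _]]] := G_conn v0 v; exists c.
have [code [codeN codeP]] := walk_code (@adj_sym G) (@adj_irrefl G)
  (@interval_clique G G_conn G_ic) (@interval_mates G G_conn G_ic)
  (@positioning_near G G_conn G_lpc) (@interval_square G G_conn G_ic)
  (@positioning_far G G_conn G_lpc) v.
pose z p := b ++ eta p ++ c.
have zP p : path adj v (z p) /\ last v (z p) = v.
  by have [pe le _] := etaP p; rewrite /z !cat_path !last_cat lb le pb pe pc lc.
(* the loops with a given code, up to homotopy: no choice of a representative is needed *)
pose cls (D : set G) : set (loop R x0) :=
  [set r | exists p, [set y | code (z p) y] = D /\ loop_homotopic p r].
apply: (@sub_finite_set _ _ (cls @` [set D | D `<=` [set w : G | adj v w]])); last first.
  exact: finite_image.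
move=> _ [p _ <-]; exists [set y | code (z p) y]; first by move=> y /codeN.
apply/seteqP; split=> r /=; last by exists p.
case=> q [E]; suff H : homot (unroll q) (unroll p).
  by move=> /homotopicP h; apply/homotopicP; exact: homot_trans (homot_sym H) h.
have [pq lq Hq] := etaP q; have [pp lp Hp] := etaP p.
have [zq zql] := zP q; have [zp zpl] := zP p.
have zz : walk_homot adj v (z q) (z p).
  by apply: codeP => // y; have := congr1 (@^~ y) E => /= ->.
have [_ /(_ zq)[_ {}zz]] := walk_homot_sound x0 zz.
have pe k : path adj v0 k -> last v0 k = v0 -> is_path (walk_path v0 k) (vx x0 v0) (vx x0 v0).
  by move=> pk lk; have := walk_path_ends x0 pk; rewrite lk.
have PB : is_path (walk_path v b) (vx x0 v) (vx x0 v0) by have := walk_path_ends x0 pb; rewrite lb.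
have PC : is_path (walk_path v0 c) (vx x0 v0) (vx x0 v) by have := walk_path_ends x0 pc; rewrite lc.
have dec k : path adj v0 k -> last v0 k = v0 ->
    homot (walk_path v (b ++ k ++ c)) (pcat (walk_path v b) (pcat (walk_path v0 k) (walk_path v0 c))).
  move=> pk lk; apply: homot_sym; have PK := pe _ pk lk.
  have pkc : path adj v0 (k ++ c) by rewrite cat_path pk lk.
  have := @walk_path_cat R G x0 v b (k ++ c) pb; rewrite lb => /(_ pkc).
  apply: homot_trans.
  apply: (homot_pcat PB (pcat_path PK PC)); first by apply: homot_refl; case: PB.
  by have := @walk_path_cat R G x0 v0 k c pk; rewrite lk; apply.
have Eqp : homot (walk_path v0 (eta q)) (walk_path v0 (eta p)).
  have [PQ PP] := (pe _ pq lq, pe _ pp lp).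
  apply: (pcat_cancel_r PQ PP PC); apply: (pcat_cancel_l PB (pcat_path PQ PC) (pcat_path PP PC)).
  exact: homot_trans (homot_sym (dec _ pq lq)) (homot_trans zz (dec _ pp lp)).
apply: homot_trans Hq (homot_trans _ (homot_sym Hp)).
have A := spoke_ends x0 s0; have iA := pinv_path A; have PQ := pe _ pq lq.
have [cA _ _] := A; have [ciA _ _] := iA.
apply: (homot_pcat A (pcat_path PQ iA) (homot_refl cA)).
exact: homot_pcat PQ iA Eqp (homot_refl ciA).
Qed.

End Finiteness.

Theorem corollary2 (R : realType) (G : graph)
    (G_conn : connected_graph G)
    (G_ic : interval_condition G)
    (G_lpc : local_positioning_condition G)
    (G_fin : exists v : G, finite_set [set w : G | adj v w])
    (x0 : tsq_complex R G) :
  finite_set (pi1 R x0).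
Proof. by case: G_fin => v; apply: pi1_finite. Qed.
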